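(* Let $M \in \mathbb{R}\setminus\{0\}$. For each $L, T, \varepsilon > 0$, the control system $$\begin{cases} y_t+\varepsilon y_{xxxx}+\delta y_{xxx}+My_x=0, & (t,x)\in(0,T)\times(0,L),\\ y(t,0)=0,\quad y(t,L)=0, & t\in(0,T),\\ By(t,0)=u(t),\quad By(t,L)=0, & t\in(0,T),\\ y(0,x)=y_0(x), & x\in(0,L),\end{cases}$$ with $\delta=-2\varepsilon^{2/3}M^{1/3}$ and $By=\varepsilon y_{xx}+\frac{\delta}{2}y_x$, is null-controllable in $L^2(0,L)$: for each $y_0\in L^2(0,L)$ there exists a control $u\in L^2(0,T)$ such that the corresponding solution $y$ satisfies $y(T,\cdot)=0$.
   Context: $M^{1/3}$ denotes the real cube root. Solutions of the control system are defined by transposition. Set $B^*\varphi=\varepsilon\varphi_{xx}-\frac{\delta}{2}\varphi_x$. For $t\in(0,T]$ and $\varphi_0\in L^2(0,L)$, let $\varphi\in C([0,t];L^2(0,L))\cap L^2(0,t;H^2\cap H^1_0(0,L))$ be the solution of the (backward) adjoint system on $(0,t)\times(0,L)$: $$-\varphi_s+\varepsilon\varphi_{xxxx}-\delta\varphi_{xxx}-M\varphi_x=0,\quad \varphi(s,0)=\varphi(s,L)=0,\quad B^*\varphi(s,0)=B^*\varphi(s,L)=0,\quad \varphi(t,\cdot)=\varphi_0.$$ Given $y_0\in L^2(0,L)$ and $u\in L^2(0,T)$, a solution of the control system is a function $y=y(t,x)$ such that for every $t\in[0,T]$ one has $y(t,\cdot)\in L^2(0,L)$ and $$\int_0^L y(t,x)\varphi_0(x)\,dx=\int_0^L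 y_0(x)\varphi(0,x)\,dx+\int_0^t u(s)\varphi_x(s,0)\,ds$$ for every $\varphi_0\in L^2(0,L)$, with $\varphi$ the adjoint solution above. For each $y_0\in L^2(0,L)$ and $u\in L^2(0,T)$ the system has exactly one solution $y\in C([0,T];L^2(0,L))$. *)

(* Defs.v *)
From HB Require Import structures.
From mathcomp Require Import all_boot all_order all_algebra.
From mathcomp Require Import all_classical all_reals all_analysis.

Set Implicit Arguments.
Unset Strict Implicit.
Unset Printing Implicit Defensive.

Import Order.TTheory GRing.Theory Num.Theory.
Import numFieldNormedType.Exports.

Local Open Scope classical_set_scope.
Local Open Scope ring_scope.

(* Elements of L^2(D) are represented by (Borel) functions R -> R of which only
   the restriction to D matters, up to a Lebesgue-null set; functions of (t, x)
   are curried with the time variable first. *)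

(* powR is only meaningful on nonnegative bases, hence the sign. *)
Definition cbrt (R : realType) (a : R) : R := Num.sg a * (`|a| `^ 3^-1).

Definition critical_delta (R : realType) (eps M : R) : R :=
  - 2 * (eps `^ (2 / 3)) * cbrt M.

Definition L2 (R : realType) (D : set R) (f : R -> R) : Prop :=
  measurable_fun D f /\
  (@lebesgue_measure R).-integrable D (fun x => (f x ^+ 2)%:E).

Definition ae_zero (R : realType) (D : set R) (f : R -> R) : Prop :=
  {ae lebesgue_measure, forall x, D x -> f x = 0}.

(* C([0,t]; L^2(0,L)). *)
Definition C_L2 (R : realType) (t L : R) (f : R -> R -> R) : Prop :=
  forall s, 0 <= s <= t ->
    L2 `]0, L[ (f s) /\
    (fun r => \int[lebesgue_measure]_(x in `]0, L[) (f r x - f s x) ^+ 2)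
      @ within `[0, t] (nbhs s) --> (0 : R).

(* C^1_c(0,L), the usual test functions for Sobolev spaces on an interval. *)
Definition test_function (R : realType) (L : R) (psi : R -> R) : Prop :=
  [/\ forall x, derivable psi x 1,
      continuous (derive1 psi) &
      exists a b, [/\ 0 < a, b < L & forall x, ~~ (a <= x <= b) -> psi x = 0]].

Definition weak_derivative (R : realType) (L : R) (f g : R -> R) : Prop :=
  forall psi, test_function L psi ->
    \int[lebesgue_measure]_(x in `]0, L[) (f x * derive1 psi x) =
    - \int[lebesgue_measure]_(x in `]0, L[) (g x * psi x).

(* f belongs to H^2(0,L), with f' = f1 and f'' = f2 in the weak sense.  As
   H^2(0,L) is contained in C^1([0,L]), f and f1 are taken to be the continuous
   representatives, so that f 0, f L, f1 0 are the traces; then f and f1 lie in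
   L^2(0,L) automatically. *)
Definition H2 (R : realType) (L : R) (f f1 f2 : R -> R) : Prop :=
  [/\ {within `[0, L], continuous f}, {within `[0, L], continuous f1},
      L2 `]0, L[ f2, weak_derivative L f f1 & weak_derivative L f1 f2].

(* H^2 cap H^1_0(0,L); membership in H^1_0 is vanishing of the traces. *)
Definition H2_H10 (R : realType) (L : R) (f f1 f2 : R -> R) : Prop :=
  [/\ H2 L f f1 f2, f 0 = 0 & f L = 0].

(* L^2(0,t; H^2 cap H^1_0(0,L)), for a function phi with weak space derivatives
   phi1, phi2.  Measurability is asked up to x = 0 and x = L, which is a choice
   of representatives and makes s |-> phi1 s 0 measurable. *)
Definition L2_H2_H10 (R : realType) (t L : R) (phi phi1 phi2 : R -> R -> R)
  : Prop :=
  [/\ [/\ measurable_fun (`]0, t[ `*` `[0, L]) (fun z : R * R => phi z.1 z.2),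
          measurable_fun (`]0, t[ `*` `[0, L]) (fun z : R * R => phi1 z.1 z.2) &
          measurable_fun (`]0, t[ `*` `[0, L]) (fun z : R * R => phi2 z.1 z.2)],
      {ae lebesgue_measure, forall s, `]0, t[%classic s ->
         H2_H10 L (phi s) (phi1 s) (phi2 s)} &
      (\int[lebesgue_measure]_(s in `]0%R, t[) \int[lebesgue_measure]_(x in `]0%R, L[)
         (phi s x ^+ 2 + phi1 s x ^+ 2 + phi2 s x ^+ 2)%:E < +oo)%E].

(* B^* phi = eps phi'' - (delta/2) phi', in terms of phi1 = phi', phi2 = phi''. *)
Definition Bstar (R : realType) (eps delta : R) (phi1 phi2 : R -> R) (x : R)
  : R := eps * phi2 x - delta / 2 * phi1 x.

(* The bilinear form of A^* phi = eps phi'''' - delta phi''' - M phi' with the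
   boundary conditions phi = B^* phi = 0 at x = 0 and x = L.  Since
     A^* phi = (B^* phi)'' - (delta/2) phi''' - M phi',
   integration by parts against psi with psi 0 = psi L = 0 gives
     int (A^* phi) psi
       = - [(B^* phi) psi']_0^L
         + int ((B^* phi) psi'' + (delta/2) phi'' psi' - M phi' psi),
   so that B^* phi = 0 is the natural boundary condition. *)
Definition adjoint_form (R : realType) (L eps delta M : R)
    (phi1 phi2 psi psi1 psi2 : R -> R) : R :=
  \int[lebesgue_measure]_(x in `]0, L[)
    (Bstar eps delta phi1 phi2 x * psi2 x + delta / 2 * phi2 x * psi1 x
     - M * phi1 x * psi x).

(* phi, with phi1 = phi_x and phi2 = phi_xx, is the weak (variational) solution
   in C([0,t]; L^2) cap L^2(0,t; H^2 cap H^1_0) of the backward system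
     - phi_s + A^* phi = 0,  phi = B^* phi = 0 at x = 0 and x = L,
     phi(t) = phi0,
   the equation d/ds <phi(s), psi> = adjoint_form (phi(s), psi) being integrated
   over [s,t].  For t = 0 this reduces to phi(0) = phi0. *)
Definition adjoint_solution (R : realType) (L eps delta M t : R)
    (phi0 : R -> R) (phi phi1 phi2 : R -> R -> R) : Prop :=
  [/\ C_L2 t L phi,
      L2_H2_H10 t L phi phi1 phi2,
      ae_zero `]0, L[ (fun x => phi t x - phi0 x) &
      forall psi psi1 psi2, H2_H10 L psi psi1 psi2 ->
      forall s, 0 <= s <= t ->
        \int[lebesgue_measure]_(x in `]0, L[) (phi t x * psi x)
        - \int[lebesgue_measure]_(x in `]0, L[) (phi s x * psi x) =
        \int[lebesgue_measure]_(r in `]s, t[)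
          adjoint_form L eps delta M (phi1 r) (phi2 r) psi psi1 psi2].

(* y solves, in the sense of transposition,
     y_t + eps y_xxxx + delta y_xxx + M y_x = 0   in (0,T) x (0,L),
     y(t,0) = y(t,L) = 0,  By(t,0) = u(t),  By(t,L) = 0,  y(0,.) = y0,
   where By = eps y_xx + (delta/2) y_x; the sign in front of the control term
   is a convention (formal integration by parts gives - u phi_x(.,0)), and only
   amounts to replacing u by - u. *)
Definition transposition_solution (R : realType) (L T eps delta M : R)
    (y0 u : R -> R) (y : R -> R -> R) : Prop :=
  forall t, 0 <= t <= T ->
    L2 `]0, L[ (y t) /\
    forall phi0, L2 `]0, L[ phi0 ->
    forall phi phi1 phi2,
      adjoint_solution L eps delta M t phi0 phi phi1 phi2 ->
      \int[lebesgue_measure]_(x in `]0, L[) (y t x * phi0 x) =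
      \int[lebesgue_measure]_(x in `]0, L[) (y0 x * phi 0 x)
      + \int[lebesgue_measure]_(s in `]0, t[) (u s * phi1 s 0).

(* Main.v *)
Require Import Defs.
From HB Require Import structures.
From mathcomp Require Import all_boot all_order all_algebra.
From mathcomp Require Import all_classical all_reals all_analysis.
From mathcomp Require Import measurable_realfun ring lra.

Set Implicit Arguments.
Unset Strict Implicit.
Unset Printing Implicit Defensive.

Import Order.TTheory GRing.Theory Num.Theory.
Import numFieldNormedType.Exports.

Local Open Scope classical_set_scope.
Local Open Scope ring_scope.

(** The choice delta = - 2 eps^(2/3) M^(1/3) makes the operator factor.  Put
    m = (M / eps)^(1/3), so that delta = - 2 eps m and M = eps m^3, and let
    Q y = y'' - m y'.  Then
      eps y'''' + delta y''' + M y' = eps (Q^2 y - m^2 Q y),   B y = eps Q y,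
    so the boundary conditions say that y and Q y vanish at both ends, except
    for the control eps (Q y)(0) = u.  Hence everything is explicit: the Dirichlet
    eigenfunctions of Q are e^(m x / 2) sin(w_k x), w_k = (k + 1) pi / L, with
    eigenvalue - q_k, q_k = w_k^2 + m^2 / 4; those of the adjoint of Q are
    e_k = e^(- m x / 2) sin(w_k x), and the eigenvalues of the full operator are
    lam_k = eps q_k (q_k + m^2), which grow like k^4.

    Testing the transposition identity with the adjoint solution
    e^(- lam_k (t - s)) e_k, whose trace derivative at x = 0 is
    w_k e^(- lam_k (t - s)), gives the coefficients of the state,
      <y(t), e_k> = e^(- lam_k t) (<y0, e_k> + w_k int_0^t u(s) e^(lam_k s) ds).
    As the e_k are complete, y(T) = 0 is the moment problem
      int_0^T u(s) e^(lam_k s) ds = - <y0, e_k> / w_k   for all k,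
    with a bounded right-hand side.  It is solved in [moment_problem] by a
    Newton interpolation: [pulse n] combines translates of an indicator function
    in such a way that its n first moments vanish, and u is a series
    sum_n b_n pulse_n whose coefficients are found one after the other.  The
    translations have lengths h_j of order 1 / j^2, which is summable, whereas
    (lam_n - lam_j) h_j tends to infinity with n uniformly in j < n by
    [decay_gap]; this makes the series converge absolutely.

    The statement also asks for a solution in C([0,T]; L^2).  The state is
    defined by the coefficients above, and three facts are needed to see that it
    satisfies the transposition identity for every final datum.
    - The sines are complete in L^2(0,L) ([sine_approx_L2]), whence Parseval's
      identity for the biorthogonal families e^(m x / 2) sin(w_k x) and e_k.
      Density is obtained from the Bernstein operators in the variable
      (1 + cos(pi x / L)) / 2, applied to the quotient of a function by
      sin(pi x / L).
    - Every weak adjoint solution has the expected coefficients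
      ([adjoint_coef]): a mode may be taken as test function, and the resulting
      scalar integral equation has one solution by Gronwall's argument.  This
      rests on an integration by parts for weak derivatives up to the boundary
      ([weak_IBP]).
    - The trace phi_x(s, 0) is the sum of the series of traces of the modes
      ([trace_series]), because it is an inner product of the L^2 function
      phi_xx + m phi_x with a fixed function. *)

(** * Integration on a bounded interval *)
Section Integration.
Context {R : realType}.
Local Notation RM := (measurableTypeR R).
Local Notation mu := (@lebesgue_measure R).
Local Notation meas := (@measurable _ RM).
Local Notation mfun := (@measurable_fun _ _ RM R).
Implicit Types (D : set RM) (f g h : RM -> R) (a b c : R).

Definition intg D f := mu.-integrable D (EFin \o f).

Lemma intg_meas D f : meas D -> intg D f -> mfun D f.
Proof. by move=> mD /integrableP[/measurable_EFinP]. Qed.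

Lemma itvoo_meas a b : meas `]a, b[.
Proof. exact: measurable_itv. Qed.

Lemma itvoo_fin a b : (mu `]a, b[%classic < +oo)%E.
Proof. by rewrite lebesgue_measure_itv /=; case: ifPn => _; rewrite ?ltry. Qed.

Lemma cont_meas D (f : R -> R) : meas D -> continuous f -> mfun D f.
Proof.
by move=> mD cf; apply: measurable_funS (continuous_measurable_fun cf).
Qed.

Lemma bnd_intg D f c : meas D -> (mu D < +oo)%E -> mfun D f ->
  (forall x, D x -> `|f x| <= c) -> intg D f.
Proof.
move=> mD fD mf fc; apply: measurable_bounded_integrable => //.
exists c; split; first exact: num_real.
by move=> M cM x Dx; apply: le_trans (fc x Dx) (ltW cM).
Qed.

Lemma intgM_bnd D f h c : meas D -> intg D f -> mfun D h ->
  (forall x, D x -> `|h x| <= c) -> intg D (fun x => f x * h x).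
Proof.
move=> mD If mh hc.
have mf := intg_meas mD If.
have : intg D (fun x => `|c| * `|f x|).
  rewrite /intg; have := integrableZl mD `|c| (integrable_norm If).
  by apply: eq_integrable => // x _ /=.
apply: le_integrable => //.
  by apply/measurable_EFinP; exact: measurable_funM.
move=> x Dx /=; rewrite lee_fin normrM mulrC [leRHS]ger0_norm ?mulr_ge0//.
rewrite ler_wpM2r//; apply: le_trans (hc x Dx) _; exact: ler_norm.
Qed.

Lemma intgM_bndl D f h c : meas D -> intg D f -> mfun D h ->
  (forall x, D x -> `|h x| <= c) -> intg D (fun x => h x * f x).
Proof.
move=> mD If mh hc; have := intgM_bnd mD If mh hc.
by congr intg; apply/funext => x; rewrite mulrC.
Qed.

Lemma intgD D f g : meas D -> intg D f -> intg D g ->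
  intg D (fun x => f x + g x).
Proof.
by move=> mD If Ig; have := integrableD mD If Ig; apply: eq_integrable.
Qed.

Lemma intgB D f g : meas D -> intg D f -> intg D g ->
  intg D (fun x => f x - g x).
Proof.
by move=> mD If Ig; have := integrableB mD If Ig; apply: eq_integrable.
Qed.

Lemma intgZ D c f : meas D -> intg D f -> intg D (fun x => c * f x).
Proof.
by move=> mD If; have := integrableZl mD c If; apply: eq_integrable.
Qed.

Lemma intg0 D : intg D (fun=> 0).
Proof. exact: integrable0. Qed.

Lemma intg_sum D (F : nat -> R -> R) n : meas D ->
  (forall i, intg D (F i)) -> intg D (fun x => \sum_(i < n) F i x).
Proof.
move=> mD IF; elim: n => [|n IH].
  by under eq_fun do rewrite big_ord0; exact: intg0.
by under eq_fun do rewrite big_ord_recr /=; exact: intgD.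
Qed.

Lemma Rint_sum D (F : nat -> R -> R) n : meas D ->
  (forall i, intg D (F i)) ->
  \int[mu]_(x in D) (\sum_(i < n) F i x) = \sum_(i < n) \int[mu]_(x in D) F i x.
Proof.
move=> mD IF; elim: n => [|n IH].
  rewrite big_ord0; under eq_Rintegral do rewrite big_ord0.
  by rewrite Rintegral_cst// mul0r.
rewrite big_ord_recr /= -IH -RintegralD//; last 2 first.
- exact: intg_sum.
- exact: IF.
by apply: eq_Rintegral => x _; rewrite big_ord_recr.
Qed.

Lemma RintZl D c f : meas D -> intg D f ->
  \int[mu]_(x in D) (c * f x) = c * \int[mu]_(x in D) f x.
Proof. by move=> mD If; rewrite RintegralZl. Qed.

Lemma RintD D f g : meas D -> intg D f -> intg D g ->
  \int[mu]_(x in D) (f x + g x) = \int[mu]_(x in D) f x + \int[mu]_(x in D) g x.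
Proof. exact: RintegralD. Qed.

Lemma RintB D f g : meas D -> intg D f -> intg D g ->
  \int[mu]_(x in D) (f x - g x) = \int[mu]_(x in D) f x - \int[mu]_(x in D) g x.
Proof. exact: RintegralB. Qed.

Lemma eq_Rint D f g : (forall x, D x -> f x = g x) ->
  \int[mu]_(x in D) f x = \int[mu]_(x in D) g x.
Proof. by move=> fg; apply: eq_Rintegral => x /set_mem; exact: fg. Qed.

Lemma Rint_ae D f g : meas D -> mfun D f -> mfun D g ->
  {ae mu, forall x, D x -> f x = g x} ->
  \int[mu]_(x in D) f x = \int[mu]_(x in D) g x.
Proof.
move=> mD mf mg fg; rewrite /Rintegral; congr fine.
apply: ae_eq_integral => //; [exact/measurable_EFinP|exact/measurable_EFinP|].
by apply: filterS fg => x /= fg /fg ->.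
Qed.

Lemma Rint_dct D (F : nat -> R -> R) f g : meas D ->
  (forall n, mfun D (F n)) -> mfun D f ->
  {ae mu, forall x, D x -> F ^~ x @ \oo --> f x} ->
  intg D g -> (forall n x, D x -> `|F n x| <= g x) ->
  intg D f /\
  (fun n => \int[mu]_(x in D) F n x) @ \oo --> \int[mu]_(x in D) f x.
Proof.
move=> mD mF mf Ff Ig Fg.
have [] := @dominated_convergence _ _ _ mu D mD (fun n x => (F n x)%:E)
   (EFin \o f) (EFin \o g).
- by move=> n; exact/measurable_EFinP.
- exact/measurable_EFinP.
- apply: filterS Ff => x /= Ff Dx; apply: cvg_EFin; last exact: Ff.
  by apply: nearW.
- by [].
- by apply: aeW => /= x n Dx; rewrite lee_fin Fg.
move=> If _ cF; split => //.
rewrite /Rintegral; apply: fine_cvg; rewrite fineK//.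
exact: integrable_fin_num.
Qed.

Lemma intg_L2M D f g : meas D -> L2 D f -> L2 D g ->
  intg D (fun x => f x * g x).
Proof.
move=> mD [mf If] [mg Ig].
have : intg D (fun x => f x ^+ 2 + g x ^+ 2) by exact: intgD.
apply: le_integrable => //.
  by apply/measurable_EFinP; exact: measurable_funM.
move=> x Dx /=; rewrite lee_fin [leRHS]ger0_norm; last first.
  by rewrite addr_ge0// sqr_ge0.
rewrite ler_norml; nra.
Qed.

Lemma L2D D f g : meas D -> L2 D f -> L2 D g -> L2 D (fun x => f x + g x).
Proof.
move=> mD Lf Lg; have Ifg := intg_L2M mD Lf Lg.
move: Lf Lg => [mf If] [mg Ig]; split; first exact: measurable_funD.
have : intg D (fun x => (f x ^+ 2 + 2 * (f x * g x)) + g x ^+ 2).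
  by apply: intgD => //; apply: intgD => //; exact: intgZ.
by apply: eq_integrable => // x _ /=; congr EFin; ring.
Qed.

Lemma L2Z D c f : meas D -> L2 D f -> L2 D (fun x => c * f x).
Proof.
move=> mD [mf If]; split; first exact: measurable_funM.
have : intg D (fun x => c ^+ 2 * f x ^+ 2) by exact: intgZ.
by apply: eq_integrable => // x _ /=; rewrite exprMn.
Qed.

Lemma L2B D f g : meas D -> L2 D f -> L2 D g -> L2 D (fun x => f x - g x).
Proof.
move=> mD Lf Lg; have := L2D mD Lf (L2Z (-1) mD Lg).
by congr L2; apply/funext => x; rewrite mulN1r.
Qed.

Lemma L2_bnd D f c : meas D -> (mu D < +oo)%E -> mfun D f ->
  (forall x, D x -> `|f x| <= c) -> L2 D f.
Proof.
move=> mD fD mf fc; split => //; apply: (@bnd_intg _ _ (c ^+ 2)) => //.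
  exact: measurable_funX.
by move=> x Dx; rewrite normrX lerXn2r// ?nnegrE// (le_trans _ (fc x Dx)).
Qed.

Lemma L2M_bnd D f h c : meas D -> L2 D f -> mfun D h ->
  (forall x, D x -> `|h x| <= c) -> L2 D (fun x => f x * h x).
Proof.
move=> mD [mf If] mh hc; split; first exact: measurable_funM.
have : intg D (fun x => f x ^+ 2 * h x ^+ 2).
  apply: (@intgM_bnd _ _ _ (c ^+ 2)) => //; first exact: measurable_funX.
  by move=> x Dx; rewrite normrX lerXn2r// ?nnegrE// (le_trans _ (hc x Dx)).
by apply: eq_integrable => // x _ /=; rewrite exprMn.
Qed.

Lemma L2_intg D f : meas D -> (mu D < +oo)%E -> L2 D f -> intg D f.
Proof.
move=> mD fD Lf.
have := @intg_L2M D f (fun=> 1) mD Lf.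
have -> : (fun x => f x * 1) = f by apply/funext => x; rewrite mulr1.
by apply; apply: (@L2_bnd _ _ 1) => // x _; rewrite normr1.
Qed.

Lemma L2_sum D (F : nat -> R -> R) n : meas D -> (mu D < +oo)%E ->
  (forall i, L2 D (F i)) -> L2 D (fun x => \sum_(i < n) F i x).
Proof.
move=> mD fD IF; elim: n => [|n IH].
  under eq_fun do rewrite big_ord0.
  by apply: (@L2_bnd _ _ 0) => // x _; rewrite normr0.
by under eq_fun do rewrite big_ord_recr /=; exact: L2D.
Qed.

Lemma within_bnd a b (f : R -> R) : {within `[a, b], continuous f} ->
  exists c, forall x, a <= x <= b -> `|f x| <= c.
Proof.
move=> cf.
have /compact_bounded[c [_ fc]] := continuous_compact cf (@segment_compact _ a b).
exists (c + 1) => x abx; apply: (fc (c + 1)); first by rewrite ltrDl.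
by exists x => //=; rewrite in_itv.
Qed.

Lemma within_meas a b (f : R -> R) : {within `[a, b], continuous f} ->
  mfun `]a, b[ f.
Proof.
move=> cf; have /integrableP[/measurable_EFinP mf _] :=
  continuous_compact_integrable (@segment_compact R a b) cf.
by apply: measurable_funS mf => //; exact: subset_itv_oo_cc.
Qed.

Lemma within_L2 a b (f : R -> R) : {within `[a, b], continuous f} -> L2 `]a, b[ f.
Proof.
move=> cf; have [c fc] := within_bnd cf.
apply: (@L2_bnd _ _ c); [exact: itvoo_meas|exact: itvoo_fin|exact: within_meas|].
by move=> x; rewrite /= in_itv/= => /andP[/ltW ax /ltW xb]; apply: fc; rewrite ax.
Qed.

Lemma cont_within (D : set R) (f : R -> R) : continuous f -> {within D, continuous f}.
Proof. exact: continuous_subspaceT. Qed.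

Lemma RintFTC a b (f F : R -> R) : a <= b -> (forall x : R, is_derive x 1 F (f x)) ->
  continuous f -> \int[mu]_(x in `]a, b[) f x = F b - F a.
Proof.
rewrite le_eqVlt => /predU1P[->|ab] dF cf.
  by rewrite set_itvoo0 Rintegral_set0 subrr.
have cF : continuous F.
  by move=> x; apply: differentiable_continuous; apply/derivable1_diffP; case: (dF x).
have cF' : derivable_oo_LRcontinuous F a b.
  split=> [x _||]; [by case: (dF x) | |].
    by apply: cvg_at_right_filter; exact: cF.
  by apply: cvg_at_left_filter; exact: cF.
have Icc : mu.-integrable `[a, b] (EFin \o f).
  by apply: continuous_compact_integrable; [exact: segment_compact|exact: cont_within].
rewrite Rintegral_itv_bndo_bndc; last first.
  by apply: integrableS Icc => //; exact: subset_itv_oo_cc.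
rewrite Rintegral_itv_obnd_cbnd; last first.
  by apply: integrableS Icc => //; exact: subset_itv_oc_cc.
rewrite /Rintegral (continuous_FTC2 ab (cont_within cf) cF')//.
by move=> x _; rewrite derive1E; apply: derive_val.
Qed.

Lemma continuous_is_derive (f h : R -> R) : (forall x : R, is_derive x 1 f (h x)) -> continuous f.
Proof.
move=> df x; apply: differentiable_continuous; apply/derivable1_diffP.
by case: (df x).
Qed.

Lemma Rint_cst a b c : a <= b -> \int[mu]_(x in `]a, b[) c = c * (b - a).
Proof.
move=> ab; rewrite mulrBr; apply: (@RintFTC a b (fun=> c) ( *%R c)) => //.
  by move=> x; apply: is_derive_eq; rewrite /GRing.scale/= mulr1.
exact: cst_continuous.
Qed.

Lemma cont_expM (z : R) : continuous (fun s : R => expR (z * s)).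
Proof.
move=> x; apply: continuous_comp; last exact: continuous_expR.
by apply: mulrl_continuous.
Qed.

Global Instance expM_derive (z x : R) :
  is_derive x 1 (fun s : R => expR (z * s)) (z * expR (z * x)).
Proof.
have := @is_derive1_comp R expR ( *%R z) x _ z (is_derive_expR _).
have d : is_derive x 1 ( *%R z) z by apply: is_derive_eq; rewrite /GRing.scale/= mulr1.
by move=> /(_ d); rewrite mulrC.
Qed.

Lemma is_derive_scale (c f' x : R) (f : R -> R) : is_derive x 1 f f' ->
  is_derive x 1 (fun y => c * f y) (c * f').
Proof. by move=> df; apply: is_derive_eq; rewrite /GRing.scale/=; ring. Qed.

Lemma RintIBP a b (f f' h h' : R -> R) : a <= b -> (forall x : R, is_derive x 1 f (f' x)) ->
  (forall x : R, is_derive x 1 h (h' x)) -> continuous f' -> continuous h' ->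
  \int[mu]_(x in `]a, b[) (f' x * h x) =
  f b * h b - f a * h a - \int[mu]_(x in `]a, b[) (f x * h' x).
Proof.
move=> ab df dh cf' ch'.
have cf := continuous_is_derive df; have ch := continuous_is_derive dh.
have mI := itvoo_meas a b.
have cL (g : R -> R) : continuous g -> L2 `]a, b[ g by move=> cg; apply: within_L2; exact: cont_within.
have <- : \int[mu]_(x in `]a, b[) (f' x * h x + f x * h' x) =
    f b * h b - f a * h a.
  apply: (@RintFTC a b _ (fun x => f x * h x)) => //.
    by move=> x; apply: is_derive_eq; rewrite /GRing.scale/=; ring.
  by move=> x; apply: cvgD; apply: cvgM; [exact: cf'|exact: ch|exact: cf|exact: ch'].
by rewrite RintegralD ?addrK//; apply: intg_L2M => //; exact: cL.
Qed.

End Integration.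

(** * Dominated series *)
Section DominatedSeries.
Context {R : realType}.
Local Notation RM := (measurableTypeR R).
Local Notation mu := (@lebesgue_measure R).
Local Notation meas := (@measurable _ RM).
Local Notation mfun := (@measurable_fun _ _ RM R).

Lemma sum_cvg_dominated (g G : nat -> R) (c : R) :
  (forall n, `|g n| <= G n) -> (forall n, \sum_(i < n) G i <= c) ->
  exists2 l, (fun n => \sum_(i < n) g i) @ \oo --> l & `|l| <= c.
Proof.
move=> gG Gc.
have cn : cvgn [normed series g].
  apply: nondecreasing_is_cvgn; first by apply: (@nondecreasing_series _ (fun n => `|g n|) xpredT 0).
  exists c => _ [n _ <-]; rewrite ?/normed_series_of ?/series /= big_mkord.
  by apply: le_trans (Gc n); exact: ler_sum.
have cg := normed_cvg cn.
have E : series g = (fun n => \sum_(i < n) g i).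
  by apply/funext => n; rewrite ?/normed_series_of ?/series /= big_mkord.
exists (limn (series g)); first by rewrite -E.
apply: le_trans (lim_series_norm cn) _; apply: limr_le => //.
apply: nearW => n; rewrite ?/normed_series_of ?/series /= big_mkord.
by apply: le_trans (Gc n); exact: ler_sum.
Qed.

(** A Weierstrass test together with termwise integration against an arbitrary
    integrable function.  It is used twice: in time, to build the control, and
    in space, to build a function with prescribed sine coefficients. *)
Lemma dominated_series (D : set RM) (g : nat -> RM -> R) (G : nat -> R) (c : R) :
  meas D -> (forall n, mfun D (g n)) ->
  (forall n x, D x -> `|g n x| <= G n) -> (forall n, \sum_(i < n) G i <= c) ->
  exists F : R -> R,
    [/\ mfun D F, forall x, D x -> `|F x| <= c,
        forall x, D x -> (fun n => \sum_(i < n) g i x) @ \oo --> F x &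
        forall h, intg D h ->
          (fun n => \sum_(i < n) \int[mu]_(x in D) (g i x * h x)) @ \oo -->
          \int[mu]_(x in D) (F x * h x)].
Proof.
move=> mD mg gG Gc.
pose F x := limn (fun n => \sum_(i < n) g i x).
have FP x : D x -> (fun n => \sum_(i < n) g i x) @ \oo --> F x /\ `|F x| <= c.
  move=> Dx; have [l gl lc] := @sum_cvg_dominated (g ^~ x) G c (gG^~ x^~ Dx) Gc.
  by rewrite /F (cvg_lim _ gl).
have mS n : mfun D (fun x => \sum_(i < n) g i x) by exact: measurable_sum.
have mF : mfun D F by apply: (measurable_fun_cvg mS) => x /FP[].
exists F; split => //; [by move=> x /FP[]|by move=> x /FP[]|].
move=> h Ih; have mh := intg_meas mD Ih.
have -> : (fun n => \sum_(i < n) \int[mu]_(x in D) (g i x * h x)) =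
    (fun n => \int[mu]_(x in D) (\sum_(i < n) g i x * h x)).
  apply/funext => n; rewrite (@Rint_sum _ D (fun i x => g i x * h x))//.
  by move=> i; apply: (@intgM_bndl _ _ _ _ (G i)) => // x Dx; exact: gG.
have := @Rint_dct _ D (fun n x => \sum_(i < n) g i x * h x)
  (fun x => F x * h x) (fun x => c * `|h x|) mD.
case=> //.
- move=> n; apply: measurable_sum => i; exact: measurable_funM.
- exact: measurable_funM.
- apply: aeW => x Dx; have [cF _] := FP x Dx.
  by under eq_fun do rewrite -mulr_suml; apply: cvgM => //; exact: cvg_cst.
- apply: intgZ => //; exact: integrable_norm.
- move=> n x Dx; rewrite -mulr_suml normrM ler_wpM2r//.
  apply: le_trans (ler_norm_sum _ _ _) _; apply: le_trans (Gc n).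
  by apply: ler_sum => i _; exact: gG.
Qed.

End DominatedSeries.

(** * The moment problem for real exponentials *)
Section Moments.
Context {R : realType}.
Local Notation RM := (measurableTypeR R).
Local Notation mu := (@lebesgue_measure R).
Local Notation meas := (@measurable _ RM).
Local Notation mfun := (@measurable_fun _ _ RM R).
Variables (lam h a : nat -> R) (T T0 A : R) (N0 : nat).
Hypotheses (T00 : 0 < T0) (h0 : forall j, 0 < h j)
  (hT : forall n, \sum_(j < n) h j + T0 <= T)
  (lam0 : forall n, 0 < lam n) (lamI : forall j n, (j < n)%N -> lam j < lam n)
  (lamh : forall j n, (j < n)%N -> (N0 <= n)%N -> 6 <= (lam n - lam j) * h j)
  (aA : forall n, `|a n| <= A).

(** [pulse n p] is the product over j < n of the operators
    1 - e^(- lam_j h_j) (translation by h_j), applied to the indicator function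
    of ]p, p + T0[.  Translating by h_j multiplies the exponential moment at z by
    e^(z h_j), so each operator contributes to the moment the factor
    1 - e^((z - lam_j) h_j), which vanishes at z = lam_j. *)
Fixpoint pulse n (p s : R) : R :=
  if n is n'.+1 then
    pulse n' p s - expR (- lam n' * h n') * pulse n' (p + h n') s
  else \1_`]p, p + T0[ s.

(** The exponential moment at z of [pulse n 0], see [pulse_moment]. *)
Definition pulse_hat n (z : R) : R :=
  \prod_(j < n) (1 - expR ((z - lam j) * h j)) * ((expR (z * T0) - 1) / z).

Lemma pulse_meas n p (D : set RM) : meas D -> mfun D (pulse n p).
Proof.
move=> mD; elim: n p => [|n IH] p /=.
  by apply: measurable_indic; exact: itvoo_meas.
by apply: measurable_funB; [exact: IH|apply: measurable_funM => //; exact: IH].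
Qed.

Lemma pulse_bnd n p s : `|pulse n p s| <= 2 ^+ n.
Proof.
elim: n p => [|n IH] p /=.
  by rewrite indicE; case: (_ \in _); rewrite ?normr0 ?normr1.
apply: le_trans (ler_normB _ _) _; rewrite normrM (ger0_norm (expR_ge0 _)).
rewrite exprS mulrDl mul1r lerD//.
rewrite -[leRHS]mul1r ler_pM ?expR_ge0//.
by rewrite -expR0 ler_expR mulNr oppr_le0 mulr_ge0// ltW.
Qed.

Lemma pulse_moment n (p z : R) : z != 0 -> 0 <= p -> p + \sum_(j < n) h j + T0 <= T ->
  \int[mu]_(s in `]0, T[) (pulse n p s * expR (z * s)) =
  expR (z * p) * pulse_hat n z.
Proof.
move=> z0; have mD := itvoo_meas 0 T.
have I n' p' : intg `]0, T[ (fun s => pulse n' p' s * expR (z * s)).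
  apply: (@intgM_bndl _ _ _ _ (2 ^+ n')) => //; last 2 first.
  - exact: pulse_meas.
  - by move=> s _; exact: pulse_bnd.
  apply: L2_intg => //; first exact: itvoo_fin.
  by apply: within_L2; apply: cont_within; exact: cont_expM.
elim: n p => [|n IH] p p0 pT.
  rewrite /= /pulse_hat big_ord0 mul1r.
  rewrite (_ : \int[mu]_(s in _) _ = \int[mu]_(s in `]p, p + T0[) expR (z * s)).
    transitivity (z^-1 * expR (z * (p + T0)) - z^-1 * expR (z * p)).
      apply: (@RintFTC _ p (p + T0) _ (fun s => z^-1 * expR (z * s))).
      - by rewrite lerDl ltW.
      - by move=> x; apply: is_derive_eq; rewrite /GRing.scale/=; field.
      - exact: cont_expM.
    by rewrite mulrDr expRD; field.
  have sub : `]p, p + T0[ `<=` `]0, T[.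
    rewrite big_ord0 addr0 in pT.
    by apply: subset_itv; rewrite bnd_simp.
  rewrite -[in RHS](setIidr sub) Rintegral_mkcondr; apply: eq_Rint => s _.
  rewrite patchE indicE.
  by case: (s \in _); rewrite ?mul1r ?mul0r.
rewrite big_ord_recr /= in pT.
have hs : 0 <= \sum_(j < n) h j by apply: sumr_ge0 => i _; exact: ltW.
have hn := h0 n.
transitivity (\int[mu]_(s in `]0, T[) (pulse n p s * expR (z * s)) -
   expR (- lam n * h n) *
   \int[mu]_(s in `]0, T[) (pulse n (p + h n) s * expR (z * s))).
  rewrite -RintZl// -RintB//; last exact: intgZ.
  by apply: eq_Rint => s _ /=; ring.
rewrite !IH//; [|lra..].
rewrite /pulse_hat big_ord_recr /= (mulrDr z p) (expRD (z * p)).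
rewrite (mulrBl (h n) z) (expRD (z * h n)) -(mulNr (lam n)).
by ring.
Qed.

(** Newton's interpolation scheme: since [pulse_hat n] vanishes at the nodes
    lam_0, ..., lam_(n-1), adding a multiple of it repairs the value at lam_n
    without spoiling the earlier ones. *)
Fixpoint interpolant n (z : R) : R :=
  if n is n'.+1 then
    interpolant n' z +
    (a n' - interpolant n' (lam n')) / pulse_hat n' (lam n') * pulse_hat n' z
  else 0.

Let b n : R := (a n - interpolant n (lam n)) / pulse_hat n (lam n).

Lemma interpolant_sum n z : interpolant n z = \sum_(i < n) b i * pulse_hat i z.
Proof. by elim: n => [|n IH]; rewrite ?big_ord0// big_ord_recr /= IH. Qed.

Lemma pulse_hat_gt k n : (k < n)%N -> pulse_hat n (lam k) = 0.
Proof.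
by move=> kn; rewrite /pulse_hat (bigD1 (Ordinal kn))//= subrr mul0r expR0 subrr !mul0r.
Qed.

Lemma base_ge z : 0 < z -> T0 <= (expR (z * T0) - 1) / z.
Proof.
move=> z0; rewrite ler_pdivlMr// lerBrDr mulrC addrC; exact: expR_ge1Dx.
Qed.

Lemma pulse_hat_neq0 n : pulse_hat n (lam n) != 0.
Proof.
rewrite mulf_neq0//; last by apply: lt0r_neq0; exact: lt_le_trans (base_ge (lam0 n)).
apply/prodf_neq0 => j _; rewrite subr_eq0 eq_sym; apply/eqP => E.
have : (lam n - lam j) * h j = 0 by apply: expR_inj; rewrite expR0.
apply/eqP; rewrite mulf_neq0// ?subr_eq0 ?gt_eqF//; exact: lamI.
Qed.

Lemma interpolant_node k n : (k < n)%N -> interpolant n (lam k) = a k.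
Proof.
elim: n => // n IH; rewrite ltnS leq_eqVlt => /predU1P[->|kn] /=.
  by rewrite divfK ?pulse_hat_neq0// addrC subrK.
by rewrite IH// (pulse_hat_gt kn); ring.
Qed.

(** Each of the k factors between [pulse_hat i] and [pulse_hat (i + k)] has the
    form 1 - e^x with x >= 6, hence modulus at least x >= 6. *)
Lemma pulse_hat_ratio i k n : (N0 <= n)%N -> (i + k <= n)%N ->
  `|pulse_hat i (lam n)| * 6 ^+ k <= `|pulse_hat (i + k) (lam n)|.
Proof.
move=> Nn; elim: k => [|k IH] ikn; first by rewrite expr0 mulr1 addn0.
rewrite addnS in ikn; have {}IH := IH (ltnW ikn).
have -> : pulse_hat (i + k.+1) (lam n) = pulse_hat (i + k) (lam n) *
    (1 - expR ((lam n - lam (i + k)%N) * h (i + k)%N)).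
  by rewrite addnS /pulse_hat big_ord_recr /=; ring.
rewrite exprSr mulrA [leRHS]normrM.
rewrite ler_pM ?mulr_ge0 ?exprn_ge0//.
have := lamh ikn Nn; set x := (_ * h _) => x6.
by rewrite distrC ler_normr; have := expR_ge1Dx x; move: (expR x) => y; lra.
Qed.

Let beta n : R := 2 ^+ n * `|b n|.
(** The bound 6 on the ratios loses a factor 2 per step to the growth of the
    pulses ([pulse_bnd]); what remains is a discount by 3 per step. *)
Let past n : R := \sum_(m < n) beta m * (3^-1) ^+ (n - m).

Lemma pastS n : past n.+1 = (past n + beta n) / 3.
Proof.
rewrite /past big_ord_recr /= subSnn expr1 mulrDl; congr (_ + _).
rewrite mulr_suml; apply: eq_bigr => i _.
by rewrite subSn 1?ltnW// exprSr mulrA.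
Qed.

Lemma past_ge0 n : 0 <= past n.
Proof.
by apply: sumr_ge0 => i _; rewrite !mulr_ge0 ?exprn_ge0 ?invr_ge0.
Qed.

Let pow6 n : (6 : R) ^+ n = 3 ^+ n * 2 ^+ n.
Proof. by rewrite -exprMn; congr (_ ^+ _); ring. Qed.

(** The n-th coefficient is (a_n - sum_(i < n) b_i pulse_hat_i(lam_n)) divided by
    pulse_hat_n(lam_n): the quotients of the pulse_hat decay geometrically, and
    the term a_n / pulse_hat_n(lam_n) is at most A / (T0 6^n). *)
Lemma beta_le n : (N0 <= n)%N -> beta n <= A / T0 * 3^-1 ^+ n + past n.
Proof.
move=> Nn.
have A0 : 0 <= A by exact: le_trans (aA 0).
pose D : R := `|pulse_hat n (lam n)|.
have D0 : 0 < D by rewrite normr_gt0 pulse_hat_neq0.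
have D6 : T0 * 6 ^+ n <= D.
  have := @pulse_hat_ratio 0 n n Nn (leqnn _); apply: le_trans.
  rewrite ler_wpM2r ?exprn_ge0// /pulse_hat big_ord0 mul1r.
  apply: le_trans (base_ge (lam0 n)) _; exact: ler_norm.
rewrite /beta {1}/b normrM normfV -/D mulrA ler_pdivrMr//.
apply: (@le_trans _ _ (2 ^+ n * A + 2 ^+ n * `|interpolant n (lam n)|)).
  rewrite -mulrDr ler_wpM2l ?exprn_ge0//.
  by apply: le_trans (ler_normB _ _) _; rewrite lerD2r.
rewrite mulrDl lerD//.
  have K0 : 0 <= A / T0 * 3^-1 ^+ n by rewrite !mulr_ge0 ?exprn_ge0 ?invr_ge0// ltW.
  have := ler_wpM2l K0 D6; apply: le_trans.
  rewrite pow6.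
  rewrite le_eqVlt exprVn; apply/orP; left; apply/eqP; field.
  by rewrite expf_neq0//= lt0r_neq0.
rewrite interpolant_sum /past mulr_suml.
apply: (@le_trans _ _ (2 ^+ n * \sum_(i < n) `|b i * pulse_hat i (lam n)|)).
  by rewrite ler_wpM2l ?exprn_ge0// ler_norm_sum.
rewrite mulr_sumr; apply: ler_sum => -[i /= ilt] _.
have := @pulse_hat_ratio i (n - i)%N n Nn; rewrite (subnKC (ltnW ilt)) => /(_ (leqnn _)).
rewrite -/D => H.
have K0 : 0 <= beta i * 3^-1 ^+ (n - i) by rewrite !mulr_ge0 ?exprn_ge0 ?invr_ge0.
have := ler_wpM2l K0 H; apply: le_trans.
rewrite normrM (_ : 2 ^+ n = 2 ^+ i * 2 ^+ (n - i))//; last first.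
  by rewrite -exprD (subnKC (ltnW ilt)).
rewrite pow6.
rewrite le_eqVlt /beta exprVn; apply/orP; left; apply/eqP; field.
by rewrite expf_neq0.
Qed.

(** By [beta_le] and [pastS], the quantity
    W_n = sum_(i < n) beta_i + 3 past_n + 3 (A / T0) 3^(-n) is nonincreasing from
    n = N0 on. *)
Lemma beta_summable : exists c, forall n, \sum_(i < n) beta i <= c.
Proof.
have A0 : 0 <= A by exact: le_trans (aA 0).
pose K := A / T0; have K0 : 0 <= K by rewrite divr_ge0// ltW.
have beta0 n : 0 <= beta n by rewrite mulr_ge0 ?exprn_ge0.
pose W n : R := \sum_(i < n) beta i + 3 * past n + 3 * K * 3^-1 ^+ n.
have W1 n : (N0 <= n)%N -> W n.+1 <= W n.
  move=> /beta_le; rewrite -/K /W big_ord_recr/= pastS exprSr.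
  by move: (3^-1 ^+ n) => e; lra.
have W2 k : W (N0 + k)%N <= W N0.
  elim: k => [|k]; first by rewrite addn0.
  by apply: le_trans; rewrite addnS; apply: W1; exact: leq_addr.
have WS n : \sum_(i < n) beta i <= W n.
  rewrite /W -addrA lerDl addr_ge0// ?mulr_ge0 ?exprn_ge0 ?invr_ge0//.
    exact: past_ge0.
  exact: ltW.
apply: (ex_intro _ (W N0)) => n.
have [nN|Nn] := leqP n N0; last first.
  by rewrite -(subnKC (ltnW Nn)); apply: le_trans (WS _) (W2 _).
apply: le_trans (WS N0); rewrite -(subnKC nN) big_split_ord/= lerDl.
by apply: sumr_ge0.
Qed.

Lemma moment_problem : exists u : R -> R,
  [/\ mfun `]0, T[ u, (exists c, forall s, `]0, T[%classic s -> `|u s| <= c) &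
    forall k, \int[mu]_(s in `]0, T[) (u s * expR (lam k * s)) = a k].
Proof.
have mD := itvoo_meas 0 T.
have [c Sc] := beta_summable.
have [//||||u [mu_ uc _ Iu]] := @dominated_series _ `]0, T[
   (fun n s => b n * pulse n 0 s) beta c.
- by move=> n; apply: measurable_funM => //; exact: pulse_meas.
- move=> n s _; rewrite normrM /beta mulrC ler_wpM2r//; exact: pulse_bnd.
- exact: Sc.
exists u; split => //; first by exists c.
move=> k; have Ie : intg `]0, T[ (fun s => expR (lam k * s)).
  apply: L2_intg => //; first exact: itvoo_fin.
  by apply: within_L2; apply: cont_within; exact: cont_expM.
have cu := Iu _ Ie.
have E n : \int[mu]_(s in `]0, T[) (b n * pulse n 0 s * expR (lam k * s)) =
    b n * pulse_hat n (lam k).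
  under eq_Rintegral do rewrite -mulrA.
  rewrite RintZl//; last first.
    apply: (@intgM_bndl _ _ _ _ (2 ^+ n)) => //; first exact: pulse_meas.
    by move=> s _; exact: pulse_bnd.
  by rewrite pulse_moment ?lt0r_neq0// ?add0r// mulr0 expR0 mul1r.
apply: (cvg_unique _ cu) => //.
apply: cvg_near_cst; exists k.+1 => // n /= kn.
rewrite -(interpolant_node kn) interpolant_sum; apply: eq_bigr => i _; exact: E.
Qed.

End Moments.

(** * Bernstein operators as random walks *)
Section RandomWalk.
Context {R : realType}.
Implicit Types (phi psi : nat -> R) (z : R).

(** The expectation of phi at the position of a walker who starts at j and
    makes n steps, each being + 1 with probability z and 0 otherwise.  With
    phi i = H (i / n) and j = 0 this is the Bernstein polynomial of H at z;
    the recursion avoids binomial coefficients altogether. *)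
Fixpoint walk z n phi j : R :=
  if n is n'.+1 then (1 - z) * walk z n' phi j + z * walk z n' phi j.+1
  else phi j.

Lemma walk_le z n phi psi j : 0 <= z <= 1 -> (forall i, phi i <= psi i) ->
  walk z n phi j <= walk z n psi j.
Proof.
move=> /andP[z0 z1] le; elim: n j => [|n IH] j /=; first exact: le.
by apply: lerD; apply: ler_wpM2l => //; lra.
Qed.

Lemma walk_affine z n phi a b j :
  walk z n (fun i => a + b * phi i) j = a + b * walk z n phi j.
Proof. by elim: n j => [|n IH] j //=; rewrite !IH; ring. Qed.

Lemma walk_variance z n c j :
  walk z n (fun i => (i%:R - c) ^+ 2) j =
  (j%:R + n%:R * z - c) ^+ 2 + n%:R * z * (1 - z).
Proof. by elim: n j => [|n IH] j //=; rewrite ?IH ?mulrS; ring. Qed.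

Lemma walk_bnd z n phi j c : 0 <= z <= 1 -> (forall i, `|phi i| <= c) ->
  `|walk z n phi j| <= c.
Proof.
move=> z01 pc.
have := walk_affine z n phi c 0 j; rewrite mul0r addr0 => Ec.
have H1 : walk z n phi j <= c.
  rewrite -Ec; apply: walk_le => // i.
  by rewrite mul0r addr0 (le_trans (ler_norm _) (pc i)).
have := walk_affine z n phi (- c) 0 j; rewrite mul0r addr0 => Ec'.
rewrite ler_norml H1 andbT -Ec'; apply: walk_le => // i.
by rewrite mul0r addr0 lerNl (le_trans _ (pc i))// -normrN ler_norm.
Qed.

(** Bernstein's proof: near z the function is within e / 2 of H z, and far from z
    it is bounded by a multiple of (t - z)^2; the expectation of the latter is
    the variance, of order 1 / n.  Only continuity at the point z is used, which
    allows H to be irregular at the ends of [0, 1]. *)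
Lemma bernstein_cvg (H : R -> R) (c z : R) : (forall t, `|H t| <= c) ->
  0 <= z <= 1 -> {for z, continuous H} ->
  (fun n => walk z n.+1 (fun j => H (j%:R / n.+1%:R)) 0) @ \oo --> H z.
Proof.
move=> Hc z01 /cvgrPdist_le cH; apply/cvgrPdist_le => e e0.
have e2 : 0 < e / 2 by lra.
have [d /= d0 Hd] := cH _ e2.
have c0 : 0 <= c by apply: le_trans (Hc 0).
pose K := 2 * c / d ^+ 2.
have K0 : 0 <= K by apply: divr_ge0; [apply: mulr_ge0|apply: sqr_ge0].
have dom t : `|H t - H z| <= e / 2 + K * (t - z) ^+ 2.
  have [lt|ge] := ltP `|z - t| d.
    rewrite distrC; apply: le_trans (Hd _ lt) _.
    by rewrite lerDl mulr_ge0// sqr_ge0.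
  apply: (@le_trans _ _ (2 * c)).
    by apply: le_trans (ler_normB _ _) _; rewrite mulr2n mulrDl mul1r lerD.
  apply: (@le_trans _ _ (K * (t - z) ^+ 2)); last by lra.
  rewrite /K -mulrA -[leLHS]mulr1 ler_wpM2l ?mulr_ge0//.
  rewrite mulrC ler_pdivlMr ?exprn_gt0// mul1r -[leRHS]real_normK ?num_real//.
  by rewrite lerXn2r ?nnegrE//; [exact: ltW|rewrite distrC].
have bound n : `|H z - walk z n.+1 (fun j => H (j%:R / n.+1%:R)) 0| <=
    e / 2 + K * n.+1%:R^-1.
  set phi := fun j => _.
  have n0 : n.+1%:R != 0 :> R by rewrite pnatr_eq0.
  have V : walk z n.+1 (fun j => e / 2 + K * (n.+1%:R ^- 2) * (j%:R - n.+1%:R * z) ^+ 2) 0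
     <= e / 2 + K * n.+1%:R^-1.
    rewrite walk_affine walk_variance lerD2l -mulrA ler_wpM2l//.
    rewrite add0r subrr expr0n add0r.
    rewrite (_ : _ * _ = n.+1%:R^-1 * (z * (1 - z))); last by field.
    by rewrite -[leRHS]mulr1 ler_wpM2l//; nra.
  have domj j : `|phi j - H z| <= e / 2 + K * (n.+1%:R ^- 2) * (j%:R - n.+1%:R * z) ^+ 2.
    apply: le_trans (dom _) _; rewrite lerD2l -mulrA ler_wpM2l//.
    by rewrite le_eqVlt; apply/orP; left; apply/eqP; field.
  rewrite distrC ler_norml; apply/andP; split.
    have E := walk_affine z n.+1 phi (- - H z) (-1) 0.
    rewrite lerNl; apply: le_trans V.
    have -> : - (walk z n.+1 phi 0 - H z) = walk z n.+1 (fun i => - - H z + -1 * phi i) 0.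
      by rewrite E; ring.
    apply: walk_le => // i; apply: le_trans (domj i).
    by rewrite opprK mulN1r distrC ler_norm.
  have E := walk_affine z n.+1 phi (- H z) 1 0.
  apply: le_trans V.
  have -> : walk z n.+1 phi 0 - H z = walk z n.+1 (fun i => - H z + 1 * phi i) 0.
    by rewrite E; ring.
  apply: walk_le => // i; apply: le_trans (domj i).
  by rewrite mul1r addrC ler_norm.
have : (fun n => K * n.+1%:R^-1) @ \oo --> K * 0.
  by apply: cvgM; [exact: cvg_cst|exact: cvg_harmonic].
rewrite mulr0 => /cvgrPdist_le/(_ _ e2); apply: filterS => n.
rewrite sub0r normrN ger0_norm => [Kn|]; last by apply: mulr_ge0; rewrite ?invr_ge0.
by apply: le_trans (bound n) _; rewrite [leRHS]splitr lerD2l.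
Qed.

End RandomWalk.

(** * Completeness of the sines *)
Section SineBasis.
Context {R : realType}.
Local Notation RM := (measurableTypeR R).
Local Notation mu := (@lebesgue_measure R).
Local Notation meas := (@measurable _ RM).
Local Notation mfun := (@measurable_fun _ _ RM R).
Variables (L : R) (L0 : 0 < L).

Definition freq k : R := k.+1%:R * pi / L.
Definition sine k (x : R) : R := sin (freq k * x).

(** The truncation index is allowed to be any large n, so that two sums can be
    added without padding. *)
Definition sinpoly (f : R -> R) := exists N (c : nat -> R),
  forall n, (N <= n)%N -> forall x, f x = \sum_(k < n) c k * sine k x.

Lemma sinpolyD f g : sinpoly f -> sinpoly g -> sinpoly (fun x => f x + g x).
Proof.
move=> [N [c fc]] [N' [c' gc]]; exists (maxn N N'), (fun k => c k + c' k) => n.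
rewrite geq_max => /andP[Nn Nn'] x; rewrite (fc n)// (gc n)// -big_split/=.
by apply: eq_bigr => i _; rewrite mulrDl.
Qed.

Lemma sinpolyZ a f : sinpoly f -> sinpoly (fun x => a * f x).
Proof.
move=> [N [c fc]]; exists N, (fun k => a * c k) => n Nn x; rewrite (fc n)//.
by rewrite mulr_sumr; apply: eq_bigr => i _; rewrite mulrA.
Qed.

Lemma sinpoly0 : sinpoly (fun=> 0).
Proof. by exists 0%N, (fun=> 0) => n _ x; rewrite big1// => i _; rewrite mul0r. Qed.

Lemma sinpoly_sine k : sinpoly (sine k).
Proof.
exists k.+1, (fun i => (i == k)%:R) => n kn x.
rewrite (bigD1 (Ordinal kn))//= eqxx mul1r big1 ?addr0// => i /eqP ik.
by case: eqP => [E|]; rewrite ?mul0r//; case: ik; apply: val_inj.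
Qed.

Lemma sinpoly_sum (F : nat -> R -> R) n : (forall i, sinpoly (F i)) ->
  sinpoly (fun x => \sum_(i < n) F i x).
Proof.
move=> SF; elim: n => [|n IH].
  by under eq_fun do rewrite big_ord0; exact: sinpoly0.
by under eq_fun do rewrite big_ord_recr /=; exact: sinpolyD.
Qed.

(** 2 cos(w_0 x) sin(w_k x) = sin(w_(k+1) x) + sin(w_(k-1) x). *)
Lemma sinpoly_cos f : sinpoly f -> sinpoly (fun x => cos (freq 0 * x) * f x).
Proof.
have base k : sinpoly (fun x => cos (freq 0 * x) * sine k x).
  have E k' (x : R) : freq k'.+1 * x = freq k' * x + freq 0 * x.
    by rewrite /freq -[in LHS]natr1; ring.
  case: k => [|k].
    have -> : (fun x => cos (freq 0 * x) * sine 0 x) = (fun x => 2^-1 * sine 1 x).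
      by apply/funext => x; rewrite /sine E sinD; field.
    by apply: sinpolyZ; exact: sinpoly_sine.
  have -> : (fun x => cos (freq 0 * x) * sine k.+1 x) =
      (fun x => 2^-1 * sine k.+2 x + 2^-1 * sine k x).
    apply/funext => x; rewrite /sine (E k.+1 x) sinD.
    rewrite (_ : freq k * x = freq k.+1 * x - freq 0 * x) ?sinB; last by rewrite E; ring.
    by field.
  by apply: sinpolyD; apply: sinpolyZ; exact: sinpoly_sine.
move=> [N [c fc]].
have -> : (fun x => cos (freq 0 * x) * f x) =
    (fun x => \sum_(k < N) c k * (cos (freq 0 * x) * sine k x)).
  apply/funext => x; rewrite (fc N)// mulr_sumr; apply: eq_bigr => i _; ring.
by apply: (sinpoly_sum (F := fun k x => c k * (cos (freq 0 * x) * sine k x))) => i;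
  exact: sinpolyZ.
Qed.

(** Sine polynomials are sin(w_0 x) times polynomials in cos(w_0 x), and a
    Bernstein operator at (1 + cos(w_0 x)) / 2 is such a polynomial. *)
Lemma sinpoly_walk n phi j :
  sinpoly (fun x => sine 0 x * walk ((1 + cos (freq 0 * x)) / 2) n phi j).
Proof.
elim: n j => [|n IH] j /=.
  under eq_fun do rewrite mulrC; apply: sinpolyZ; exact: sinpoly_sine.
have H1 := IH j; have H2 := IH j.+1.
have := sinpolyD (sinpolyD (sinpolyZ 2^-1 H1) (sinpolyZ (- 2^-1) (sinpoly_cos H1)))
  (sinpolyD (sinpolyZ 2^-1 H2) (sinpolyZ 2^-1 (sinpoly_cos H2))).
by congr sinpoly; apply/funext => x; field.
Qed.

Local Notation D := (`]0, L[%classic : set RM).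
Let mD : meas D. Proof. exact: itvoo_meas. Qed.
Let fD : (mu D < +oo)%E. Proof. exact: itvoo_fin. Qed.

Lemma freq_gt0 k : 0 < freq k.
Proof. by rewrite /freq divr_gt0// mulr_gt0 ?pi_gt0. Qed.

Lemma cont_sine k : continuous (sine k).
Proof.
move=> x; apply: continuous_comp; last exact: continuous_sin.
by apply: mulrl_continuous.
Qed.

Lemma sine_bnd k x : `|sine k x| <= 1.
Proof. by rewrite ler_norml sin_geN1 sin_le1. Qed.

Lemma sine_meas k : mfun D (sine k).
Proof. by apply: cont_meas => //; exact: cont_sine. Qed.

Lemma sine_L2 k : L2 D (sine k).
Proof. by apply: (@L2_bnd _ _ _ 1) => //; [exact: sine_meas|move=> x _; exact: sine_bnd]. Qed.

Lemma sinpoly_L2 p : sinpoly p -> L2 D p.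
Proof.
move=> [N [c pc]]; rewrite (_ : p = fun x => \sum_(k < N) c k * sine k x).
  by apply: (@L2_sum _ _ (fun k x => c k * sine k x)) => // k; apply: L2Z => //; exact: sine_L2.
by apply/funext => x; exact: pc.
Qed.

Lemma sine0_gt0 (x : R) : D x -> 0 < sine 0 x.
Proof.
rewrite /= in_itv/= => /andP[x0 xL]; apply: sin_gt0_pi; rewrite /freq mul1r.
have p0 := @pi_gt0 R.
rewrite mulr_gt0 ?divr_gt0//= -[ltRHS]mulr1 -mulrA ltr_pM2l// mulrC.
by rewrite ltr_pdivrMr// mul1r.
Qed.

Definition sqint (f : R -> R) := \int[mu]_(x in D) (f x ^+ 2).

Definition sine_approx f := forall e, 0 < e ->
  exists2 p, sinpoly p & sqint (fun x => f x - p x) < e.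

Lemma sqint_le_sum f g : L2 D f -> L2 D g ->
  sqint (fun x => f x + g x) <= 2 * sqint f + 2 * sqint g.
Proof.
move=> Lf Lg; have If := Lf.2; have Ig := Lg.2; rewrite /sqint.
rewrite -!RintZl// -RintD//; [|exact: intgZ..].
apply: le_Rintegral => //; first by have := (L2D mD Lf Lg).2.
  by apply: intgD => //; exact: intgZ.
move=> x _; rewrite -subr_ge0 (_ : _ - _ = (f x - g x) ^+ 2) ?sqr_ge0//; ring.
Qed.

Lemma sine_approx_lim f (F : nat -> R -> R) : L2 D f -> (forall n, L2 D (F n)) ->
  (forall n, sine_approx (F n)) ->
  (fun n => sqint (fun x => f x - F n x)) @ \oo --> (0 : R) -> sine_approx f.
Proof.
move=> Lf LF AF /cvgrPdist_lt cF e e0.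
have e4 : 0 < e / 4 by lra.
have [N _ /(_ N (leqnn N)) /=] := cF _ e4.
rewrite sub0r normrN => /(le_lt_trans (ler_norm _)) fN.
have [p Sp Fp] := AF N _ e4; exists p => //.
have := sqint_le_sum (L2B mD Lf (LF N)) (L2B mD (LF N) (sinpoly_L2 Sp)).
rewrite (_ : (fun x => _ + _) = (fun x => f x - p x)); last first.
  by apply/funext => x; ring.
by move=> H; apply: le_lt_trans H _; lra.
Qed.

Lemma sqint_dct f (F : nat -> R -> R) g : mfun D f -> (forall n, mfun D (F n)) ->
  (forall x, D x -> F ^~ x @ \oo --> f x) -> intg D g ->
  (forall n x, D x -> (f x - F n x) ^+ 2 <= g x) ->
  (fun n => sqint (fun x => f x - F n x)) @ \oo --> (0 : R).
Proof.
move=> mf mF cF Ig Fg.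
have [|||//||_] := @Rint_dct _ D (fun n x => (f x - F n x) ^+ 2) (fun=> 0) g mD.
- by move=> n; apply: measurable_funX; exact: measurable_funB.
- exact: measurable_cst.
- apply: aeW => x Dx.
  have c0 : (fun n => f x - F n x) @ \oo --> 0.
    by rewrite -(subrr (f x)); apply: cvgB; [exact: cvg_cst|exact: cF].
  by have := cvgM c0 c0; rewrite mulr0; apply.
- by move=> n x Dx; rewrite ger0_norm ?sqr_ge0// Fg.
by rewrite Rintegral_cst// mul0r.
Qed.

(** The change of variable z = (1 + cos(w_0 x)) / 2 maps ]0, L[ onto ]0, 1[, and
    its inverse is continuous there, so the Bernstein polynomials of h in the
    variable z converge pointwise; they stay bounded, which gives convergence
    in L^2. *)
Lemma sine_approx_cont (h : R -> R) c : continuous h -> (forall x, `|h x| <= c) ->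
  sine_approx (fun x => sine 0 x * h x).
Proof.
move=> ch hc.
pose H t := h (L / pi * acos (2 * t - 1)).
pose q x := (1 + cos (freq 0 * x)) / 2.
pose F n x := sine 0 x * walk (q x) n.+1 (fun j => H (j%:R / n.+1%:R)) 0.
have SF n : sinpoly (F n) by exact: sinpoly_walk.
have q01 x : 0 <= q x <= 1.
  have := @cos_geN1 R (freq 0 * x); have := @cos_le1 R (freq 0 * x).
  by rewrite /q; lra.
have mh : mfun D h by exact: cont_meas.
have Lsh : L2 D (fun x => sine 0 x * h x).
  apply: (@L2_bnd _ _ _ c) => //; first by apply: measurable_funM => //; exact: sine_meas.
  move=> x _; rewrite normrM -[leRHS]mul1r; apply: ler_pM => //; exact: sine_bnd.
apply: (sine_approx_lim Lsh (F := F)).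
- by move=> n; exact: sinpoly_L2.
- move=> n e e0; exists (F n) => //.
  rewrite /sqint; under eq_Rintegral do rewrite subrr expr0n.
  by rewrite Rintegral_cst// mul0r.
- apply: (@sqint_dct _ _ (fun=> (2 * c) ^+ 2)).
  + by case: Lsh.
  + by move=> n; case: (sinpoly_L2 (SF n)).
  + move=> x Dx; apply: cvgM; first exact: cvg_cst.
    have p0 := @pi_gt0 R.
    have fx : 0 < freq 0 * x < pi.
      move: Dx; rewrite /= in_itv/= => /andP[x0 xL].
      rewrite mulr_gt0 ?freq_gt0//= /freq mul1r -[ltRHS]mulr1 -mulrA ltr_pM2l// mulrC.
      by rewrite ltr_pdivrMr// mul1r.
    have qE : 2 * q x - 1 = cos (freq 0 * x) by rewrite /q; field.
    have HE : H (q x) = h x.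
      rewrite /H qE cosK; last by rewrite in_itv/=; lra.
      congr h; rewrite /freq; move: (@pi R) p0 => p p0; field.
      by rewrite !lt0r_neq0.
    rewrite -HE; apply: (@bernstein_cvg _ H c) => //; first by move=> t; exact: hc.
    apply: (@continuous_comp _ _ _ (fun t : R => L / pi * acos (2 * t - 1) : R) h (q x)); last exact: ch.
    apply: continuousM; first exact: cvg_cst.
    apply: (@continuous_comp _ _ _ (fun t : R => 2 * t - 1 : R) (@acos R) (q x)); last first.
      apply: continuous_acos; rewrite qE.
      have [f0 f1] := andP fx.
      have c1 : cos (freq 0 * x) < cos 0.
        by rewrite ltr_cos ?in_itv//= ?lexx ?ltW//.
      have c2 : cos pi < cos (freq 0 * x).
        by rewrite ltr_cos ?in_itv//= ?lexx ?ltW//.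
      by rewrite cos0 in c1; rewrite cospi in c2; rewrite c1 c2.
    apply: continuousB; last exact: cvg_cst.
    exact: mulrl_continuous.
  + apply: (@bnd_intg _ _ _ ((2 * c) ^+ 2)) => //.
    by move=> x _; rewrite ger0_norm ?sqr_ge0.
  + move=> n x Dx; rewrite -mulrBr -(real_normK (num_real _)) lerXn2r ?nnegrE//.
      by rewrite mulr_ge0// (le_trans _ (hc 0)).
    rewrite normrM -[leRHS]mul1r ler_pM// ?sine_bnd//.
    rewrite mulr2n mulrDl mul1r; apply: le_trans (ler_normB _ _) _.
    by apply: lerD => //; apply: walk_bnd => // i; exact: hc.
Qed.

Definition clamp (c y : R) : R := (`|y + c| - `|y - c|) / 2.

(** Truncation at level c stays within c and moves no farther away from a value
    that is itself at most c in modulus. *)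
Lemma clampP (c a b : R) : 0 <= c -> `|a| <= c ->
  `|clamp c b| <= c /\ `|a - clamp c b| <= `|a - b|.
Proof.
move=> c0; rewrite /clamp ler_norml => /andP[ac ca].
case: (leP 0 (b + c)) => H1; [rewrite (ger0_norm H1)|rewrite (ltr0_norm H1)];
(case: (leP 0 (b - c)) => H2; [rewrite (ger0_norm H2)|rewrite (ltr0_norm H2)]);
(split; first by rewrite ler_norml; lra);
(case: (leP 0 (a - b)) => H3; [rewrite (ger0_norm H3)|rewrite (ltr0_norm H3)]);
by rewrite ler_norml; lra.
Qed.

(** Continuous functions approximate g in L^1; clamping them to [- c, c] keeps
    this and bounds the difference by 2 c, so they also approximate in L^2. *)
Lemma sine_approx_bnd g c : mfun D g -> (forall x, D x -> `|g x| <= c) ->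
  sine_approx (fun x => sine 0 x * g x).
Proof.
move=> mg gc.
have c0 : 0 <= c.
  apply: le_trans (gc (L / 2) _) => //=.
  by rewrite in_itv/= divr_gt0//= ltr_pdivrMr// ltr_pMr// ltr1n.
have Ig : intg D g by exact: bnd_intg gc.
have [h [ch Ih hg]] := approximation_continuous_integrable mD fD Ig.
pose h' n x := clamp c (h n x).
have ch' n : continuous (h' n).
  move=> x; apply: cvgM; last exact: cvg_cst.
  by apply: cvgB; apply: cvg_norm; [apply: cvgD|apply: cvgB];
    [exact: ch|exact: cvg_cst|exact: ch|exact: cvg_cst].
have h'c n x : `|h' n x| <= c.
  by have [] := @clampP c 0 (h n x) c0 _; rewrite ?normr0.
have Lb f : mfun D f -> (forall x, D x -> `|f x| <= c) -> L2 D (fun x => sine 0 x * f x).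
  move=> mf fc; apply: (@L2_bnd _ _ _ c) => //.
    by apply: measurable_funM => //; exact: sine_meas.
  by move=> x Dx; rewrite normrM -[leRHS]mul1r; apply: ler_pM => //; [exact: sine_bnd|exact: fc].
have mh' n : mfun D (h' n) by apply: cont_meas.
have Lsg := Lb _ mg gc.
have Lsh n := Lb _ (mh' n) (fun x _ => h'c n x).
apply: (sine_approx_lim Lsg Lsh).
  by move=> n; exact: sine_approx_cont (ch' n) (h'c n).
have /fine_cvg hg' : (fun n => \int[mu]_(z in D) `|(g z - h n z)%:E|)%E @ \oo --> 0%:E := hg.
have : (fun n => 2 * c * \int[mu]_(z in D) `|g z - h n z|) @ \oo --> 2 * c * 0.
  apply: cvgM; first exact: cvg_cst.
  by apply: cvg_trans hg'; apply: near_eq_cvg; apply: nearW.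
rewrite mulr0; apply: squeeze_cvgr; last exact: cvg_cst.
apply: nearW => n; apply/andP; split.
  by apply: Rintegral_ge0 => x _; exact: sqr_ge0.
have Ign : intg D (fun x => `|g x - h n x|).
  by apply: integrable_norm; apply: intgB => //; exact: Ih.
rewrite -RintZl//; apply: le_Rintegral => //.
- exact: (L2B mD Lsg (Lsh n)).2.
- exact: intgZ.
move=> x Dx; have [h1 h2] := @clampP c (g x) (h n x) c0 (gc x Dx).
rewrite -mulrBr exprMn.
have s1 : sine 0 x ^+ 2 <= 1.
  by rewrite -(real_normK (num_real _)) exprn_ile1// sine_bnd.
apply: (@le_trans _ _ (`|g x - h' n x| ^+ 2)).
  by rewrite real_normK ?num_real// ler_piMl// sqr_ge0.
rewrite expr2; apply: ler_pM => //.
by apply: le_trans (ler_normB _ _) _; rewrite mulr2n mulrDl mul1r lerD// gc.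
Qed.

(** The part of f where |f| <= n sin(w_0 x) is sin(w_0 x) times a bounded
    function, and it tends to f in L^2 because the sine is positive inside. *)
Lemma sine_approx_L2 f : L2 D f -> sine_approx f.
Proof.
move=> Lf; have [mf If] := Lf.
pose g n x := if `|f x| <= n%:R * sine 0 x then f x / sine 0 x else 0.
have mV : mfun D (fun x => (sine 0 x)^-1).
  apply: open_continuous_measurable_fun; first exact: interval_open.
  move=> x /set_mem Dx; apply: continuousV; last exact: cont_sine.
  by rewrite lt0r_neq0// sine0_gt0.
have mg n : mfun D (g n).
  apply: measurable_fun_if => //.
  - apply: measurable_fun_ler; first by apply: measurableT_comp => //.
    by apply: measurable_funM => //; exact: sine_meas.
  - exact: (@measurable_funS _ _ RM R D _ _ mD (@subIsetl _ _ _) (measurable_funM mf mV)).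
have gn n x : D x -> `|g n x| <= n%:R.
  move=> Dx; rewrite /g; case: ifPn => [H|_]; last by rewrite normr0.
  by rewrite normrM normfV (gtr0_norm (sine0_gt0 Dx)) ler_pdivrMr ?sine0_gt0.
have gE n x : D x -> sine 0 x * g n x = if `|f x| <= n%:R * sine 0 x then f x else 0.
  move=> Dx; rewrite /g; case: ifPn => _; last by rewrite mulr0.
  by rewrite mulrC divfK// lt0r_neq0// sine0_gt0.
have Lg n : L2 D (fun x => sine 0 x * g n x).
  apply: (@L2_bnd _ _ _ n%:R) => //.
    by apply: measurable_funM => //; exact: sine_meas.
  by move=> x Dx; rewrite normrM -[leRHS]mul1r; apply: ler_pM => //; [exact: sine_bnd|exact: gn].
apply: (sine_approx_lim Lf Lg).
  by move=> n; exact: sine_approx_bnd (mg n) (gn n).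
apply: sqint_dct If _ => //.
- by move=> n; case: (Lg n).
- move=> x Dx; apply: cvg_near_cst.
  near=> n; rewrite gE// ifT// -ler_pdivrMr ?sine0_gt0//.
  by near: n; exact: nbhs_infty_ger.
- move=> n x Dx; rewrite gE//; case: ifP => _; last by rewrite subr0.
  by rewrite subrr expr0n sqr_ge0.
Unshelve. all: by end_near. Qed.

Global Instance sinM_derive (c x : R) :
  is_derive x 1 (fun s : R => sin (c * s)) (c * cos (c * x)).
Proof.
have := @is_derive1_comp R sin ( *%R c) x _ c (is_derive_sin _).
have d : is_derive x 1 ( *%R c) c by apply: is_derive_eq; rewrite /GRing.scale/= mulr1.
by move=> /(_ d); rewrite mulrC.
Qed.

Global Instance cosM_derive (c x : R) :
  is_derive x 1 (fun s : R => cos (c * s)) (- c * sin (c * x)).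
Proof.
have := @is_derive1_comp R cos ( *%R c) x _ c (is_derive_cos _).
have d : is_derive x 1 ( *%R c) c by apply: is_derive_eq; rewrite /GRing.scale/= mulr1.
by move=> /(_ d); rewrite mulrC mulrN mulNr.
Qed.

Lemma cont_cosM (c : R) : continuous (fun s : R => cos (c * s)).
Proof.
move=> x; apply: continuous_comp; last exact: continuous_cos.
by apply: mulrl_continuous.
Qed.

Lemma sin_natpi n : sin (n%:R * pi : R) = 0.
Proof.
elim: n => [|n IH]; first by rewrite mul0r sin0.
by rewrite mulrS mulrDl mul1r sinD sinpi IH mulr0 mul0r addr0.
Qed.

Lemma sine_L k : sine k L = 0.
Proof. by rewrite /sine /freq divfK ?gt_eqF// sin_natpi. Qed.

Lemma Rint_cosM (c : R) : c != 0 -> sin (c * L) = 0 ->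
  \int[mu]_(x in D) cos (c * x) = 0.
Proof.
move=> c0 cL; transitivity (c^-1 * sin (c * L) - c^-1 * sin (c * 0)); last first.
  by rewrite cL !mulr0 sin0 mulr0 subrr.
apply: (@RintFTC _ 0 L _ (fun s => c^-1 * sin (c * s))); first exact: ltW.
  by move=> x; apply: is_derive_eq; rewrite /GRing.scale/=; field.
exact: cont_cosM.
Qed.

Lemma intg_cosM (c : R) : intg D (fun x => cos (c * x)).
Proof.
by apply: L2_intg => //; apply: within_L2; apply: cont_within; exact: cont_cosM.
Qed.

Lemma sine_orthogonal j k :
  \int[mu]_(x in D) (sine j x * sine k x) = if j == k then L / 2 else 0.
Proof.
have sL i : sin (freq i * L) = 0 by exact: sine_L.
have Ic (c c' : R) : intg D (fun x => c' * cos (c * x)).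
  by apply: intgZ => //; exact: intg_cosM.
transitivity (2^-1 * \int[mu]_(x in D) cos ((freq j - freq k) * x) -
              2^-1 * \int[mu]_(x in D) cos ((freq j + freq k) * x)).
  rewrite -!RintZl//; [|exact: intg_cosM..].
  rewrite -RintB//; apply: eq_Rint => x _.
  by rewrite /sine mulrBl mulrDl cosB cosD; field.
rewrite [X in _ - _ * X]Rint_cosM; first last.
- by rewrite mulrDl sinD !sL mul0r mulr0 addr0.
- by rewrite lt0r_neq0// addr_gt0// freq_gt0.
rewrite mulr0 subr0; case: eqP => [->|/eqP jk].
  rewrite subrr; under eq_Rintegral do rewrite mul0r cos0.
  by rewrite Rint_cst ?ltW//; field.
rewrite Rint_cosM ?mulr0//.
  rewrite subr_eq0; apply: contra_neq jk => E; apply/eqP.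
  have : freq j * (L / pi) = freq k * (L / pi) by rewrite E.
  rewrite /freq; have p0 : (pi : R) != 0 by rewrite gt_eqF// pi_gt0.
  have Ln : L != 0 by rewrite gt_eqF.
  have X i : i.+1%:R * pi / L * (L / pi) = i.+1%:R :> R.
    by move: (pi : R) p0 => p p0; field; rewrite p0.
  by rewrite !X => /eqP; rewrite eqr_nat eqSS.
by rewrite mulrBl sinB !sL mul0r mulr0 subrr.
Qed.

Definition coef (f : R -> R) k := \int[mu]_(x in D) (f x * sine k x).

Lemma coefD f g k : L2 D f -> L2 D g ->
  coef (fun x => f x + g x) k = coef f k + coef g k.
Proof.
move=> Lf Lg; have Ls := sine_L2 k; rewrite /coef -RintD//; [|exact: intg_L2M..].
by apply: eq_Rint => x _; rewrite mulrDl.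
Qed.

Lemma coefZ c f k : L2 D f -> coef (fun x => c * f x) k = c * coef f k.
Proof.
move=> Lf; have Ls := sine_L2 k; rewrite /coef -RintZl//; last exact: intg_L2M.
by apply: eq_Rint => x _; rewrite mulrA.
Qed.

Lemma coefB f g k : L2 D f -> L2 D g ->
  coef (fun x => f x - g x) k = coef f k - coef g k.
Proof.
move=> Lf Lg; rewrite -mulN1r -coefZ// -coefD//; last exact: L2Z.
by congr (coef _ _); apply/funext => x; rewrite mulN1r.
Qed.

Let partial (d : nat -> R) n x := \sum_(k < n) d k * sine k x.

Lemma partial_L2 d n : L2 D (partial d n).
Proof.
by apply: (@L2_sum _ _ (fun k x => d k * sine k x)) => // k; apply: L2Z => //; exact: sine_L2.
Qed.

Lemma coef_partial d n j : (n <= j)%N -> coef (partial d n) j = 0.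
Proof.
elim: n => [|n IH] nj.
  rewrite /coef /partial; under eq_Rintegral do rewrite big_ord0 mul0r.
  by rewrite Rintegral_cst// mul0r.
have -> : partial d n.+1 = (fun x => partial d n x + d n * sine n x).
  by apply/funext => x; rewrite /partial big_ord_recr.
rewrite coefD; [|exact: partial_L2|by apply: L2Z => //; exact: sine_L2].
rewrite (IH (ltnW nj)) add0r (@coefZ (d n) (sine n) j); last exact: sine_L2.
by rewrite /coef sine_orthogonal ltn_eqF// mulr0.
Qed.

Lemma sqint_partial f d n : L2 D f ->
  sqint (fun x => f x - partial d n x) =
  sqint f - 2 * \sum_(k < n) d k * coef f k + L / 2 * \sum_(k < n) d k ^+ 2.
Proof.
move=> Lf; elim: n => [|n IH].
  rewrite !big_ord0 !mulr0 subr0 addr0; congr (sqint _).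
  by apply/funext => x; rewrite /partial big_ord0 subr0.
rewrite !big_ord_recr/=.
have Lp := partial_L2 d n; have Ls := sine_L2 n.
pose r x := f x - partial d n x.
have Lr : L2 D r by exact: L2B.
have Er : coef r n = coef f n by rewrite coefB// coef_partial// subr0.
transitivity (sqint r - 2 * d n * coef r n + d n ^+ 2 * (L / 2)).
  have <- : \int[mu]_(x in D) (sine n x * sine n x) = L / 2.
    by rewrite sine_orthogonal eqxx.
  have I1 : intg D (fun x => r x ^+ 2) by case: Lr.
  have I2 : intg D (fun x => r x * sine n x) by exact: intg_L2M.
  have I3 : intg D (fun x => sine n x * sine n x) by exact: intg_L2M.
  rewrite /sqint /coef -!RintZl// -RintB//; last exact: intgZ.
  rewrite -RintD//; [|by apply: intgB => //; exact: intgZ|exact: intgZ].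
  by apply: eq_Rint => x _; rewrite /r /partial big_ord_recr/=; ring.
by rewrite IH Er; ring.
Qed.

(** As int_0^L sin(w_k x)^2 dx = L / 2, this is the coefficient of the best
    approximation, whereas [coef] is the bare inner product. *)
Definition fourier_coef (f : R -> R) k := 2 / L * coef f k.

Lemma sqint_fourier f n : L2 D f ->
  sqint (fun x => f x - partial (fourier_coef f) n x) =
  sqint f - 2 / L * \sum_(k < n) coef f k ^+ 2.
Proof.
move=> Lf; rewrite sqint_partial// /fourier_coef.
rewrite (eq_bigr (fun k : 'I_n => 2 / L * coef f k ^+ 2)); last by move=> k _; ring.
rewrite [X in _ + _ * X](eq_bigr (fun k : 'I_n => (2 / L) ^+ 2 * coef f k ^+ 2)); last first.
  by move=> k _; rewrite exprMn.
rewrite -!mulr_sumr; field; by rewrite gt_eqF.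
Qed.

Lemma bessel f n : L2 D f -> 2 / L * \sum_(k < n) coef f k ^+ 2 <= sqint f.
Proof.
move=> Lf; rewrite -subr_ge0 -sqint_fourier//.
by apply: Rintegral_ge0 => x _; exact: sqr_ge0.
Qed.

Lemma parseval f : L2 D f ->
  (fun n => 2 / L * \sum_(k < n) coef f k ^+ 2) @ \oo --> sqint f.
Proof.
move=> Lf; apply/cvgrPdist_lt => e e0.
have [p [N [d pd]] fp] := sine_approx_L2 Lf e0.
exists N => // n /= Nn; rewrite ger0_norm; last by rewrite subr_ge0 bessel.
apply: le_lt_trans fp.
have -> : (fun x => f x - p x) = (fun x => f x - partial d n x).
  by apply/funext => x; rewrite (pd n Nn).
rewrite sqint_partial// -addrA lerD2l -subr_ge0.
rewrite (_ : _ - _ = L / 2 * \sum_(k < n) (d k - fourier_coef f k) ^+ 2).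
  apply: mulr_ge0; first by rewrite divr_ge0// ltW.
  by apply: sumr_ge0 => i _; exact: sqr_ge0.
rewrite [in RHS](eq_bigr (fun k : 'I_n => d k ^+ 2 - 4 / L * (d k * coef f k) +
   (2 / L) ^+ 2 * coef f k ^+ 2)); last by move=> k _; rewrite /fourier_coef; ring.
rewrite big_split sumrB/= -!mulr_sumr; field; by rewrite gt_eqF.
Qed.

(** Polarization. *)
Lemma parseval2 f g : L2 D f -> L2 D g ->
  (fun n => 2 / L * \sum_(k < n) coef f k * coef g k) @ \oo -->
  \int[mu]_(x in D) (f x * g x).
Proof.
move=> Lf Lg.
have Lp := L2D mD Lf Lg; have Lm := L2B mD Lf Lg.
have -> : \int[mu]_(x in D) (f x * g x) =
    4^-1 * (sqint (fun x => f x + g x) - sqint (fun x => f x - g x)).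
  rewrite /sqint -RintB//; [|by case: Lp|by case: Lm].
  rewrite -RintZl//; last by apply: intgB => //; [case: Lp|case: Lm].
  by apply: eq_Rint => x _; field.
have -> : (fun n => 2 / L * \sum_(k < n) coef f k * coef g k) =
    (fun n => 4^-1 * (2 / L * \sum_(k < n) coef (fun x => f x + g x) k ^+ 2 -
                      2 / L * \sum_(k < n) coef (fun x => f x - g x) k ^+ 2)).
  apply/funext => n; rewrite -mulrBr mulrCA; congr (_ * _).
  rewrite -sumrB mulr_sumr; apply: eq_bigr => k _.
  by rewrite coefD// coefB//; field.
by apply: cvgM; [exact: cvg_cst|apply: cvgB; exact: parseval].
Qed.

Lemma coef_eq0 f : L2 D f -> (forall k, coef f k = 0) -> ae_zero D f.
Proof.
move=> Lf f0.
have S0 : sqint f = 0.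
  apply: (cvg_unique _ (parseval Lf)) => //; apply: cvg_near_cst; apply: nearW => n.
  by rewrite big1 ?mulr0// => k _; rewrite f0 expr0n.
have I2 : (\int[mu]_(x in D) `|(f x ^+ 2)%:E|)%E = 0%E.
  under eq_integral do rewrite gee0_abs ?lee_fin ?sqr_ge0//.
  rewrite -[LHS]fineK; last exact: (integrable_fin_num mD Lf.2).
  by congr EFin.
have mf2 : measurable_fun D (fun x => (f x ^+ 2)%:E).
  by apply/measurable_EFinP; apply: measurable_funX; case: Lf.
have := (ae_eq_integral_abs mu mD mf2).1 I2.
by apply: filterS => x /= + Dx => /(_ Dx) [] /eqP; rewrite sqrf_eq0 => /eqP.
Qed.

(** Absolute summability makes the sine series converge uniformly, which yields
    the function without any appeal to the completeness of L^2. *)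
Lemma coef_surj (c : nat -> R) (C : R) : (forall n, \sum_(k < n) `|c k| <= C) ->
  exists f : R -> R, [/\ mfun D f, exists B, forall x, D x -> `|f x| <= B &
    forall k, coef f k = c k].
Proof.
move=> cC.
have [//||||f [mf fB _ If]] := @dominated_series _ D
   (fun n x => 2 / L * c n * sine n x) (fun n => 2 / L * `|c n|) (2 / L * C).
- by move=> n; apply: measurable_funM => //; exact: sine_meas.
- move=> n x _; rewrite !normrM (ger0_norm (_ : 0 <= 2)) ?normfV// (gtr0_norm L0).
  by rewrite -[leRHS]mulr1 ler_wpM2l// ?sine_bnd// !mulr_ge0 ?invr_ge0// ltW.
- by move=> n; rewrite -mulr_sumr ler_wpM2l// divr_ge0// ltW.
exists f; split => //; first by exists (2 / L * C).
move=> k; have /If cf : intg D (sine k) by apply: L2_intg => //; exact: sine_L2.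
apply: (cvg_unique _ cf) => //; apply: cvg_near_cst; exists k.+1 => // n /= kn.
have E i : \int[mu]_(x in D) (2 / L * c i * sine i x * sine k x) =
    if i == k then c k else 0.
  under eq_Rintegral do rewrite -mulrA.
  rewrite RintZl//; last by apply: intg_L2M => //; exact: sine_L2.
  rewrite sine_orthogonal; case: eqP => [->|]; last by rewrite mulr0.
  by field; rewrite gt_eqF.
rewrite (bigD1 (Ordinal kn))//= E eqxx big1 ?addr0// => i /eqP ik.
rewrite E; case: eqP => // ik'; case: ik; exact: val_inj.
Qed.

End SineBasis.

(** * Integration by parts for weak derivatives *)
Section WeakDerivative.
Context {R : realType}.
Local Notation RM := (measurableTypeR R).
Local Notation mu := (@lebesgue_measure R).
Local Notation meas := (@measurable _ RM).
Local Notation mfun := (@measurable_fun _ _ RM R).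

Definition pos (y : R) : R := (y + `|y|) / 2.

Lemma pos_ge0 y : 0 <= pos y.
Proof. by rewrite /pos; have := ler_norm (- y); rewrite normrN; lra. Qed.

Lemma pos_eq0 y : y <= 0 -> pos y = 0.
Proof. by move=> y0; rewrite /pos ler0_norm// subrr mul0r. Qed.

Lemma pos_id y : 0 <= y -> pos y = y.
Proof. by move=> y0; rewrite /pos ger0_norm//; field. Qed.

Lemma cont_pos : continuous pos.
Proof.
move=> x; apply: cvgM; last exact: cvg_cst.
by apply: cvgD; [exact: cvg_id|apply: cvg_norm; exact: cvg_id].
Qed.

(** Cutoff functions must be of class C^1; squaring the positive part is the
    cheapest way to glue at 0. *)
Lemma is_derive_sqpos (x : R) : is_derive x 1 (fun y => pos y ^+ 2) (2 * pos x).
Proof.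
have [x0|x0|->] := ltgtP x 0.
- have E : \near x, (fun=> 0 : R) x = pos x ^+ 2.
    near=> z; rewrite pos_eq0 ?expr0n//.
    by near: z; apply: filterS (lt_nbhsl x0) => z /ltW.
  apply: near_eq_is_derive E _.
  by rewrite pos_eq0 ?ltW// mulr0; exact: is_derive_cst.
- have E : \near x, (fun z => z ^+ 2 : R) x = pos x ^+ 2.
    near=> z; rewrite pos_id//.
    by near: z; apply: filterS (lt_nbhsr x0) => z /ltW.
  apply: near_eq_is_derive E _.
  by rewrite pos_id ?ltW//; apply: is_derive_eq; rewrite /GRing.scale/=; ring.
rewrite pos_eq0// mulr0.
have H : (fun h : R => h^-1 *: ((fun y => pos y ^+ 2) (h *: 1 + 0 : R) - pos 0 ^+ 2)) @ 0^' --> (0 : R).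
  have C : (fun h : R => pos h) @ 0^' --> (0 : R).
    have := @cont_pos 0; rewrite /continuous_at pos_eq0// => c.
    by apply: cvg_trans c; apply: cvg_app; exact: cvg_within.
  apply: cvg_trans C; apply: near_eq_cvg; near=> h.
  have h0 : h != 0 by near: h; exact: nbhs_dnbhs_neq.
  rewrite /GRing.scale/= mulr1 addr0 (pos_eq0 (lexx 0)) expr0n subr0.
  have [hp|hn] := leP 0 h; last by rewrite pos_eq0 ?ltW// expr0n mulr0.
  by rewrite pos_id//; field.
split; first by apply/cvg_ex; exists 0.
by apply: cvg_lim.
Unshelve. all: by end_near. Qed.

(** A C^1 cutoff which vanishes for x <= a, increases to 1, and has scale a: the
    rational shape gives the bound x * ramp' a x <= 3, uniform in a. *)
Definition ramp (a x : R) : R := pos (x - a) ^+ 2 / (pos (x - a) ^+ 2 + a ^+ 2).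
Definition ramp' (a x : R) : R :=
  2 * pos (x - a) * a ^+ 2 / (pos (x - a) ^+ 2 + a ^+ 2) ^+ 2.

Section Ramp.
Variables (a : R) (a0 : 0 < a).

Let den_gt0 x : 0 < pos (x - a) ^+ 2 + a ^+ 2.
Proof. by rewrite ltr_wpDl ?sqr_ge0// exprn_gt0. Qed.

Lemma ramp_derive (x : R) : is_derive x 1 (ramp a) (ramp' a x).
Proof.
have d1 : is_derive x 1 (fun y : R => y - a) 1.
  by apply: is_derive_eq; rewrite subr0.
have d2 : is_derive x 1 (fun y => pos (y - a) ^+ 2) (2 * pos (x - a)).
  have := @is_derive1_comp R (fun y => pos y ^+ 2) (fun y => y - a) x _ _ (is_derive_sqpos _) d1.
  by rewrite mulr1.
have n0 := lt0r_neq0 (den_gt0 x).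
have d3 : is_derive x 1 (fun y => (pos (y - a) ^+ 2 + a ^+ 2)^-1)
   (- (pos (x - a) ^+ 2 + a ^+ 2) ^- 2 * (2 * pos (x - a))).
  have d4 : is_derive x 1 (fun y => pos (y - a) ^+ 2 + a ^+ 2) (2 * pos (x - a)).
    by apply: is_derive_eq; rewrite addr0.
  exact: (@is_deriveV _ (fun y => pos (y - a) ^+ 2 + a ^+ 2) x _ 1 n0 d4).
apply: is_derive_eq; rewrite /GRing.scale/= /ramp'.
by field.
Qed.

Lemma cont_ramp' : continuous (ramp' a).
Proof.
have c1 (x : R) : (fun y => pos (y - a)) @ x --> pos (x - a).
  apply: (@continuous_comp _ _ _ (fun y : R => y - a) pos x); last exact: cont_pos.
  by apply: cvgB; [exact: cvg_id|exact: cvg_cst].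
have c2 (x : R) : (fun y => pos (y - a) ^+ 2 + a ^+ 2) @ x --> pos (x - a) ^+ 2 + a ^+ 2.
  by apply: cvgD; [exact: (cvgM (c1 x) (c1 x))|exact: cvg_cst].
move=> x; apply: cvgM.
  by apply: cvgM; [apply: cvgM; [exact: cvg_cst|exact: c1]|exact: cvg_cst].
apply: cvgV; first by rewrite expf_neq0// lt0r_neq0.
exact: (cvgM (c2 x) (c2 x)).
Qed.

Lemma ramp_ge0 x : 0 <= ramp a x.
Proof. by rewrite divr_ge0 ?sqr_ge0// ltW. Qed.

Lemma ramp_le1 x : ramp a x <= 1.
Proof. by rewrite ler_pdivrMr// mul1r lerDl sqr_ge0. Qed.

Lemma ramp_eq0 x : x <= a -> ramp a x = 0.
Proof. by move=> xa; rewrite /ramp pos_eq0 ?subr_le0// expr0n mul0r. Qed.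

Lemma ramp'_ge0 x : 0 <= ramp' a x.
Proof.
apply: divr_ge0; last exact: sqr_ge0.
by apply: mulr_ge0; [apply: mulr_ge0 => //; exact: pos_ge0|exact: sqr_ge0].
Qed.

Lemma ramp'_le x : 0 <= x -> x * ramp' a x <= 3.
Proof.
move=> x0; rewrite /ramp' mulrA ler_pdivrMr ?exprn_gt0//.
have [xa|ax] := leP x a.
  by rewrite pos_eq0 ?subr_le0// !(mulr0, mul0r) mulr_ge0// sqr_ge0.
rewrite pos_id; last by rewrite subr_ge0 ltW.
have [y xy] : exists y, x = y + a by exists (x - a); ring.
have y0 : 0 < y by rewrite xy ltrDr in ax.
rewrite xy addrK.
have P : 0 <= (y + a) * y by apply: mulr_ge0; [apply: addr_ge0|]; exact: ltW.
have H : 2 * ((y + a) * y) <= 3 * (y ^+ 2 + a ^+ 2) by have := sqr_ge0 (y - a); nra.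
rewrite [leLHS](_ : _ = 2 * ((y + a) * y) * a ^+ 2); last by ring.
rewrite [leRHS](_ : _ = 3 * (y ^+ 2 + a ^+ 2) * (y ^+ 2 + a ^+ 2)); last by ring.
apply: ler_pM; rewrite ?sqr_ge0//.
  by rewrite mulr_ge0.
by rewrite lerDr sqr_ge0.
Qed.

End Ramp.

Let e n : R := n.+1%:R^-1.
Let e_gt0 n : 0 < e n. Proof. by rewrite invr_gt0. Qed.

Lemma ramp_cvg x : 0 < x -> (fun n => ramp (e n) x) @ \oo --> (1 : R).
Proof.
move=> x0; have ce : e @ \oo --> (0 : R) by exact: cvg_harmonic.
have c1 : (fun n => pos (x - e n) ^+ 2) @ \oo --> x ^+ 2.
  have c : (fun n => pos (x - e n)) @ \oo --> x.
    rewrite -[X in _ --> X](pos_id (ltW x0)) -[X in _ --> pos X]subr0.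
    apply: (cvg_comp _ _ (cvgB (cvg_cst x) ce)); exact: cont_pos.
  exact: (cvgM c c).
rewrite -[X in _ --> X](@divff _ (x ^+ 2)) ?expf_neq0 ?lt0r_neq0//.
apply: cvgM => //; apply: cvgV; first by rewrite expf_neq0 ?lt0r_neq0.
rewrite -[X in _ --> X]addr0 -[X in _ --> _ + X](mulr0 0).
by apply: cvgD => //; exact: (cvgM ce ce).
Qed.

Lemma ramp'_cvg x : 0 < x -> (fun n => x * ramp' (e n) x) @ \oo --> (0 : R).
Proof.
move=> x0; have ce : e @ \oo --> (0 : R) by exact: cvg_harmonic.
have c : (fun n => pos (x - e n)) @ \oo --> x.
  rewrite -[X in _ --> X](pos_id (ltW x0)) -[X in _ --> pos X]subr0.
  apply: (cvg_comp _ _ (cvgB (cvg_cst x) ce)); exact: cont_pos.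
have c1 : (fun n => pos (x - e n) ^+ 2 + e n ^+ 2) @ \oo --> x ^+ 2.
  rewrite -[X in _ --> X]addr0 -[X in _ --> _ + X](mulr0 0).
  by apply: cvgD; [exact: (cvgM c c)|exact: (cvgM ce ce)].
rewrite -[X in _ --> X](_ : x * (2 * x * (0 * 0) / (x ^+ 2) ^+ 2) = 0); last by rewrite !(mul0r, mulr0).
apply: cvgM; first exact: cvg_cst.
apply: cvgM; first by apply: cvgM; [apply: cvgM => //; exact: cvg_cst|exact: (cvgM ce ce)].
apply: cvgV; first by rewrite !expf_neq0 ?lt0r_neq0.
exact: (cvgM c1 c1).
Qed.

Variables (L : R) (L0 : 0 < L).
Local Notation D := (`]0, L[%classic : set RM).
Let mD : meas D. Proof. exact: itvoo_meas. Qed.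
Let fD : (mu D < +oo)%E. Proof. exact: itvoo_fin. Qed.

Let in_D x : D x -> 0 < x < L. Proof. by rewrite /= in_itv. Qed.

Definition end_dist (b : bool) (x : R) : R := if b then x else L - x.
Definition end_sign (b : bool) : R := if b then 1 else -1.

Lemma end_dist_derive b (x : R) : is_derive x 1 (end_dist b) (end_sign b).
Proof.
case: b; rewrite /end_dist /end_sign; first exact: is_derive_id.
by apply: is_derive_eq; ring.
Qed.

Lemma cont_end_dist b : continuous (end_dist b).
Proof. by apply: continuous_is_derive => x; exact: end_dist_derive. Qed.

Lemma end_dist_gt0 b x : D x -> 0 < end_dist b x.
Proof. by move=> /in_D; case: b => /= /andP[? ?]; lra. Qed.

Lemma ramp_end_dist_derive a b (x : R) : 0 < a ->
  is_derive x 1 (fun y => ramp a (end_dist b y)) (end_sign b * ramp' a (end_dist b x)).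
Proof.
move=> a0; have := is_derive1_comp (ramp_derive a0 (end_dist b x)) (end_dist_derive b x).
by rewrite mulrC.
Qed.

Lemma cont_ramp'_end_dist a b : 0 < a -> continuous (fun x => ramp' a (end_dist b x)).
Proof.
move=> a0 x; apply: (@continuous_comp _ _ _ (end_dist b) (ramp' a)); first exact: cont_end_dist.
exact: cont_ramp'.
Qed.

(** The derivative of the cutoff has mass at most one, since the cutoff is monotone
    with values in [0, 1]. *)
Lemma Rint_ramp'_end_dist b n : \int[mu]_(x in D) ramp' (e n) (end_dist b x) <= 1.
Proof.
have F : \int[mu]_(x in D) ramp' (e n) (end_dist b x) =
    end_sign b * ramp (e n) (end_dist b L) - end_sign b * ramp (e n) (end_dist b 0).
  apply: (@RintFTC _ 0 L _ (fun x => end_sign b * ramp (e n) (end_dist b x))) => //.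
  - exact: ltW.
  - move=> x; have d := ramp_end_dist_derive b x (e_gt0 n).
    apply: is_derive_eq; rewrite /GRing.scale/= mulrA.
    by case: (b); rewrite /end_sign ?mulrNN !mul1r.
  - exact: cont_ramp'_end_dist.
rewrite F; have := @ramp_ge0 _ (e_gt0 n); have := @ramp_le1 _ (e_gt0 n).
by move=> H1 H0; case: b {F}; rewrite /= ?mul1r ?mulN1r ?opprK;
  have := H1 L; have := H0 0; have := H1 (L - 0); have := H0 (L - L); lra.
Qed.

Lemma Rint_end_dist_ramp'_cvg b :
  (fun n => \int[mu]_(x in D) (end_dist b x * ramp' (e n) (end_dist b x))) @ \oo --> (0 : R).
Proof.
have mw n : mfun D (fun x => end_dist b x * ramp' (e n) (end_dist b x)).
  apply: measurable_funM; apply: cont_meas => //; first exact: cont_end_dist.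
  exact: cont_ramp'_end_dist.
have [||||_] := @Rint_dct _ D (fun n x => end_dist b x * ramp' (e n) (end_dist b x))
  (fun=> 0) (fun=> 3) mD mw.
- exact: measurable_cst.
- by apply: aeW => x Dx; apply: ramp'_cvg; exact: end_dist_gt0.
- by apply: (@bnd_intg _ _ _ 3) => // x _; rewrite ger0_norm.
- move=> n x Dx; have w0 := ltW (end_dist_gt0 b Dx).
  rewrite ger0_norm ?ramp'_le//.
  by apply: mulr_ge0 => //; exact: ramp'_ge0.
by rewrite Rintegral_cst// mul0r.
Qed.

(** Mere continuity gives no rate at which F vanishes at the end; the bound is
    linear in the distance up to an arbitrarily small constant. *)
Lemma vanish_end_dist_bnd (F : R -> R) b : {within `[0, L], continuous F} ->
  F (if b then 0 else L) = 0 -> forall eta, 0 < eta ->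
  exists2 K, 0 <= K & forall x, D x -> `|F x| <= eta + K * end_dist b x.
Proof.
move=> cF F0 eta eta0; set p := (if b then 0 else L) in F0.
have [C FC] := within_bnd cF.
have pL : `[0, L]%classic p by rewrite /p /= in_itv/=; case: (b); rewrite lexx ltW.
have /subspace_continuousP/(_ p pL)/cvgrPdist_le/(_ _ eta0) := cF.
move=> [d /= d0 Hd].
have C0 : 0 <= C.
  by have := FC 0; rewrite lexx ltW// => /(_ isT); apply: le_trans.
exists (C / d); first by rewrite divr_ge0// ltW.
move=> x Dx; have w0 := end_dist_gt0 b Dx; have /andP[x0 xL] := in_D Dx.
have xp : `|p - x| = end_dist b x.
  by rewrite /p /end_dist; case: (b); rewrite ?sub0r ?normrN gtr0_norm// subr_gt0.
have [lt|ge] := ltP (end_dist b x) d.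
  have H := Hd x; rewrite /= xp in H.
  have {}H : `|F p - F x| <= eta.
    by apply: (H lt); rewrite in_itv/= !ltW.
  rewrite F0 sub0r normrN in H; apply: le_trans H _.
  by rewrite lerDl; apply: mulr_ge0; [apply: divr_ge0 => //; exact: ltW|exact: ltW].
apply: (@le_trans _ _ C); first by apply: FC; rewrite !ltW.
apply: (@le_trans _ _ (C / d * end_dist b x)); last by rewrite lerDr ltW.
by rewrite -mulrA ler_peMr// mulrC ler_pdivlMr// mul1r.
Qed.

(** The derivative of the cutoff concentrates at the end, where F vanishes: the
    constant of [vanish_end_dist_bnd] meets a mass at most 1, and its linear
    part is handled by [Rint_end_dist_ramp'_cvg]. *)
Lemma ramp'_end_dist_cvg (F : R -> R) b : {within `[0, L], continuous F} ->
  F (if b then 0 else L) = 0 ->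
  (fun n => \int[mu]_(x in D) (`|F x| * ramp' (e n) (end_dist b x))) @ \oo --> (0 : R).
Proof.
move=> cF F0; apply/cvgrPdist_le => eta eta0.
have eta2 : 0 < eta / 2 by lra.
have [K K0 FK] := vanish_end_dist_bnd cF F0 eta2.
have c0 : (fun n => K * \int[mu]_(x in D) (end_dist b x * ramp' (e n) (end_dist b x))) @ \oo --> K * 0.
  by apply: cvgM; [exact: cvg_cst|exact: Rint_end_dist_ramp'_cvg].
move: c0; rewrite mulr0 => /cvgrPdist_le/(_ _ eta2); apply: filterS => n.
have LF := within_L2 cF.
have cr : continuous (fun x => ramp' (e n) (end_dist b x)) by exact: cont_ramp'_end_dist.
have Lr : L2 D (fun x => ramp' (e n) (end_dist b x)) by apply: within_L2; exact: cont_within.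
have Lw : L2 D (end_dist b) by apply: within_L2; apply: cont_within; exact: cont_end_dist.
have r0 x : 0 <= ramp' (e n) (end_dist b x) by exact: ramp'_ge0.
rewrite !sub0r !normrN => H.
have Ir : intg D (fun x => ramp' (e n) (end_dist b x)) by exact: L2_intg.
have Iwr : intg D (fun x => end_dist b x * ramp' (e n) (end_dist b x)) by exact: intg_L2M.
have IFr : intg D (fun x => `|F x| * ramp' (e n) (end_dist b x)).
  have := integrable_norm (intg_L2M mD LF Lr); apply: eq_integrable => // x _ /=.
  by rewrite normrM (ger0_norm (r0 x)).
rewrite ger0_norm; last first.
  by apply: Rintegral_ge0 => x _; rewrite mulr_ge0.
apply: (@le_trans _ _ (\int[mu]_(x in D) (eta / 2 * ramp' (e n) (end_dist b x) +
    K * (end_dist b x * ramp' (e n) (end_dist b x))))).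
  apply: le_Rintegral => //; first by apply: intgD => //; exact: intgZ.
  move=> x Dx; apply: le_trans (ler_wpM2r (r0 x) (FK x Dx)) _.
  by rewrite le_eqVlt; apply/orP; left; apply/eqP; ring.
rewrite RintD//; [|exact: intgZ..]; rewrite !RintZl//.
rewrite [leRHS]splitr lerD//.
  by rewrite -[leRHS]mulr1 ler_wpM2l ?Rint_ramp'_end_dist// ltW.
exact: le_trans (ler_norm _) H.
Qed.

Definition cutoff n x : R := ramp (e n) (end_dist true x) * ramp (e n) (end_dist false x).
Definition cutoff' n x : R :=
  ramp' (e n) (end_dist true x) * ramp (e n) (end_dist false x)
  - ramp (e n) (end_dist true x) * ramp' (e n) (end_dist false x).

Lemma cutoff_derive n (x : R) : is_derive x 1 (cutoff n) (cutoff' n x).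
Proof.
have d1 := ramp_end_dist_derive true x (e_gt0 n).
have d2 := ramp_end_dist_derive false x (e_gt0 n).
by apply: is_derive_eq; rewrite /GRing.scale/= /cutoff' /end_dist; ring.
Qed.

Lemma cont_ramp_end_dist n b : continuous (fun x => ramp (e n) (end_dist b x)).
Proof.
by apply: continuous_is_derive => x; exact: (ramp_end_dist_derive b x (e_gt0 n)).
Qed.

Lemma cont_cutoff' n : continuous (cutoff' n).
Proof.
move=> x; apply: cvgB; apply: cvgM;
  [exact: cont_ramp'_end_dist|exact: cont_ramp_end_dist|exact: cont_ramp_end_dist|exact: cont_ramp'_end_dist].
Qed.

Lemma cutoff_ge0 n x : 0 <= cutoff n x.
Proof. by apply: mulr_ge0; exact: ramp_ge0. Qed.

Lemma cutoff_le1 n x : cutoff n x <= 1.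
Proof.
rewrite -[leRHS]mulr1; apply: ler_pM;
  [exact: ramp_ge0|exact: ramp_ge0|exact: ramp_le1|exact: ramp_le1].
Qed.

Lemma cutoff_cvg x : D x -> (fun n => cutoff n x) @ \oo --> (1 : R).
Proof.
move=> Dx; rewrite -[X in _ --> X]mulr1.
by apply: cvgM; apply: ramp_cvg; exact: end_dist_gt0.
Qed.

Lemma cutoff'_le n x : `|cutoff' n x| <= ramp' (e n) (end_dist true x) + ramp' (e n) (end_dist false x).
Proof.
have r0 b : 0 <= ramp (e n) (end_dist b x) by exact: ramp_ge0.
have r1 b : ramp (e n) (end_dist b x) <= 1 by exact: ramp_le1.
have r'0 b : 0 <= ramp' (e n) (end_dist b x) by exact: ramp'_ge0.
rewrite /cutoff'; move: (r0 true) (r0 false) (r1 true) (r1 false) (r'0 true) (r'0 false).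
move: (ramp _ _) (ramp _ _) (ramp' _ _) (ramp' _ _) => a b c d *.
by rewrite ler_norml; nra.
Qed.

Lemma test_cutoff (h h' : R -> R) n : (forall x : R, is_derive x 1 h (h' x)) ->
  continuous h' ->
  test_function L (fun x => h x * cutoff n x) /\
  derive1 (fun x => h x * cutoff n x) = (fun x => h' x * cutoff n x + h x * cutoff' n x).
Proof.
move=> dh ch'.
have d (x : R) : is_derive x 1 (fun x => h x * cutoff n x) (h' x * cutoff n x + h x * cutoff' n x).
  have d1 := dh x; have d2 := cutoff_derive n x.
  by apply: is_derive_eq; rewrite /GRing.scale/=; ring.
have E : derive1 (fun x => h x * cutoff n x) = (fun x => h' x * cutoff n x + h x * cutoff' n x).
  by apply/funext => x; rewrite derive1E; apply: derive_val.
split => //; split.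
- by move=> x; case: (d x).
- rewrite E => x; apply: cvgD; apply: cvgM.
  + exact: ch'.
  + by apply: continuous_is_derive => y; exact: (cutoff_derive n y).
  + by apply: continuous_is_derive => y; exact: (dh y).
  + exact: cont_cutoff'.
- exists (e n), (L - e n); split => //; first by rewrite ltrBlDr ltrDl.
  move=> x; rewrite negb_and -!ltNge => /orP[H|H]; rewrite /cutoff /end_dist.
    by rewrite (@ramp_eq0 (e n) x (ltW H)) mul0r mulr0.
  by rewrite (@ramp_eq0 (e n) (L - x)) ?mulr0//; lra.
Qed.

Lemma Rint_cutoff_cvg (f : RM -> R) : intg D f ->
  (fun n => \int[mu]_(x in D) (f x * cutoff n x)) @ \oo --> \int[mu]_(x in D) f x.
Proof.
move=> If; have mf := intg_meas mD If.
have mc n : mfun D (cutoff n).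
  by apply: cont_meas => //; apply: continuous_is_derive => y; exact: (cutoff_derive n y).
have [|||||//] := @Rint_dct _ D (fun n x => f x * cutoff n x) f (fun x => `|f x|) mD.
- by move=> n; exact: measurable_funM.
- exact: mf.
- apply: aeW => x Dx; rewrite -[X in _ --> X]mulr1.
  by apply: cvgM; [exact: cvg_cst|exact: cutoff_cvg].
- exact: integrable_norm.
- move=> n x _; rewrite normrM ler_piMr// ger0_norm ?cutoff_le1//; exact: cutoff_ge0.
Qed.

(** h times a cutoff is a test function; when the cutoff widens, the term which
    carries its derivative disappears because f vanishes at the ends. *)
Lemma weak_IBP0 (f g h h' : R -> R) : {within `[0, L], continuous f} -> intg D g ->
  weak_derivative L f g -> f 0 = 0 -> f L = 0 ->
  (forall x : R, is_derive x 1 h (h' x)) -> continuous h' ->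
  \int[mu]_(x in D) (g x * h x) = - \int[mu]_(x in D) (f x * h' x).
Proof.
move=> cf Ig fg f0 fL dh ch'.
have ch := continuous_is_derive dh.
have Lf := within_L2 cf.
have Lh : L2 D h by apply: within_L2; exact: cont_within.
have Lh' : L2 D h' by apply: within_L2; exact: cont_within.
have [B hB] := within_bnd (cont_within (D := `[0, L]) ch).
have Igh : intg D (fun x => g x * h x).
  apply: (@intgM_bnd _ _ _ _ B) => //; first by case: Lh.
  by move=> x /in_D /andP[x0 xL]; apply: hB; rewrite !ltW.
have Ifh' := intg_L2M mD Lf Lh'.
have c1 := Rint_cutoff_cvg Ifh'; have c2 := Rint_cutoff_cvg Igh.
have cF : {within `[0, L], continuous (fun x => f x * h x)}.
  move=> x; apply: cvgM; first exact: cf.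
  exact: (cont_within ch).
have F0 : (fun x => f x * h x) 0 = 0 by rewrite f0 mul0r.
have FL : (fun x => f x * h x) L = 0 by rewrite fL mul0r.
have ct := @ramp'_end_dist_cvg _ true cF F0; have cf' := @ramp'_end_dist_cvg _ false cF FL.
have Lc' n : L2 D (cutoff' n) by apply: within_L2; apply: cont_within; exact: cont_cutoff'.
have LF := within_L2 cF.
have IF n : intg D (fun x => f x * h x * cutoff' n x) by exact: intg_L2M.
have c3 : (fun n => \int[mu]_(x in D) (f x * h x * cutoff' n x)) @ \oo --> (0 : R).
  have lim : (fun n => \int[mu]_(x in D) (`|f x * h x| * ramp' (e n) (end_dist true x)) +
      \int[mu]_(x in D) (`|f x * h x| * ramp' (e n) (end_dist false x))) @ \oo --> (0 : R).
    by rewrite -[X in _ --> X]addr0; exact: cvgD.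
  apply/norm_cvg0P; move: lim.
  apply: squeeze_cvgr; last exact: cvg_cst.
  apply: nearW => n; rewrite normr_ge0/=.
  apply: le_trans (le_normr_Rintegral mD (IF n)) _.
  have Ir b : intg D (fun x => `|f x * h x| * ramp' (e n) (end_dist b x)).
    have Lr : L2 D (fun x => ramp' (e n) (end_dist b x)).
      by apply: within_L2; apply: cont_within; exact: cont_ramp'_end_dist.
    have := integrable_norm (intg_L2M mD LF Lr); apply: eq_integrable => // x _ /=.
    by rewrite normrM (ger0_norm (ramp'_ge0 _ _)).
  rewrite -RintD; [|exact: mD|exact: (Ir true)|exact: (Ir false)].
  apply: le_Rintegral => //.
  - by apply: integrable_norm; exact: IF.
  - by apply: intgD; [exact: mD|exact: (Ir true)|exact: (Ir false)].
  by move=> x _; rewrite normrM -mulrDr ler_wpM2l// cutoff'_le.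
have E n : \int[mu]_(x in D) (f x * h' x * cutoff n x) +
    \int[mu]_(x in D) (f x * h x * cutoff' n x) =
    - \int[mu]_(x in D) (g x * h x * cutoff n x).
  have [tf dE] := test_cutoff n dh ch'.
  have := fg _ tf; rewrite dE => H.
  transitivity (- \int[mu]_(x in D) (g x * (h x * cutoff n x))); last first.
    by congr (- _); apply: eq_Rint => x _; rewrite mulrA.
  rewrite -H -RintD//.
    by apply: eq_Rint => x _; ring.
  apply: (@intgM_bnd _ _ _ _ 1) => //.
    by apply: cont_meas => //; apply: continuous_is_derive => y; exact: (cutoff_derive n y).
  by move=> x _; rewrite ger0_norm ?cutoff_le1//; exact: cutoff_ge0.
have lim1 : (fun n => - \int[mu]_(x in D) (g x * h x * cutoff n x)) @ \oo -->
    \int[mu]_(x in D) (f x * h' x).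
  rewrite -[X in _ --> X]addr0 (_ : (fun n => - _) = (fun n =>
     \int[mu]_(x in D) (f x * h' x * cutoff n x) +
     \int[mu]_(x in D) (f x * h x * cutoff' n x))); first exact: cvgD.
  by apply/funext => n; rewrite E.
have lim2 : (fun n => - \int[mu]_(x in D) (g x * h x * cutoff n x)) @ \oo -->
    - \int[mu]_(x in D) (g x * h x) by exact: cvgN.
by rewrite -(cvg_unique _ lim2 lim1) ?opprK.
Qed.

Lemma smooth_weak_derivative (f f' : R -> R) : (forall x : R, is_derive x 1 f (f' x)) ->
  continuous f' -> weak_derivative L f f'.
Proof.
move=> df cf' psi [dpsi cpsi [a [b [a0 bL psi0]]]].
have E0 : psi 0 = 0 by apply: psi0; lra.
have EL : psi L = 0 by apply: psi0; lra.
have -> : \int[mu]_(x in D) (f' x * psi x) = f L * psi L - f 0 * psi 0 -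
    \int[mu]_(x in D) (f x * derive1 psi x).
  apply: RintIBP => //; first exact: ltW.
  by move=> x; rewrite derive1E; exact: derivableP.
by rewrite E0 EL !mulr0 subrr sub0r opprK.
Qed.

(** Subtracting from f the affine function with the same traces reduces to
    [weak_IBP0]. *)
Lemma weak_IBP (f g h h' : R -> R) : {within `[0, L], continuous f} -> intg D g ->
  weak_derivative L f g ->
  (forall x : R, is_derive x 1 h (h' x)) -> continuous h' ->
  \int[mu]_(x in D) (g x * h x) =
  f L * h L - f 0 * h 0 - \int[mu]_(x in D) (f x * h' x).
Proof.
move=> cf Ig fg dh ch'.
(* the affine function with the traces of f *)
pose c := (f L - f 0) / L.
pose l x := f 0 + c * x.
have dl (x : R) : is_derive x 1 l c.
  by apply: is_derive_eq; rewrite /GRing.scale/=; ring.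
have cl := continuous_is_derive dl.
have cc : continuous (fun _ : R => c) by exact: cst_continuous.
have ch := continuous_is_derive dh.
have Ll : L2 D l by apply: within_L2; exact: cont_within.
have Lf := within_L2 cf.
have Lh : L2 D h by apply: within_L2; exact: cont_within.
have Lc : L2 D (fun=> c) by apply: within_L2; exact: cont_within.
have Lh' : L2 D h' by apply: within_L2; exact: cont_within.
have [B hB] := within_bnd (cont_within (D := `[0, L]) ch).
have Igh : intg D (fun x => g x * h x).
  apply: (@intgM_bnd _ _ _ _ B) => //; first by case: Lh.
  by move=> x /in_D /andP[x0 xL]; apply: hB; rewrite !ltW.
have l0 : l 0 = f 0 by rewrite /l mulr0 addr0.
have lL : l L = f L by rewrite /l /c; field; rewrite gt_eqF.
have := @weak_IBP0 (fun x => f x - l x) (fun x => g x - c) h h'.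
have -> : \int[mu]_(x in D) ((g x - c) * h x) =
    \int[mu]_(x in D) (g x * h x) - \int[mu]_(x in D) (c * h x).
  rewrite -RintB//; last exact: intg_L2M.
  by apply: eq_Rint => x _; rewrite mulrBl.
have -> : \int[mu]_(x in D) ((f x - l x) * h' x) =
    \int[mu]_(x in D) (f x * h' x) - \int[mu]_(x in D) (l x * h' x).
  rewrite -RintB//; [|exact: intg_L2M..].
  by apply: eq_Rint => x _; rewrite mulrBl.
have -> : \int[mu]_(x in D) (c * h x) = l L * h L - l 0 * h 0 -
    \int[mu]_(x in D) (l x * h' x).
  by apply: (@RintIBP _ 0 L l (fun=> c)) => //; exact: ltW.
rewrite l0 lL !subrr => H.
suff : \int[mu]_(x in D) (g x * h x) -
    (f L * h L - f 0 * h 0 - \int[mu]_(x in D) (l x * h' x)) =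
    - (\int[mu]_(x in D) (f x * h' x) - \int[mu]_(x in D) (l x * h' x)) by lra.
apply: H => //.
- move=> x; apply: cvgB; first exact: cf.
  exact: (cont_within cl).
- by apply: intgB => //; exact: L2_intg.
- move=> psi tp.
  have [dpsi cpsi _] := tp.
  have cp : continuous psi.
    by move=> x; apply: differentiable_continuous; apply/derivable1_diffP.
  have Lp : L2 D psi by apply: within_L2; exact: cont_within.
  have Lp' : L2 D (derive1 psi) by apply: within_L2; exact: cont_within.
  have [B' pB] := within_bnd (cont_within (D := `[0, L]) cp).
  have Igp : intg D (fun x => g x * psi x).
    apply: (@intgM_bnd _ _ _ _ B') => //; first by case: Lp.
    by move=> x /in_D /andP[x0 xL]; apply: pB; rewrite !ltW.
  have := fg _ tp; have := smooth_weak_derivative dl cc tp.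
  have -> : \int[mu]_(x in D) ((f x - l x) * derive1 psi x) =
    \int[mu]_(x in D) (f x * derive1 psi x) - \int[mu]_(x in D) (l x * derive1 psi x).
    rewrite -RintB//; [|exact: intg_L2M..].
    by apply: eq_Rint => x _; rewrite mulrBl.
  have -> : \int[mu]_(x in D) ((g x - c) * psi x) =
    \int[mu]_(x in D) (g x * psi x) - \int[mu]_(x in D) (c * psi x).
    rewrite -RintB//; last exact: intg_L2M.
    by apply: eq_Rint => x _; rewrite mulrBl.
  by move=> -> ->; ring.
Qed.

End WeakDerivative.

(** * Spectral decomposition of the factored operator *)
Section Modes.
Context {R : realType}.
Local Notation RM := (measurableTypeR R).
Local Notation mu := (@lebesgue_measure R).
Local Notation meas := (@measurable _ RM).
Local Notation mfun := (@measurable_fun _ _ RM R).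
Variables (L : R) (L0 : 0 < L).
Local Notation D := (`]0, L[%classic : set RM).
Let mD : meas D. Proof. exact: itvoo_meas. Qed.
Let fD : (mu D < +oo)%E. Proof. exact: itvoo_fin. Qed.

Lemma Rint_lin (a b : R) (f g : RM -> R) : intg D f -> intg D g ->
  \int[mu]_(x in D) (a * f x + b * g x) =
  a * \int[mu]_(x in D) f x + b * \int[mu]_(x in D) g x.
Proof. by move=> If Ig; rewrite RintD ?RintZl//; exact: intgZ. Qed.

Lemma cont_L2 (f : R -> R) : continuous f -> L2 D f.
Proof. by move=> cf; apply: within_L2; exact: cont_within. Qed.

Definition mode (a : R) k x : R := expR (a * x) * sine L k x.
Definition mode1 (a : R) k x : R :=
  expR (a * x) * (a * sine L k x + freq L k * cos (freq L k * x)).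
(** The second derivative in the form given by the characteristic equation of
    e^(a x) sin(w x), so that modes pair with a weak derivative without
    differentiating it twice. *)
Definition mode2 (a : R) k x : R :=
  2 * a * mode1 a k x - (a ^+ 2 + freq L k ^+ 2) * mode a k x.

Lemma mode_derive a k (x : R) : is_derive x 1 (mode a k) (mode1 a k x).
Proof.
have d1 := expM_derive a x; have d2 := sinM_derive (freq L k) x.
by apply: is_derive_eq; rewrite /GRing.scale/= /mode1 /sine; ring.
Qed.

Lemma mode1_derive a k (x : R) : is_derive x 1 (mode1 a k) (mode2 a k x).
Proof.
have d1 := expM_derive a x; have d2 := sinM_derive (freq L k) x.
have d3 := cosM_derive (freq L k) x.
have d4 : is_derive x 1 (fun x => a * sine L k x + freq L k * cos (freq L k * x))
   (a * (freq L k * cos (freq L k * x)) + freq L k * (- freq L k * sin (freq L k * x))).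
  by apply: is_derive_eq; rewrite /GRing.scale/=; ring.
by apply: is_derive_eq; rewrite /GRing.scale/= /mode2 /mode1 /mode /sine; ring.
Qed.

Lemma cont_mode a k : continuous (mode a k).
Proof. by apply: continuous_is_derive => x; exact: mode_derive. Qed.

Lemma cont_mode1 a k : continuous (mode1 a k).
Proof. by apply: continuous_is_derive => x; exact: mode1_derive. Qed.

Lemma cont_mode2 a k : continuous (mode2 a k).
Proof.
by move=> x; apply: cvgB; apply: cvgM; try exact: cvg_cst; [exact: cont_mode1|exact: cont_mode].
Qed.

Lemma mode_0 a k : mode a k 0 = 0.
Proof. by rewrite /mode /sine !mulr0 sin0 mulr0. Qed.

Lemma mode_L a k : mode a k L = 0.
Proof. by rewrite /mode sine_L// mulr0. Qed.

Lemma mode1_0 a k : mode1 a k 0 = freq L k.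
Proof. by rewrite /mode1 /sine !mulr0 expR0 sin0 cos0; ring. Qed.

Lemma mode_H2_H10 a k : H2_H10 L (mode a k) (mode1 a k) (mode2 a k).
Proof.
split; [|exact: mode_0|exact: mode_L]; split.
- by apply: cont_within; exact: cont_mode.
- by apply: cont_within; exact: cont_mode1.
- by apply: cont_L2; exact: cont_mode2.
- by apply: smooth_weak_derivative => //; [move=> x; exact: mode_derive|exact: cont_mode1].
- by apply: smooth_weak_derivative => //; [move=> x; exact: mode1_derive|exact: cont_mode2].
Qed.

Lemma mode_L2 a k : L2 D (mode a k). Proof. by apply: cont_L2; exact: cont_mode. Qed.
Lemma mode1_L2 a k : L2 D (mode1 a k). Proof. by apply: cont_L2; exact: cont_mode1. Qed.
Lemma mode2_L2 a k : L2 D (mode2 a k). Proof. by apply: cont_L2; exact: cont_mode2. Qed.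

Lemma expM_bnd (a : R) : exists B : R, forall x, D x -> `|expR (a * x)| <= B.
Proof.
have [B hB] := within_bnd (cont_within (D := `[0, L]) (@cont_expM R a)).
by exists B => x; rewrite /= in_itv/= => /andP[x0 xL]; apply: hB; rewrite !ltW.
Qed.

Lemma L2_expM (f : R -> R) a : L2 D f -> L2 D (fun x => f x * expR (a * x)).
Proof.
move=> Lf; have [B hB] := expM_bnd a.
by apply: (@L2M_bnd _ _ _ _ B) => //; apply: cont_meas => //; exact: cont_expM.
Qed.

Lemma coef_expM (f : R -> R) a k :
  coef L (fun x => f x * expR (a * x)) k = \int[mu]_(x in D) (f x * mode a k x).
Proof. by apply: eq_Rint => x _; rewrite mulrA. Qed.

(** The weights e^(a x) and e^(- a x) cancel in the product f g: the two families
    of modes are biorthogonal up to the factor L / 2. *)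
Lemma parseval_mode (f g : R -> R) a : L2 D f -> L2 D g ->
  (fun n => 2 / L * \sum_(k < n) (\int[mu]_(x in D) (f x * mode a k x)) *
     (\int[mu]_(x in D) (g x * mode (- a) k x))) @ \oo -->
  \int[mu]_(x in D) (f x * g x).
Proof.
move=> Lf Lg; have := parseval2 L0 (L2_expM a Lf) (L2_expM (- a) Lg).
have -> : \int[mu]_(x in D) (f x * expR (a * x) * (g x * expR (- a * x))) =
    \int[mu]_(x in D) (f x * g x).
  apply: eq_Rint => x _.
  by rewrite mulrACA -expRD -mulrDl subrr mul0r expR0 mulr1.
apply: cvg_trans; apply: near_eq_cvg; apply: nearW => n /=.
by congr (_ * _); apply: eq_bigr => k _; rewrite !coef_expM.
Qed.

Lemma mode_complete (f : R -> R) a : L2 D f ->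
  (forall k, \int[mu]_(x in D) (f x * mode a k x) = 0) -> ae_zero D f.
Proof.
move=> Lf f0; have := coef_eq0 L0 (L2_expM a Lf).
have H k : coef L (fun x => f x * expR (a * x)) k = 0 by rewrite coef_expM.
move=> /(_ H); rewrite /ae_zero => ae; apply: (@filterS _ _ (ae_filter_ringOfSetsType lebesgue_measure) _ _ _ ae) => x /= fx Dx.
by have /eqP := fx Dx; rewrite mulf_eq0 (gt_eqF (expR_gt0 _)) orbF => /eqP.
Qed.

Section H2space.
Variables (phi phi1 phi2 : R -> R).
Hypothesis Hphi : H2_H10 L phi phi1 phi2.

Lemma H2_L2 : [/\ L2 D phi, L2 D phi1 & L2 D phi2].
Proof. by case: Hphi => -[c c1 l2 _ _] _ _; split => //; exact: within_L2. Qed.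

Lemma H2_IBP1 (h h' : R -> R) : (forall x : R, is_derive x 1 h (h' x)) ->
  continuous h' ->
  \int[mu]_(x in D) (phi1 x * h x) = - \int[mu]_(x in D) (phi x * h' x).
Proof.
case: Hphi => -[c c1 l2 w w1] p0 pL dh ch'.
rewrite (weak_IBP L0 c _ w dh ch') ?p0 ?pL; first by ring.
by apply: L2_intg => //; exact: within_L2.
Qed.

Lemma H2_IBP2 (h h' : R -> R) : (forall x : R, is_derive x 1 h (h' x)) ->
  continuous h' ->
  \int[mu]_(x in D) (phi2 x * h x) =
  phi1 L * h L - phi1 0 * h 0 - \int[mu]_(x in D) (phi1 x * h' x).
Proof.
case: Hphi => -[c c1 l2 w w1] p0 pL dh ch'.
by rewrite (weak_IBP L0 c1 _ w1 dh ch')//; exact: L2_intg.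
Qed.

(** All pairings of phi' and phi'' with a mode reduce to the two pairings of phi
    with the mode and its derivative.  No boundary term is left: phi and the
    mode both vanish at the ends. *)
Lemma H2_modes a k :
  let A := \int[mu]_(x in D) (phi x * mode1 a k x) in
  let B := \int[mu]_(x in D) (phi x * mode a k x) in
  let q := a ^+ 2 + freq L k ^+ 2 in
  [/\ \int[mu]_(x in D) (phi1 x * mode a k x) = - A,
      \int[mu]_(x in D) (phi1 x * mode1 a k x) = - (2 * a * A - q * B) &
      \int[mu]_(x in D) (phi2 x * mode a k x) = 2 * a * A - q * B].
Proof.
move=> A B q; have [Lp Lp1 Lp2] := H2_L2.
have Im := mode_L2 a k; have Im1 := mode1_L2 a k; have Im2 := mode2_L2 a k.
have E1 : \int[mu]_(x in D) (phi1 x * mode1 a k x) = - (2 * a * A - q * B).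
  rewrite (H2_IBP1 (mode1_derive a k) (@cont_mode2 a k)).
  have <- : \int[mu]_(x in D) (2 * a * (phi x * mode1 a k x) + - q * (phi x * mode a k x)) =
       2 * a * A - q * B by rewrite Rint_lin ?mulNr//; exact: intg_L2M.
  by congr (- _); apply: eq_Rint => x _; rewrite /mode2 -/q; ring.
split => //; first by rewrite (H2_IBP1 (mode_derive a k) (@cont_mode1 a k)).
rewrite (H2_IBP2 (mode_derive a k) (@cont_mode1 a k)) mode_0 mode_L E1.
by ring.
Qed.

End H2space.

Variables (m eps : R) (m0 : m != 0).
Let delta := - 2 * eps * m.
Let M := eps * m ^+ 3.

(** The eigenvalue of - Q, where Q y = y'' - m y', on the k-th Dirichlet mode. *)
Definition symbol k : R := (m / 2) ^+ 2 + freq L k ^+ 2.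
(** The eigenvalue of eps (Q^2 - m^2 Q), i.e. the decay rate of the k-th mode. *)
Definition decay k : R := eps * (symbol k * (symbol k + m ^+ 2)).

(** The weight a = m / 2 makes the test function an eigenfunction of the forward
    operator, so the pairing with any phi closes up; the pairings with the
    derivative of the mode cancel. *)
Lemma adjoint_form_mode (phi phi1 phi2 : R -> R) k : H2_H10 L phi phi1 phi2 ->
  adjoint_form L eps delta M phi1 phi2 (mode (m / 2) k) (mode1 (m / 2) k) (mode2 (m / 2) k) =
  decay k * \int[mu]_(x in D) (phi x * mode (m / 2) k x).
Proof.
move=> Hp; have [Lp Lp1 Lp2] := H2_L2 Hp.
have [E1 E2 E3] := H2_modes Hp (m / 2) k.
have Im := mode_L2 (m / 2) k; have Im1 := mode1_L2 (m / 2) k.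
have I1 := intg_L2M mD Lp1 Im; have I2 := intg_L2M mD Lp1 Im1; have I3 := intg_L2M mD Lp2 Im.
transitivity (\int[mu]_(x in D) (1 * (- (eps * symbol k) * (phi2 x * mode (m / 2) k x)
   + eps * m ^+ 2 * (phi1 x * mode1 (m / 2) k x))
   + - (eps * (m ^+ 3 + m * symbol k)) * (phi1 x * mode (m / 2) k x))).
  apply: eq_Rint => x _; rewrite /Bstar /delta /M /mode2 /symbol.
  by field.
rewrite !Rint_lin//; last by apply: intgD => //; exact: intgZ.
by rewrite E1 E2 E3 /decay /symbol; field.
Qed.

(** The weight a = - m / 2 makes the first argument an eigenfunction of the
    adjoint operator, B^* vanishing at the ends included. *)
Lemma mode_adjoint_form (psi psi1 psi2 : R -> R) k : H2_H10 L psi psi1 psi2 ->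
  adjoint_form L eps delta M (mode1 (- (m / 2)) k) (mode2 (- (m / 2)) k) psi psi1 psi2 =
  decay k * \int[mu]_(x in D) (mode (- (m / 2)) k x * psi x).
Proof.
move=> Hp; have [Lp Lp1 Lp2] := H2_L2 Hp.
have [E1 E2 E3] := H2_modes Hp (- (m / 2)) k.
have Im := mode_L2 (- (m / 2)) k; have Im1 := mode1_L2 (- (m / 2)) k.
have I0 := intg_L2M mD Lp Im1.
have I1 := intg_L2M mD Lp1 Im; have I2 := intg_L2M mD Lp1 Im1; have I3 := intg_L2M mD Lp2 Im.
transitivity (\int[mu]_(x in D) (1 * (- (eps * symbol k) * (psi2 x * mode (- (m / 2)) k x)
   + eps * m ^+ 2 * (psi1 x * mode1 (- (m / 2)) k x))
   + 1 * ((eps * (m * symbol k)) * (psi1 x * mode (- (m / 2)) k x)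
   + - (eps * m ^+ 3) * (psi x * mode1 (- (m / 2)) k x)))).
  apply: eq_Rint => x _; rewrite /Bstar /delta /M /mode2 /symbol.
  by field.
rewrite !Rint_lin//; [|by apply: intgD => //; exact: intgZ..].
rewrite E1 E2 E3 /decay /symbol.
under [in RHS]eq_Rintegral do rewrite mulrC.
by field.
Qed.

Lemma symbol_gt0 k : 0 < symbol k.
Proof.
by rewrite /symbol ltr_wpDl ?sqr_ge0// exprn_gt0// freq_gt0.
Qed.

(** [lift] solves w'' = m w' with w(0) = 1 and w(L) = 0: it lies in the kernel
    of Q and picks out the trace at x = 0. *)
Let den : R := expR (m * L) - 1.
Let lift (x : R) : R := den^-1 * (expR (m * L) - expR (m * x)).
Let lift1 (x : R) : R := den^-1 * - m * expR (m * x).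

Let den0 : den != 0.
Proof.
rewrite subr_eq0; apply/eqP => E.
have : m * L = 0 by apply: expR_inj; rewrite expR0.
by apply/eqP; rewrite mulf_neq0// gt_eqF.
Qed.

Let lift_derive (x : R) : is_derive x 1 lift (lift1 x).
Proof.
have d1 : is_derive x 1 (fun y => expR (m * L) - expR (m * y)) (- m * expR (m * x)).
  have := is_deriveB (is_derive_cst (expR (m * L)) x 1) (expM_derive m x).
  by rewrite sub0r mulNr.
by have := is_derive_scale den^-1 d1; rewrite mulrA.
Qed.

Let lift1_derive (x : R) : is_derive x 1 lift1 (m * lift1 x).
Proof.
have := is_derive_scale (den^-1 * - m) (expM_derive m x).
by rewrite (mulrCA _ m).
Qed.

Let cont_lift1 : continuous lift1.
Proof. exact: (continuous_is_derive lift1_derive). Qed.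

(** Integrating by parts twice moves Q^* phi = phi'' + m phi' to Q lift = 0, and
    only the boundary term - phi'(0) lift(0) survives. *)
Lemma trace_duality (phi phi1 phi2 : R -> R) : H2_H10 L phi phi1 phi2 ->
  \int[mu]_(x in D) ((phi2 x + m * phi1 x) * lift x) = - phi1 0.
Proof.
move=> Hp; have [Lp Lp1 Lp2] := H2_L2 Hp.
have Ll : L2 D lift.
  by apply: cont_L2; exact: (continuous_is_derive lift_derive).
have Ll1 : L2 D lift1 by apply: cont_L2; exact: cont_lift1.
have clift1' : continuous (fun x => m * lift1 x).
  by move=> x; apply: cvgM; [exact: cvg_cst|exact: cont_lift1].
transitivity (\int[mu]_(x in D) (1 * (phi2 x * lift x) + m * (phi1 x * lift x))).
  by apply: eq_Rint => x _; ring.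
rewrite Rint_lin; [|exact: intg_L2M..].
rewrite (H2_IBP2 Hp lift_derive cont_lift1) (H2_IBP1 Hp lift_derive cont_lift1).
rewrite (H2_IBP1 Hp lift1_derive clift1').
have -> : \int[mu]_(x in D) (phi x * (m * lift1 x)) = m * \int[mu]_(x in D) (phi x * lift1 x).
  rewrite -RintZl//; last exact: intg_L2M.
  by apply: eq_Rint => x _; ring.
have -> : lift L = 0 by rewrite /lift subrr mulr0.
have -> : lift 0 = 1 by rewrite /lift mulr0 expR0 mulVf.
by ring.
Qed.

Lemma drift_mode (phi phi1 phi2 : R -> R) k : H2_H10 L phi phi1 phi2 ->
  \int[mu]_(x in D) ((phi2 x + m * phi1 x) * mode (m / 2) k x) =
  - symbol k * \int[mu]_(x in D) (phi x * mode (m / 2) k x).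
Proof.
move=> Hp; have [Lp Lp1 Lp2] := H2_L2 Hp; have Im := mode_L2 (m / 2) k.
have [E1 E2 E3] := H2_modes Hp (m / 2) k.
transitivity (\int[mu]_(x in D) (1 * (phi2 x * mode (m / 2) k x) + m * (phi1 x * mode (m / 2) k x))).
  by apply: eq_Rint => x _; ring.
rewrite Rint_lin; [|exact: intg_L2M..].
by rewrite E1 E3 /symbol; field.
Qed.

(** [trace_duality] for phi an eigenfunction of Q^*. *)
Lemma lift_mode k :
  \int[mu]_(x in D) (lift x * mode (- (m / 2)) k x) = freq L k / symbol k.
Proof.
have := trace_duality (mode_H2_H10 (- (m / 2)) k); rewrite mode1_0.
have Ll : L2 D lift.
  by apply: cont_L2; exact: (continuous_is_derive lift_derive).
have -> : \int[mu]_(x in D) ((mode2 (- (m / 2)) k x + m * mode1 (- (m / 2)) k x) * lift x) =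
    - symbol k * \int[mu]_(x in D) (lift x * mode (- (m / 2)) k x).
  rewrite -RintZl//; last by apply: intg_L2M => //; exact: mode_L2.
  by apply: eq_Rint => x _; rewrite /mode2 /symbol; field.
move=> H; apply: (mulfI (lt0r_neq0 (symbol_gt0 k))).
have s0 := lt0r_neq0 (symbol_gt0 k).
by rewrite [RHS]mulrC divfK//; move: H; rewrite mulNr => /oppr_inj.
Qed.

(** Differentiating the expansion of phi termwise at 0 is not directly legitimate.
    Instead, phi'(0) is the inner product of Q^* phi and [lift], both in L^2, and
    Parseval's identity applies; the factors q_k of the two coefficients cancel. *)
Lemma trace_series (phi phi1 phi2 : R -> R) : H2_H10 L phi phi1 phi2 ->
  (fun n => 2 / L * \sum_(k < n) freq L k * \int[mu]_(x in D) (phi x * mode (m / 2) k x))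
  @ \oo --> phi1 0.
Proof.
move=> Hp; have [Lp Lp1 Lp2] := H2_L2 Hp.
have Ll : L2 D lift.
  by apply: cont_L2; exact: (continuous_is_derive lift_derive).
have Lf : L2 D (fun x => phi2 x + m * phi1 x) by apply: L2D => //; exact: L2Z.
rewrite -[phi1 0]opprK -(trace_duality Hp).
rewrite (_ : (fun n => _) = (fun n => - (2 / L * \sum_(k < n)
   (\int[mu]_(x in D) ((phi2 x + m * phi1 x) * mode (m / 2) k x)) *
   (\int[mu]_(x in D) (lift x * mode (- (m / 2)) k x))))).
  by apply: cvgN; exact: parseval_mode.
apply/funext => n; rewrite -mulrN -sumrN; congr (_ * _); apply: eq_bigr => k _.
have s0 := lt0r_neq0 (symbol_gt0 k).
by rewrite (drift_mode k Hp) lift_mode; field.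
Qed.

End Modes.

(** * Exchange of limits, and Gronwall's argument *)
Section SeriesAndGronwall.
Context {R : realType}.
Local Notation RM := (measurableTypeR R).
Local Notation mu := (@lebesgue_measure R).
Local Notation meas := (@measurable _ RM).
Local Notation mfun := (@measurable_fun _ _ RM R).

Lemma EFin_Rint (D : set RM) (f : RM -> R) : meas D -> intg D f ->
  (\int[mu]_(x in D) (f x)%:E)%E = (\int[mu]_(x in D) f x)%:E.
Proof. by move=> mD If; rewrite /Rintegral fineK//; exact: integrable_fin_num. Qed.

(** Termwise integration when the L^1 norms are summable: the sum of the absolute
    values is integrable by monotone convergence and serves as dominating
    function. *)
Lemma Rint_series (D : set RM) (g : nat -> RM -> R) (G : nat -> R) (C : R)
    (f : RM -> R) : meas D -> (forall n, intg D (g n)) ->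
  (forall n, \int[mu]_(x in D) `|g n x| <= G n) ->
  (forall n, \sum_(i < n) G i <= C) -> mfun D f ->
  {ae mu, forall x, D x -> (fun n => \sum_(i < n) g i x) @ \oo --> f x} ->
  (fun n => \sum_(i < n) \int[mu]_(x in D) g i x) @ \oo --> \int[mu]_(x in D) f x.
Proof.
move=> mD Ig gG GC mf gf.
have Ign n : intg D (fun x => `|g n x|) by apply: integrable_norm; exact: Ig.
have mg n : measurable_fun D (fun x => (`|g n x|)%:E).
  by apply/measurable_EFinP; exact: intg_meas (Ign n).
pose H x := (\sum_(k <oo) (`|g k x|)%:E)%E.
have IH : mu.-integrable D H.
  apply/integrableP; split.
    by apply: ge0_emeasurable_sum => // k x _ _; rewrite lee_fin.
  have H0 x : (0 <= H x)%E by apply: nneseries_ge0 => k _ _; rewrite lee_fin.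
  under eq_integral do rewrite gee0_abs//.
  rewrite integral_nneseries//.
  apply: (@le_lt_trans _ _ C%:E); last exact: ltry.
  apply: lime_le.
    by apply: is_cvg_nneseries => n _ _; apply: integral_ge0 => x _; rewrite lee_fin.
  apply: nearW => n.
  under eq_bigr do rewrite EFin_Rint//.
  rewrite sumEFin lee_fin big_mkord; apply: le_trans (GC n).
  by apply: ler_sum => i _; exact: gG.
have mS n : measurable_fun D (fun x => (\sum_(i < n) g i x)%:E).
  apply/measurable_EFinP; apply: measurable_sum => i; exact: intg_meas (Ig i).
have [] := @dominated_convergence _ _ _ mu D mD (fun n x => (\sum_(i < n) g i x)%:E)
   (EFin \o f) H mS.
- exact/measurable_EFinP.
- apply: filterS gf => x /= gf Dx; apply: cvg_EFin; last exact: gf.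
  exact: nearW.
- exact: IH.
- apply: aeW => /= x n Dx.
  apply: (@le_trans _ _ (\sum_(0 <= k < n) (`|g k x|)%:E)%E).
    by rewrite sumEFin lee_fin big_mkord ler_norm_sum.
  by apply: nneseries_lim_ge => k _ _; rewrite lee_fin.
move=> If _ cF.
rewrite (_ : (fun n => \sum_(i < n) _) =
  (fun n => \int[mu]_(x in D) (\sum_(i < n) g i x))); last first.
  by apply/funext => n; rewrite Rint_sum.
rewrite /Rintegral; apply: fine_cvg; rewrite fineK//.
exact: integrable_fin_num.
Qed.

(** Dominated convergence for series of nonnegative terms along a filter. *)
Lemma tannery {T : Type} (F : set_system T) {FF : ProperFilter F} (a : nat -> T -> R)
    (S : T -> R) (beta : nat -> R) (C : R) (P : set T) : F P ->
  (forall k r, P r -> 0 <= a k r <= beta k) ->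
  (forall n, \sum_(k < n) beta k <= C) ->
  (forall r, P r -> (fun n => \sum_(k < n) a k r) @ \oo --> S r) ->
  (forall k, a k r @[r --> F] --> (0 : R)) -> S r @[r --> F] --> (0 : R).
Proof.
move=> FP ab bC aS a0; apply/cvgrPdist_le => e e0.
have [r0 Pr0] := @filter_ex _ F FF P FP.
have b0 k : 0 <= beta k by have /andP[/le_trans] := ab k r0 Pr0; apply.
pose B n := \sum_(k < n) beta k.
have ndB : nondecreasing_seq B.
  by apply/nondecreasing_seqP => n; rewrite /B big_ord_recr/= lerDl.
have cB : cvgn B.
  by apply: nondecreasing_is_cvgn => //; exists C => _ [n _ <-]; exact: bC.
have e2 : 0 < e / 2 by lra.
have [N _ HN] := (cvgrPdist_le _ _).1 cB _ e2.
have tail n : B n - B N <= e / 2.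
  have H1 := nondecreasing_cvgn_le ndB cB n.
  have := HN N (leqnn N); rewrite /= => /(le_trans (ler_norm _)) H2.
  by apply: le_trans H2; rewrite lerD2r.
have fin : (fun r => \sum_(k < N) a k r) @ F --> (0 : R).
  elim: N {HN tail} => [|N IH].
    by under eq_fun do rewrite big_ord0; exact: cvg_cst.
  under eq_fun do rewrite big_ord_recr/=.
  by have := cvgD IH (a0 N); rewrite addr0; apply.
move/cvgrPdist_le: fin => /(_ _ e2) Hf.
near=> r.
have Pr : P r by near: r.
have Hr : `|0 - \sum_(k < N) a k r| <= e / 2 by near: r.
rewrite sub0r normrN in Hr; rewrite sub0r normrN.
have SN : S r <= \sum_(k < N) a k r + e / 2.
  have cS := aS r Pr.
  rewrite -(cvg_lim _ cS)//; apply: limr_le; first by apply/cvg_ex; exists (S r).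
  exists N => // n /= Nn.
  apply: le_trans (_ : _ <= \sum_(k < N) a k r + (B n - B N)) _; last by rewrite lerD2l.
  rewrite /B -(subnKC Nn) !big_split_ord/= [X in _ <= _ + X]addrC addKr lerD2l.
  by apply: ler_sum => i _; have /andP[] := ab (N + i)%N r Pr.
have S0 : 0 <= S r.
  have cS := aS r Pr.
  rewrite -(cvg_lim _ cS)//; apply: limr_ge; first by apply/cvg_ex; exists (S r).
  by apply: nearW => n; apply: sumr_ge0 => i _; have /andP[] := ab i r Pr.
rewrite ger0_norm//; apply: le_trans SN _; rewrite [leRHS]splitr lerD2r.
exact: le_trans (ler_norm _) Hr.
Unshelve. all: by end_near. Qed.

(** Iterating the inequality gives |d(s)| <= K (lam (t - s))^n / n! for all n. *)
Lemma gronwall (t lam K : R) (d : R -> R) : 0 <= lam -> 0 <= t ->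
  (forall s, 0 <= s <= t -> `|d s| <= K) -> mfun `]0, t[ d ->
  (forall s, 0 <= s <= t -> `|d s| <= lam * \int[mu]_(r in `]s, t[) `|d r|) ->
  forall s, 0 <= s <= t -> d s = 0.
Proof.
move=> lam0 t0 dK md dI.
have H n s : 0 <= s <= t -> `|d s| <= K * exp_coeff (lam * (t - s)) n.
  elim: n s => [|n IH] s st.
    by rewrite /exp_coeff/= expr0 divr1 mulr1; exact: dK.
  have /andP[s0 s1] := st.
  apply: le_trans (dI s st) _.
  have mI := itvoo_meas s t.
  pose F r := - K * (lam ^+ n / (n.+1)`!%:R) * (t - r) ^+ n.+1.
  pose f r := K * exp_coeff (lam * (t - r)) n.
  have dF (r : R) : is_derive r 1 F (f r).
    have d1 : is_derive r 1 (fun r => t - r) (-1) by apply: is_derive_eq; ring.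
    have d2 : is_derive r 1 (fun r => (t - r) ^+ n.+1) (- (n.+1%:R * (t - r) ^+ n)).
      have := is_deriveX n.+1 d1; rewrite exprfctE.
      by congr (is_derive _ _ _ _); rewrite /GRing.scale/=; ring.
    have -> : f r = - K * (lam ^+ n / (n.+1)`!%:R) * - (n.+1%:R * (t - r) ^+ n).
      rewrite /f /exp_coeff/= exprMn factS natrM.
      by field; rewrite -mulrS !pnatr_eq0 -lt0n fact_gt0.
    exact: is_derive_scale.
  have cf : continuous f.
    move=> r; apply: cvgM; first exact: cvg_cst.
    apply: cvgM; last exact: cvg_cst.
    apply: (@continuous_comp _ _ _ (fun r => lam * (t - r)) (fun y => y ^+ n) r).
      by apply: cvgM; [exact: cvg_cst|apply: cvgB; [exact: cvg_cst|exact: cvg_id]].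
    exact: exprn_continuous.
  have sub : `]s, t[ `<=` `]0, t[ by apply: subset_itv; rewrite bnd_simp.
  have IF : intg `]s, t[ f.
    by apply: L2_intg => //; [exact: itvoo_fin|apply: within_L2; exact: cont_within].
  have Id : intg `]s, t[ (fun r => `|d r|).
    apply: integrable_norm; apply: (@bnd_intg _ _ _ K) => //; first exact: itvoo_fin.
      exact: (@measurable_funS _ _ RM R `]0, t[ _ _ (itvoo_meas _ _) sub md).
    move=> r; rewrite /= in_itv/= => /andP[r0 r1]; apply: dK.
    by rewrite (ltW r1) (le_trans s0 (ltW r0)).
  apply: (@le_trans _ _ (lam * \int[mu]_(r in `]s, t[) f r)).
    rewrite ler_wpM2l//; apply: le_Rintegral => // r.
    rewrite /= in_itv/= => /andP[r0 r1]; apply: IH.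
    by rewrite (ltW r1) (le_trans s0 (ltW r0)).
  rewrite (@RintFTC _ s t f F s1 dF cf) /F subrr expr0n mulr0 sub0r.
  rewrite le_eqVlt /exp_coeff/= exprMn (exprS lam); apply/orP; left; apply/eqP; ring.
move=> s st; apply/eqP; rewrite -normr_le0.
have c : (fun n => K * exp_coeff (lam * (t - s)) n) @ \oo --> K * 0.
  apply: cvgM; first exact: cvg_cst.
  by apply: cvg_series_cvg_0; exact: is_cvg_series_exp_coeff.
rewrite mulr0 in c; rewrite -(cvg_lim _ c)//; apply: limr_ge.
  by apply/cvg_ex; exists 0.
by apply: nearW => n; exact: H.
Qed.

Lemma section_Rint_meas (t L : R) (Xi : RM * RM -> R) :
  measurable_fun (`]0, t[ `*` `[0, L] : set (RM * RM)) Xi ->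
  mfun `]0, t[ (fun r => \int[mu]_(x in `]0, L[) Xi (r, x)).
Proof.
move=> mXi; pose E : set (RM * RM) := `]0, t[ `*` `]0, L[.
have mE : measurable E by apply: measurableX; exact: itvoo_meas.
pose f := (EFin \o Xi) \_ E.
have mf : measurable_fun setT f.
  apply/(measurable_restrict _ mE measurableT); rewrite setTI.
  apply/measurable_EFinP; apply: measurable_funS mXi.
    by apply: measurableX; exact: measurable_itv.
  by move=> z [/= z1 z2]; split => //; exact: subset_itv_oo_cc z2.
have mp := @measurable_fun_fubini_tonelli_F _ _ RM RM R mu _ (measurable_funepos mf) (fun=> funepos_ge0 _ _).
have mn := @measurable_fun_fubini_tonelli_F _ _ RM RM R mu _ (measurable_funeneg mf) (fun=> funeneg_ge0 _ _).
have mF : measurable_fun (`]0, t[ : set RM) (fun r => (\int[mu]_(x in `]0%R, L[) (Xi (r, x))%:E)%E).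
  apply: (eq_measurable_fun (fun r => (fubini_F mu f^\+ r - fubini_F mu f^\- r)%E)).
    move=> r /set_mem rt; rewrite [RHS]integral_mkcond [RHS]integralE.
    have E1 x : ((fun x => (Xi (r, x))%:E) \_ `]0%R, L[) x = f (r, x).
      rewrite /f !patchE; congr (if _ then _ else _).
      by apply/idP/idP => /set_mem => [xL|[_ xL]]; apply/mem_set.
    by rewrite /fubini_F; congr (_ - _)%E; apply: eq_integral => x _;
      rewrite ?funeposE ?funenegE E1.
  by apply: measurable_funTS; apply: emeasurable_funB.
by apply: (measurableT_comp _ mF); exact: fine_measurable.
Qed.

End SeriesAndGronwall.

(** * Solutions of the adjoint system *)
Section Adjoint.
Context {R : realType}.
Local Notation RM := (measurableTypeR R).
Local Notation mu := (@lebesgue_measure R).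
Local Notation meas := (@measurable _ RM).
Local Notation mfun := (@measurable_fun _ _ RM R).
Variables (L : R) (L0 : 0 < L) (m eps : R) (eps0 : 0 < eps).
Local Notation D := (`]0, L[%classic : set RM).
Let mD : meas D. Proof. exact: itvoo_meas. Qed.
Let delta := - 2 * eps * m.
Let M := eps * m ^+ 3.
Let lam k := decay L m eps k.

Lemma decay_gt0 k : 0 < decay L m eps k.
Proof.
by rewrite mulr_gt0// mulr_gt0 ?symbol_gt0// ltr_wpDr ?sqr_ge0// symbol_gt0.
Qed.

(** Bessel's inequality for a single coefficient; it stands in for the
    Cauchy-Schwarz inequality, with a constant independent of k. *)
Lemma mode_pairing_sq a : exists2 C : R, 0 <= C & forall k (f : R -> R), L2 D f ->
  (\int[mu]_(x in D) (f x * mode L a k x)) ^+ 2 <= C * \int[mu]_(x in D) (f x ^+ 2).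
Proof.
have [B hB] := expM_bnd L a.
have B0 : 0 <= B ^+ 2 by exact: sqr_ge0.
exists (L / 2 * B ^+ 2); first by rewrite mulr_ge0// divr_ge0// ltW.
move=> k f Lf; rewrite -coef_expM.
have Lg := L2_expM a Lf.
have := bessel L0 k.+1 Lg; rewrite big_ord_recr/= => H.
have s0 : 0 <= \sum_(i < k) coef L (fun x => f x * expR (a * x)) i ^+ 2.
  by apply: sumr_ge0 => i _; exact: sqr_ge0.
have H2 : sqint L (fun x => f x * expR (a * x)) <= B ^+ 2 * \int[mu]_(x in D) (f x ^+ 2).
  rewrite -RintZl//; last by case: Lf.
  apply: le_Rintegral => //; [by case: Lg|by apply: intgZ => //; case: Lf|].
  move=> x Dx; rewrite exprMn mulrC ler_wpM2r ?sqr_ge0//.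
  by rewrite -(real_normK (num_real (expR _))) lerXn2r ?nnegrE ?hB// (le_trans _ (hB x Dx)).
have {}H := le_trans H H2.
have L2 : 0 < L / 2 by rewrite divr_gt0.
rewrite -(mulrA (L / 2)) -(ler_pdivrMl _ _ L2).
apply: le_trans H; rewrite invf_div ler_wpM2l ?divr_ge0// ?(ltW L0)//.
by rewrite lerDr.
Qed.

Lemma pairing_continuous (t : R) (phi : R -> R -> R) a k : C_L2 t L phi ->
  {within `[0, t], continuous (fun s => \int[mu]_(x in D) (phi s x * mode L a k x))}.
Proof.
move=> Cphi; apply/subspace_continuousP => s /= st.
rewrite in_itv/= in st.
have [Ls cs] := Cphi s st; have [C C0 HC'] := mode_pairing_sq a; have HC := HC' k.
apply/cvgrPdist_lt => e e0.
have c0 : (fun r => C * \int[mu]_(x in D) (phi r x - phi s x) ^+ 2) @ within `[0, t] (nbhs s) --> C * 0.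
  by apply: cvgM; [exact: cvg_cst|exact: cs].
rewrite mulr0 in c0; have e2 : 0 < e ^+ 2 by rewrite exprn_gt0.
move/cvgrPdist_lt: c0 => /(_ _ e2) H; near=> r.
have rt : 0 <= r <= t.
  have : `[0, t]%classic r by near: r; exact: withinT.
  by rewrite /= in_itv.
have [Lr _] := Cphi r rt.
have Hr : `|0 - C * \int[mu]_(x in D) (phi r x - phi s x) ^+ 2| < e ^+ 2 by near: r.
rewrite sub0r normrN in Hr.
have := HC _ (L2B mD Lr Ls) => H2.
have Lm := mode_L2 L a k.
have E : \int[mu]_(x in D) ((phi r x - phi s x) * mode L a k x) =
   \int[mu]_(x in D) (phi r x * mode L a k x) - \int[mu]_(x in D) (phi s x * mode L a k x).
  rewrite -RintB//; [|exact: intg_L2M..].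
  by apply: eq_Rint => x _; rewrite mulrBl.
rewrite distrC -E -(@ltr_pXn2r _ 2) ?nnegrE// ?(ltW e0)// real_normK ?num_real//.
apply: le_lt_trans H2 _; apply: le_lt_trans Hr; exact: ler_norm.
Unshelve. all: by end_near. Qed.

Lemma adjoint_form_meas (t : R) (phi1 phi2 : R -> R -> R) (psi psi1 psi2 : R -> R) :
  measurable_fun (`]0, t[ `*` `[0, L]) (fun z : R * R => phi1 z.1 z.2) ->
  measurable_fun (`]0, t[ `*` `[0, L]) (fun z : R * R => phi2 z.1 z.2) ->
  continuous psi -> continuous psi1 -> continuous psi2 ->
  mfun `]0, t[ (fun r => adjoint_form L eps delta M (phi1 r) (phi2 r) psi psi1 psi2).
Proof.
move=> m1 m2 c c1 c2.
pose Xi (z : RM * RM) := Bstar eps delta (phi1 z.1) (phi2 z.1) z.2 * psi2 z.2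
   + delta / 2 * phi2 z.1 z.2 * psi1 z.2 - M * phi1 z.1 z.2 * psi z.2.
apply: (@section_Rint_meas _ t L Xi).
have ms (f : R -> R) : continuous f ->
    measurable_fun (`]0, t[ `*` `[0, L] : set (RM * RM)) (fun z => f z.2).
  move=> cf; apply: measurable_funTS.
  apply: (@measurableT_comp _ _ _ _ RM R f); first exact: continuous_measurable_fun.
  exact: measurable_snd.
apply: measurable_funB; last by apply: measurable_funM; [exact: measurable_funM|exact: ms].
apply: measurable_funD; last by apply: measurable_funM; [exact: measurable_funM|exact: ms].
apply: measurable_funM; last exact: ms.
by apply: measurable_funB; apply: measurable_funM.
Qed.

(** Testing with the k-th mode turns the weak formulation into the scalar
    equation g(t) - g(s) = lam_k int_s^t g for the coefficient g, by
    [adjoint_form_mode]; the exponential solves it too, and the difference of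
    the two is zero by [gronwall]. *)
Lemma adjoint_coef (t : R) (phi0 : R -> R) (phi phi1 phi2 : R -> R -> R) k : 0 <= t ->
  L2 D phi0 -> adjoint_solution L eps delta M t phi0 phi phi1 phi2 ->
  forall s, 0 <= s <= t ->
  \int[mu]_(x in D) (phi s x * mode L (m / 2) k x) =
  expR (- (lam k * (t - s))) * \int[mu]_(x in D) (phi0 x * mode L (m / 2) k x).
Proof.
move=> t0 L0' [Cphi [[m0 m1 m2] H2phi _] phit weak].
have Lm := mode_L2 L (m / 2) k.
pose g s := \int[mu]_(x in D) (phi s x * mode L (m / 2) k x).
have cg : {within `[0, t], continuous g} by exact: pairing_continuous.
have tt : 0 <= t <= t by rewrite t0 lexx.
have gt : g t = \int[mu]_(x in D) (phi0 x * mode L (m / 2) k x).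
  have [Lt _] := Cphi t tt.
  apply: Rint_ae => //; [by apply: (intg_meas mD); exact: intg_L2M..|].
  move: phit; rewrite /ae_zero => ae.
  apply: (@filterS _ _ (ae_filter_ringOfSetsType mu) _ _ _ ae) => x /= H Dx.
  by have /eqP := H Dx; rewrite subr_eq0 => /eqP ->.
have mg := within_meas cg.
have geq s : 0 <= s <= t -> g t - g s = lam k * \int[mu]_(r in `]s, t[) g r.
  move=> /andP[s0 st].
  have sub : `]s, t[ `<=` `]0, t[ by apply: subset_itv; rewrite bnd_simp.
  have Ig : intg `]s, t[ g.
    have I0 : intg `]0, t[ g.
      by apply: L2_intg; [exact: itvoo_meas|exact: itvoo_fin|exact: within_L2].
    by apply: (@integrableS _ RM _ mu `]0, t[ `]s, t[) => //; exact: itvoo_meas.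
  have := weak _ _ _ (mode_H2_H10 L0 (m / 2) k) s; rewrite s0 st => /(_ isT).
  rewrite -/(g t) -/(g s) => ->; rewrite -RintZl//.
  have mA := @adjoint_form_meas t phi1 phi2 _ _ _ m1 m2 (@cont_mode _ L (m / 2) k)
    (@cont_mode1 _ L (m / 2) k) (@cont_mode2 _ L (m / 2) k).
  apply: Rint_ae; first exact: itvoo_meas.
  - exact: (@measurable_funS _ _ RM R `]0, t[ _ _ (itvoo_meas _ _) sub mA).
  - by apply: (intg_meas (itvoo_meas s t)); apply: intgZ => //; exact: itvoo_meas.
  apply: (@filterS _ _ (ae_filter_ringOfSetsType mu) _ _ _ H2phi) => r /= Hr rst.
  exact: adjoint_form_mode (Hr (sub _ rst)).
have l0 : 0 <= lam k by rewrite ltW// decay_gt0.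
pose c := expR (- (lam k * t)) * g t.
pose E r := c * expR (lam k * r).
have ct : E t = g t by rewrite /E /c mulrAC -expRD addNr expR0 mul1r.
have dE (r : R) : is_derive r 1 E (lam k * E r).
  by have := is_derive_scale c (expM_derive (lam k) r); rewrite mulrCA.
have cE := continuous_is_derive dE.
have clE : continuous (fun r => lam k * E r).
  by move=> r; apply: cvgM; [exact: cvg_cst|exact: cE].
pose d s := g s - E s.
have cd : {within `[0, t], continuous d}.
  by move=> x; apply: cvgB; [exact: cg|exact: (cont_within cE)].
have [K dK] := within_bnd cd.
have md := within_meas cd.
have d0 : forall s, 0 <= s <= t -> d s = 0.
  apply: (@gronwall _ t (lam k) K) => //.
  move=> s st; have /andP[s0 s1] := st.
  have mI := itvoo_meas s t.
  have sub : `]s, t[ `<=` `]0, t[ by apply: subset_itv; rewrite bnd_simp.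
  have S f : L2 `]0, t[ f -> intg `]s, t[ f.
    move=> Lf; have I0 : intg `]0, t[ f.
      by apply: L2_intg => //; exact: itvoo_fin.
    by apply: (@integrableS _ RM _ mu `]0, t[ `]s, t[) => //; exact: itvoo_meas.
  have Ig : intg `]s, t[ g by apply: S; exact: within_L2.
  have IE : intg `]s, t[ E by apply: S; apply: within_L2; exact: cont_within.
  have Id : intg `]s, t[ d by apply: S; exact: within_L2.
  have dEq : d s = - (lam k * \int[mu]_(r in `]s, t[) d r).
    have F : \int[mu]_(r in `]s, t[) (lam k * E r) = E t - E s.
      exact: (@RintFTC _ s t _ E).
    rewrite RintZl// in F.
    rewrite RintB// mulrBr -geq// F ct /d; ring.
  rewrite dEq normrN normrM (ger0_norm l0) ler_wpM2l//.
  exact: le_normr_Rintegral.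
move=> s st; have /eqP := d0 s st; rewrite subr_eq0 -/(g s) => /eqP ->.
by rewrite -gt /E /c mulrAC -expRD; congr (expR _ * _); ring.
Qed.

Definition mode_flow (t : R) k (s : R) : R := expR (- (lam k * t)) * expR (lam k * s).

(** These solutions, with separated variables, are enough to determine a state
    defined by transposition. *)
Lemma mode_adjoint_solution (t : R) k : 0 <= t ->
  adjoint_solution L eps delta M t (mode L (- (m / 2)) k)
    (fun s x => mode_flow t k s * mode L (- (m / 2)) k x)
    (fun s x => mode_flow t k s * mode1 L (- (m / 2)) k x)
    (fun s x => mode_flow t k s * mode2 L (- (m / 2)) k x).
Proof.
move=> t0; set e := mode L (- (m / 2)) k; set e1 := mode1 _ _ _; set e2 := mode2 _ _ _.
have Le : L2 D e by exact: mode_L2.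
have Le1 : L2 D e1 by exact: mode1_L2.
have Le2 : L2 D e2 by exact: mode2_L2.
have ce : continuous e by exact: cont_mode.
have ce1 : continuous e1 by exact: cont_mode1.
have ce2 : continuous e2 by exact: cont_mode2.
pose E := mode_flow t k.
have dE (r : R) : is_derive r 1 E (lam k * E r).
  by have := is_derive_scale (expR (- (lam k * t))) (expM_derive (lam k) r); rewrite mulrCA.
have cE := continuous_is_derive dE.
have Et : E t = 1 by rewrite /E /mode_flow -expRD addNr expR0.
have HH s : H2_H10 L (fun x => E s * e x) (fun x => E s * e1 x) (fun x => E s * e2 x).
  have d0 (x : R) := is_derive_scale (E s) (mode_derive L (- (m / 2)) k x).
  have d1 (x : R) := is_derive_scale (E s) (mode1_derive L (- (m / 2)) k x).
  have cm (f : R -> R) : continuous f -> continuous (fun x => E s * f x).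
    by move=> cf x; apply: cvgM; [exact: cvg_cst|exact: cf].
  split; [split|by rewrite /e mode_0 mulr0|by rewrite /e mode_L// mulr0].
  - by apply: cont_within; exact: cm.
  - by apply: cont_within; exact: cm.
  - exact: L2Z.
  - by apply: (smooth_weak_derivative L0 d0); exact: cm.
  - by apply: (smooth_weak_derivative L0 d1); exact: cm.
split.
- move=> s st; split; first exact: L2Z.
  have -> : (fun r => \int[mu]_(x in D) (E r * e x - E s * e x) ^+ 2) =
      (fun r => (E r - E s) * (E r - E s) * \int[mu]_(x in D) (e x ^+ 2)).
    apply/funext => r; rewrite -RintZl//; last by case: Le.
    by apply: eq_Rint => x _; ring.
  have c0 : (fun r => E r - E s) @ within `[0, t] (nbhs s) --> (0 : R).
    rewrite -(subrr (E s)); apply: cvgB; last exact: cvg_cst.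
    by apply: cvg_trans (cE s); apply: cvg_app; exact: cvg_within.
  have := cvgM (cvgM c0 c0) (@cvg_cst _ (\int[mu]_(x in D) (e x ^+ 2)) _ (within `[0, t] (nbhs s)) _).
  by rewrite !mul0r; apply.
- split.
  + have ms (f : R -> R) : continuous f ->
        measurable_fun (`]0, t[ `*` `[0, L] : set (R * R)) (fun z => E z.1 * f z.2).
      move=> cf; apply: measurable_funTS; apply: measurable_funM.
        apply: (@measurableT_comp _ _ _ _ R R E); first exact: continuous_measurable_fun.
        exact: measurable_fst.
      apply: (@measurableT_comp _ _ _ _ R R f); first exact: continuous_measurable_fun.
      exact: measurable_snd.
    by split; exact: ms.
  + by apply: aeW => s _; exact: HH.
  + pose K := \int[mu]_(x in D) (e x ^+ 2 + e1 x ^+ 2 + e2 x ^+ 2).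
    have IK : intg D (fun x => e x ^+ 2 + e1 x ^+ 2 + e2 x ^+ 2).
      by apply: intgD => //; [apply: intgD => //; [case: Le|case: Le1]|case: Le2].
    have cEK : continuous (fun s => E s * E s * K).
      by move=> s; apply: cvgM; [apply: cvgM; exact: cE|exact: cvg_cst].
    have Iout : intg `]0, t[ (fun s => E s * E s * K).
      by apply: L2_intg; [exact: itvoo_meas|exact: itvoo_fin|apply: within_L2; exact: cont_within].
    rewrite (eq_integral (fun s : RM => (E s * E s * K)%:E)); last first.
      move=> s _; rewrite /K -RintZl// -EFin_Rint//; last exact: intgZ.
      by apply: eq_integral => x _; congr EFin; rewrite -/(E s); ring.
    exact: (integrable_lty (itvoo_meas 0 t) Iout).
- by apply: aeW => x _; rewrite -/(E t) Et mul1r subrr.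
- move=> psi psi1 psi2 Hpsi s /andP[s0 st].
  have [Lpsi Lpsi1 Lpsi2] := H2_L2 Hpsi.
  have If := intg_L2M mD Le Lpsi.
  set I := \int[mu]_(x in D) (e x * psi x).
  have EI r : \int[mu]_(x in D) (E r * e x * psi x) = E r * I.
    by rewrite -RintZl//; apply: eq_Rint => x _; rewrite mulrA.
  rewrite !EI.
  have EA r : adjoint_form L eps delta M (fun x => E r * e1 x) (fun x => E r * e2 x) psi psi1 psi2 =
      I * (lam k * E r).
    rewrite [RHS]mulrC -mulrA mulrCA -(mode_adjoint_form L0 m eps k Hpsi) -RintZl//.
      by apply: eq_Rint => x _; rewrite -/e1 -/e2 -/delta -/M /Bstar /=; ring.
    have I1 := intg_L2M mD Le2 Lpsi2; have I2 := intg_L2M mD Le1 Lpsi2.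
    have I3 := intg_L2M mD Le2 Lpsi1; have I4 := intg_L2M mD Le1 Lpsi.
    have : intg D (fun x => (eps * (e2 x * psi2 x) + - (delta / 2) * (e1 x * psi2 x)) +
       (delta / 2 * (e2 x * psi1 x) + - M * (e1 x * psi x))).
      by apply: intgD => //; apply: intgD => //; exact: intgZ.
    by congr intg; apply/funext => x; rewrite -/e1 -/e2 -/delta -/M /Bstar /=; ring.
  under eq_Rintegral do rewrite EA.
  have clE : continuous (fun r => lam k * E r).
    by move=> r; apply: cvgM; [exact: cvg_cst|exact: cE].
  rewrite RintZl; [|exact: itvoo_meas|]; last first.
    by apply: L2_intg; [exact: itvoo_meas|exact: itvoo_fin|apply: within_L2; exact: cont_within].
  by rewrite (@RintFTC _ s t _ E st dE clE); ring.
Qed.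

End Adjoint.

(** * The controlled state *)
Section State.
Context {R : realType}.
Local Notation RM := (measurableTypeR R).
Local Notation mu := (@lebesgue_measure R).
Local Notation meas := (@measurable _ RM).
Local Notation mfun := (@measurable_fun _ _ RM R).
Variables (L : R) (L0 : 0 < L) (m eps : R) (m0 : m != 0) (eps0 : 0 < eps).
Local Notation D := (`]0, L[%classic : set RM).
Let mD : meas D. Proof. exact: itvoo_meas. Qed.
Let fD : (mu D < +oo)%E. Proof. exact: itvoo_fin. Qed.
Let delta := - 2 * eps * m.
Let M := eps * m ^+ 3.
Let lam k := decay L m eps k.
Let lam_gt0 k : 0 < lam k. Proof. exact: decay_gt0. Qed.
Let freq0 k : 0 < freq L k. Proof. exact: freq_gt0. Qed.

(** A sequence of order 1 / k^2 with an explicit sum: it dominates all the series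
    of this part, and it provides the lengths of the translations in the moment
    problem. *)
Definition telescoping k : R := (k.+1%:R * k.+2%:R)^-1.

Lemma telescoping_gt0 k : 0 < telescoping k.
Proof. by rewrite invr_gt0 mulr_gt0. Qed.

Lemma sum_telescoping n : \sum_(k < n) telescoping k = 1 - n.+1%:R^-1.
Proof.
elim: n => [|n IH]; first by rewrite big_ord0 invr1 subrr.
rewrite big_ord_recr/= IH /telescoping.
have -> : n.+2%:R = n.+1%:R + 1 :> R by rewrite natr1.
have : (0 : R) < n.+1%:R by [].
by move: (n.+1%:R : R) => x x0; field; rewrite !gt_eqF// addr_gt0.
Qed.

Lemma sum_telescoping_le n : \sum_(k < n) telescoping k <= 1.
Proof. by rewrite sum_telescoping lerBlDr lerDl. Qed.

(** The ratio is of order k^(-3). *)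
Lemma freq_decay : exists2 c : R, 0 <= c & forall k, freq L k / lam k <= c * telescoping k.
Proof.
pose w := pi / L.
have w0 : 0 < w by rewrite divr_gt0// pi_gt0.
have fw k : freq L k = k.+1%:R * w by rewrite /freq /w mulrA.
exists (2 / (eps * w ^+ 3)); first by rewrite divr_ge0// mulr_ge0 ?exprn_ge0// ltW.
move=> k.
have l4 : eps * freq L k ^+ 4 <= lam k.
  have f2 : freq L k ^+ 2 <= symbol L m k by rewrite lerDr sqr_ge0.
  rewrite /lam /decay (_ : _ ^+ 4 = freq L k ^+ 2 * freq L k ^+ 2); last by ring.
  rewrite ler_wpM2l ?(ltW eps0)//; apply: ler_pM; rewrite ?sqr_ge0//.
  by apply: le_trans f2 _; rewrite lerDl sqr_ge0.
apply: (@le_trans _ _ (freq L k / (eps * freq L k ^+ 4))).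
  rewrite ler_wpM2l ?(ltW (freq0 k))// lef_pV2 ?posrE//.
  by rewrite mulr_gt0// exprn_gt0.
have n0 : (0 : R) < k.+1%:R by [].
have k1 : (1 : R) <= k.+1%:R by rewrite ler1n.
rewrite fw /telescoping -[k.+2]addn1 natrD; move: (k.+1%:R : R) n0 k1 => n n0 n1.
have -> : n * w / (eps * (n * w) ^+ 4) = (n ^+ 3)^-1 / (eps * w ^+ 3).
  by field; rewrite !gt_eqF//.
have H : (n ^+ 3)^-1 <= 2 * (n * (n + 1))^-1.
  rewrite ler_pdivlMr ?mulr_gt0 ?addr_gt0// mulrC ler_pdivrMr ?exprn_gt0//.
  have h1 : 0 <= n * (n - 1) by rewrite mulr_ge0 ?subr_ge0// ltW.
  have h2 : 0 <= n * (n * (n - 1)) by rewrite mulr_ge0// ltW.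
  by rewrite !exprS expr0; lra.
rewrite mulrAC ler_wpM2r// invr_ge0 mulr_ge0 ?exprn_ge0// ltW//.
Qed.

Variables (T : R) (T0 : 0 < T) (u y0 : R -> R) (U : R).
Hypotheses (mu_ : mfun `]0, T[ u) (uU : forall s, `]0, T[%classic s -> `|u s| <= U)
  (Ly0 : L2 D y0).

Let U0 : 0 <= U.
Proof.
apply: le_trans (uU (s := T / 2) _) => //=.
by rewrite in_itv/= divr_gt0//= ltr_pdivrMr// ltr_pMr// ltr1n.
Qed.

Definition initial k := \int[mu]_(x in D) (y0 x * mode L (- (m / 2)) k x).
Definition forcing k (t : R) := \int[mu]_(s in `]0, t[) (u s * expR (lam k * s)).
(** The k-th coefficient of the state, from the variation of constants formula. *)
Definition amplitude k (t : R) : R :=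
  expR (- (lam k * t)) * (initial k + freq L k * forcing k t).

Lemma initial_sq : exists2 C : R, 0 <= C & forall n, \sum_(k < n) initial k ^+ 2 <= C.
Proof.
have Lg := L2_expM (- (m / 2)) Ly0.
exists (L / 2 * sqint L (fun x => y0 x * expR (- (m / 2) * x))).
  rewrite mulr_ge0 ?divr_ge0 ?(ltW L0)//.
  by apply: Rintegral_ge0 => x _; exact: sqr_ge0.
move=> n; have := bessel L0 n Lg.
have L2' : 0 < L / 2 by rewrite divr_gt0.
rewrite -(ler_pdivrMl _ _ L2') invf_div; congr (_ <= _); congr (_ * _).
by apply: eq_bigr => k _; rewrite coef_expM.
Qed.

Let sub t : t <= T -> `]0, t[ `<=` `]0, T[.
Proof. by move=> tT; apply: subset_itv; rewrite bnd_simp. Qed.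

Lemma expM_intg (a c t : R) : intg `]a, t[ (fun s => expR (c * s)).
Proof.
apply: L2_intg; [exact: itvoo_meas|exact: itvoo_fin|].
by apply: within_L2; apply: cont_within; exact: cont_expM.
Qed.

Lemma forcing_intg c t : t <= T -> intg `]0, t[ (fun s => u s * expR (c * s)).
Proof.
move=> tT; apply: (@intgM_bndl _ _ _ _ U) => //.
- exact: expM_intg.
- exact: (@measurable_funS _ _ RM R `]0, T[ _ _ (itvoo_meas _ _) (sub tT) mu_).
- by move=> s /(sub tT) /uU.
Qed.

Lemma forcing_abs k t : 0 <= t <= T ->
  \int[mu]_(s in `]0, t[) `|u s * expR (lam k * s)| <= U * (expR (lam k * t) / lam k).
Proof.
move=> /andP[t0 tT].
have l0 := lt0r_neq0 (lam_gt0 k).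
have E : \int[mu]_(s in `]0, t[) expR (lam k * s) =
    (lam k)^-1 * expR (lam k * t) - (lam k)^-1 * expR (lam k * 0).
  apply: (@RintFTC _ 0 t _ (fun s => (lam k)^-1 * expR (lam k * s))) => //.
    move=> s; have := is_derive_scale (lam k)^-1 (expM_derive (lam k) s).
    by rewrite mulKf.
  exact: cont_expM.
apply: (@le_trans _ _ (\int[mu]_(s in `]0, t[) (U * expR (lam k * s)))).
  apply: le_Rintegral; first exact: itvoo_meas.
  - by apply: integrable_norm; exact: forcing_intg.
  - by apply: intgZ; [exact: itvoo_meas|exact: expM_intg].
  move=> s st; rewrite normrM (ger0_norm (expR_ge0 _)) ler_wpM2r ?expR_ge0//.
  exact: uU (sub tT st).
rewrite RintZl; [|exact: itvoo_meas|exact: expM_intg].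
rewrite ler_wpM2l// E mulr0 expR0 mulr1 mulrC lerBlDr lerDl invr_ge0.
exact: ltW.
Qed.

Lemma forced_part_le : exists2 c : R, 0 <= c & forall k t, 0 <= t <= T ->
  `|expR (- (lam k * t)) * (freq L k * forcing k t)| <= c * telescoping k.
Proof.
have [c c0 hc] := freq_decay; exists (U * c); first exact: mulr_ge0.
move=> k t tT; have /andP[t0 t1] := tT.
rewrite (normrM (expR _)) (normrM (freq L k)) (ger0_norm (expR_ge0 _)) (gtr0_norm (freq0 k)).
have H := le_trans (le_normr_Rintegral (itvoo_meas 0 t) (forcing_intg (lam k) t1)) (forcing_abs k tT).
apply: (@le_trans _ _ (expR (- (lam k * t)) * (freq L k * (U * (expR (lam k * t) / lam k))))).
  by rewrite ler_wpM2l ?expR_ge0// ler_wpM2l// ltW.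
rewrite (_ : _ * _ = U * (freq L k / lam k) * (expR (- (lam k * t)) * expR (lam k * t))); last by ring.
by rewrite -expRD addNr expR0 mulr1 -mulrA ler_wpM2l.
Qed.

Lemma amplitude0 k : amplitude k 0 = initial k.
Proof.
by rewrite /amplitude /forcing set_itvoo0 Rintegral_set0 !mulr0 oppr0 expR0 addr0 mul1r.
Qed.

Lemma amplitude_le : exists2 c : R, 0 <= c & forall k t, 0 <= t <= T ->
  `|amplitude k t| <= `|initial k| + c * telescoping k.
Proof.
have [c c0 hc] := forced_part_le; exists c => // k t tT.
rewrite /amplitude mulrDr; apply: le_trans (ler_normD _ _) _.
rewrite lerD ?hc// normrM (ger0_norm (expR_ge0 _)) ler_piMl//.
rewrite -expR0 ler_expR oppr_le0 mulr_ge0 ?(ltW (lam_gt0 k))//.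
by have /andP[] := tT.
Qed.

(** For t > 0 the decay e^(- lam_k t) <= 1 / (lam_k t) makes up for the initial
    coefficients being only square-summable. *)
Lemma amplitude_summable t : 0 < t <= T ->
  exists C, forall n, \sum_(k < n) `|amplitude k t| <= C.
Proof.
move=> /andP[t0 tT].
have [c c0 hc] := forced_part_le; have [c' c'0 hc'] := freq_decay.
have [Cb Cb0 hb] := initial_sq.
have bB k : `|initial k| <= 1 + Cb.
  have : initial k ^+ 2 <= Cb.
    apply: le_trans (hb k.+1); rewrite big_ord_recr/= lerDr.
    by apply: sumr_ge0 => i _; exact: sqr_ge0.
  rewrite -(real_normK (num_real _)); move: (normr_ge0 (initial k)).
  by move: (`|initial k|) => z *; nra.
pose K := (1 + Cb) * (c' / freq L 0 / t).
have K0 : 0 <= K.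
  apply: mulr_ge0; first by rewrite addr_ge0.
  by apply: divr_ge0; [apply: divr_ge0 => //|]; exact: ltW.
exists (K + c) => n; apply: (@le_trans _ _ (\sum_(k < n) (K + c) * telescoping k)); last first.
  by rewrite -mulr_sumr -[leRHS]mulr1 ler_wpM2l ?addr_ge0// sum_telescoping_le.
apply: ler_sum => k _; rewrite /amplitude mulrDr; apply: le_trans (ler_normD _ _) _.
rewrite [leRHS]mulrDl lerD//; last by apply: hc; rewrite (ltW t0).
rewrite normrM (ger0_norm (expR_ge0 _)) mulrC /K -(mulrA (1 + Cb)).
apply: ler_pM => //; rewrite ?expR_ge0//.
have lt : 0 < lam k * t by rewrite mulr_gt0.
apply: (@le_trans _ _ (lam k * t)^-1).
  rewrite expRN lef_pV2 ?posrE ?expR_gt0//.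
  by apply: le_trans (expR_ge1Dx _); rewrite lerDr.
rewrite invfM -mulrA (mulrC t^-1) mulrA ler_wpM2r ?invr_ge0 ?(ltW t0)//.
rewrite mulrAC ler_pdivlMr//; apply: le_trans (hc' k); rewrite mulrC ler_wpM2r ?invr_ge0 ?(ltW (lam_gt0 k))//.
rewrite /freq ler_wpM2r ?invr_ge0 ?(ltW L0)// ler_wpM2r ?pi_ge0//.
by rewrite ler_nat.
Qed.

(** At t = 0 the coefficients are those of y0, which need not be absolutely
    summable, and y0 itself is taken. *)
Lemma state_exists t : exists f : R -> R, 0 <= t <= T ->
  L2 D f /\ forall k, \int[mu]_(x in D) (f x * mode L (- (m / 2)) k x) = amplitude k t.
Proof.
have [t0|] := boolP (0 < t <= T); last first.
  move=> nt; exists y0 => /andP[t0 tT]; split => // k.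
  have -> : t = 0.
    by apply/eqP; move: nt; rewrite tT andbT -leNgt eq_le => ->.
  by rewrite amplitude0.
have [C hC] := amplitude_summable t0.
have [F [mF [B FB] cF]] := @coef_surj _ _ L0 (amplitude ^~ t) C hC.
exists (fun x => F x * expR (m / 2 * x)) => _; split.
  by apply: L2_expM; exact: (@L2_bnd _ _ _ B).
move=> k; rewrite -cF; apply: eq_Rint => x _; rewrite /mode mulrA -(mulrA (F x)).
by rewrite -expRD -mulrDl subrr mul0r expR0 mulr1.
Qed.

Definition state t : R -> R := projT1 (cid (state_exists t)).

Lemma state_L2 t : 0 <= t <= T -> L2 D (state t).
Proof. by move=> tT; have [] := projT2 (cid (state_exists t)) tT. Qed.

Lemma state_mode t k : 0 <= t <= T ->
  \int[mu]_(x in D) (state t x * mode L (- (m / 2)) k x) = amplitude k t.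
Proof. by move=> tT; have [_] := projT2 (cid (state_exists t)) tT. Qed.

Lemma forcing_continuous k : {within `[0, T], continuous (forcing k)}.
Proof.
pose f := (fun s => u s * expR (lam k * s)) \_ (`]0, T[ : set RM).
have mI := itvoo_meas 0 T.
have If : mu.-integrable `[0, T] (EFin \o f).
  have : mu.-integrable setT (EFin \o f).
    rewrite /f -restrict_EFin; apply/(integrable_mkcond _ mI).
    exact: forcing_intg.
  by apply: integrableS => //; exact: measurable_itv.
have := parameterized_integral_continuous (ltW T0) If.
apply: subspace_eq_continuous => t /=; rewrite inE /= in_itv/= => /andP[t0 tT].
rewrite /from_subspace /parameterized_integral /forcing.
have -> : \int[mu]_(s in `]0, t[) (u s * expR (lam k * s)) = \int[mu]_(s in `]0, t[) f s.
  by apply: eq_Rint => s /(sub tT) sT; rewrite /f patchE mem_set.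
have IS (J : interval R) : [set` J] `<=` `[0, T] -> mu.-integrable [set` J] (EFin \o f).
  by move=> s; apply: integrableS If => //; exact: measurable_itv.
rewrite Rintegral_itv_bndo_bndc; last first.
  by apply: IS; apply: subset_itv; rewrite bnd_simp.
rewrite Rintegral_itv_obnd_cbnd//.
by apply: IS; apply: subset_itv; rewrite bnd_simp.
Qed.

Lemma amplitude_continuous k : {within `[0, T], continuous (amplitude k)}.
Proof.
have ce : {within `[0, T], continuous (fun t => expR (- lam k * t))}.
  by apply: cont_within; exact: cont_expM.
have -> : amplitude k = (fun t => expR (- lam k * t) * (initial k + freq L k * forcing k t)).
  by apply/funext => t; rewrite /amplitude mulNr.
move=> x; apply: cvgM; first exact: ce.
apply: cvgD; first exact: cvg_cst.
apply: cvgM; first exact: cvg_cst.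
exact: forcing_continuous.
Qed.

(** Up to the weight e^(m x / 2), the squared distance between two states is by
    Parseval the sum of the squared differences of amplitudes.  Each of these is
    continuous in time, and they are dominated by a summable sequence. *)
Lemma state_C_L2 : C_L2 T L state.
Proof.
move=> s sT; split; first exact: state_L2.
have [B hB] := expM_bnd L (m / 2).
have [c c0 hc] := amplitude_le; have [Cb Cb0 hb] := initial_sq.
pose d r (x : R) := (state r x - state s x) * expR (- (m / 2) * x).
pose F : set_system R := within `[0, T] (nbhs s).
have FT : F `[0, T]%classic by exact: withinT.
have FF : ProperFilter F.
  by apply: within_nbhs_proper; apply: subset_closure; rewrite /= in_itv.
have Ld r : 0 <= r <= T -> L2 D (d r).
  by move=> rT; apply: L2_expM; apply: L2B => //; exact: state_L2.
have cd r k : 0 <= r <= T -> coef L (d r) k = amplitude k r - amplitude k s.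
  move=> rT; rewrite coef_expM -!state_mode//.
  have Lm := mode_L2 L (- (m / 2)) k.
  rewrite -RintB//; [|by apply: intg_L2M => //; exact: state_L2..].
  by apply: eq_Rint => x _; rewrite mulrBl.
have cS : (fun r => sqint L (d r)) @ F --> (0 : R).
  (* (2 (i + c p))^2 <= 8 i^2 + 8 c^2 p^2, and p^2 <= p *)
  apply: (@tannery _ _ F FF (fun k r => 2 / L * (amplitude k r - amplitude k s) ^+ 2) _
    (fun k => 2 / L * (8 * initial k ^+ 2 + 8 * c ^+ 2 * telescoping k))
    (2 / L * (8 * Cb + 8 * c ^+ 2)) _ FT).
  - move=> k r; rewrite /= in_itv/= => rT; apply/andP; split.
      by rewrite mulr_ge0 ?sqr_ge0// divr_ge0// ltW.
    rewrite ler_wpM2l ?divr_ge0 ?(ltW L0)//.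
    have h1 := hc k r rT; have h2 := hc k s sT.
    have t1 : telescoping k ^+ 2 <= telescoping k.
      rewrite expr2 ler_piMl ?(ltW (telescoping_gt0 k))//.
      by rewrite invf_le1 ?mulr_gt0// -natrM ler1n.
    have h3 : `|amplitude k r - amplitude k s| <= 2 * (`|initial k| + c * telescoping k).
      by apply: le_trans (ler_normB _ _) _; rewrite mulr2n mulrDl mul1r lerD.
    rewrite -(real_normK (num_real (_ - _))).
    apply: (@le_trans _ _ ((2 * (`|initial k| + c * telescoping k)) ^+ 2)).
      rewrite lerXn2r ?nnegrE// mulr_ge0// addr_ge0// mulr_ge0// ltW//.
      exact: telescoping_gt0.
    rewrite -(real_normK (num_real (initial k))).
    have c2 : c ^+ 2 * telescoping k ^+ 2 <= c ^+ 2 * telescoping k.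
      by rewrite ler_wpM2l ?sqr_ge0.
    have := sqr_ge0 (`|initial k| - c * telescoping k).
    by move: (`|initial k|) (telescoping k) c2 => z w; nra.
  - move=> n; rewrite -mulr_sumr ler_wpM2l ?divr_ge0 ?(ltW L0)//.
    rewrite big_split/= -!mulr_sumr; apply: lerD; first by rewrite ler_wpM2l ?hb.
    by apply: ler_piMr; [rewrite mulr_ge0 ?sqr_ge0|exact: sum_telescoping_le].
  - move=> r; rewrite /= in_itv/= => rT.
    have := parseval L0 (Ld r rT).
    rewrite (_ : (fun n => 2 / L * _) = (fun n =>
      \sum_(k < n) 2 / L * (amplitude k r - amplitude k s) ^+ 2)) //.
    by apply/funext => n; rewrite mulr_sumr; apply: eq_bigr => k _; rewrite cd.
  - move=> k.
    have ck := @amplitude_continuous k.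
    move/subspace_continuousP: ck => /(_ s); rewrite /= in_itv/= => /(_ sT) ck.
    have c1 : (fun r => amplitude k r - amplitude k s) @ F --> (0 : R).
      by rewrite -(subrr (amplitude k s)); apply: cvgB; [exact: ck|exact: cvg_cst].
    have := cvgM (@cvg_cst _ (2 / L : R) _ F _) (cvgM c1 c1).
    by rewrite !mulr0; apply.
have cB : (fun r => B ^+ 2 * sqint L (d r)) @ F --> (0 : R).
  by have := cvgM (@cvg_cst _ (B ^+ 2 : R) _ F _) cS; rewrite mulr0; apply.
apply: squeeze_cvgr cB; last exact: cvg_cst.
apply: filterS FT => r; rewrite /= in_itv/= => rT.
apply/andP; split; first by apply: Rintegral_ge0 => x _; exact: sqr_ge0.
rewrite -RintZl//; last by case: (Ld r rT).
apply: le_Rintegral => //.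
- by have [_] := L2B mD (state_L2 rT) (state_L2 sT).
- by apply: intgZ => //; case: (Ld r rT).
move=> x Dx.
have -> : state r x - state s x = d r x * expR (m / 2 * x).
  by rewrite /d -mulrA -expRD -mulrDl addNr mul0r expR0 mulr1.
rewrite exprMn mulrC ler_wpM2r ?sqr_ge0//.
by rewrite -(real_normK (num_real (expR _))) lerXn2r ?nnegrE ?hB// (le_trans _ (hB x Dx)).
Qed.

Lemma trace_meas (t : R) (phi1 : R -> R -> R) :
  measurable_fun (`]0, t[ `*` `[0, L]) (fun z : R * R => phi1 z.1 z.2) ->
  mfun `]0, t[ (fun s => phi1 s 0).
Proof.
move=> m1.
pose E : set (RM * RM) := `]0, t[ `*` `[0, L].
have mE : measurable E by apply: measurableX; exact: measurable_itv.
apply: (@measurable_comp _ _ _ RM (RM * RM)%type R E (fun z => phi1 z.1 z.2) `]0, t[ (fun s => (s, 0))) => //.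
- by move=> _ [s st <-]; split => //=; rewrite in_itv/= lexx ltW.
- by apply: measurable_funTS; apply: measurable_fun_pair => //; exact: measurable_cst.
Qed.

(** Both sides are expanded: the two pairings by Parseval's identity for modes,
    the control term by [trace_series] and termwise integration in time.  The
    k-th terms agree by the definition of the amplitudes. *)
Lemma state_transposition : transposition_solution L T eps delta M y0 u state.
Proof.
move=> t tT; have /andP[t0 t1] := tT.
have Ls := state_L2 tT; split => // phi0 Lphi0 phi phi1 phi2 Hadj.
have coefE := adjoint_coef L0 eps0 _ t0 Lphi0 Hadj.
have [Cphi [[_ m1 _] H2phi _] _ _] := Hadj.
pose c k := \int[mu]_(x in D) (phi0 x * mode L (m / 2) k x).
pose g k s := 2 / L * freq L k * c k * expR (- (lam k * t)) * (u s * expR (lam k * s)).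
have mI := itvoo_meas 0 t.
have Ig k : intg `]0, t[ (g k) by apply: intgZ => //; exact: forcing_intg.
have gE k : \int[mu]_(s in `]0, t[) g k s =
    2 / L * freq L k * c k * expR (- (lam k * t)) * forcing k t.
  by rewrite RintZl//; exact: forcing_intg.
have [C C0 hC] := mode_pairing_sq L0 (m / 2).
have [c' c'0 hc'] := freq_decay.
pose K := 1 + C * \int[mu]_(x in D) (phi0 x ^+ 2).
have K0 : 0 <= K.
  by rewrite addr_ge0// mulr_ge0//; apply: Rintegral_ge0 => x _; exact: sqr_ge0.
have cK k : `|c k| <= K.
  have := hC k _ Lphi0; rewrite -/(c k) /K.
  rewrite -(real_normK (num_real (c k))); move: (normr_ge0 (c k)).
  by move: (`|c k|) (C * _) => z w *; nra.
have lim3 : (fun n => \sum_(k < n) \int[mu]_(s in `]0, t[) g k s) @ \oo -->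
    \int[mu]_(s in `]0, t[) (u s * phi1 s 0).
  apply: (@Rint_series _ _ g (fun k => 2 / L * K * U * c' * telescoping k) (2 / L * K * U * c')) => //.
  - move=> k.
    have -> : \int[mu]_(s in `]0, t[) `|g k s| =
        2 / L * freq L k * `|c k| * expR (- (lam k * t)) * \int[mu]_(s in `]0, t[) `|u s * expR (lam k * s)|.
      rewrite -RintZl//; last by apply: integrable_norm; exact: forcing_intg.
      apply: eq_Rint => s _; rewrite /g normrM; congr (_ * _).
      rewrite (normrM _ (expR _)) (ger0_norm (expR_ge0 _)); congr (_ * _).
      rewrite (normrM _ (c k)); congr (_ * _).
      apply: ger0_norm; apply: mulr_ge0; last exact: ltW.
      by apply: divr_ge0 => //; exact: ltW.
    apply: (@le_trans _ _ (2 / L * freq L k * `|c k| * expR (- (lam k * t)) *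
        (U * (expR (lam k * t) / lam k)))).
      rewrite ler_wpM2l ?forcing_abs//; apply: mulr_ge0; last exact: expR_ge0.
      apply: mulr_ge0 => //; apply: mulr_ge0; last exact: ltW.
      by apply: divr_ge0 => //; exact: ltW.
    rewrite (_ : _ * _ = 2 / L * (`|c k| * U * (freq L k / lam k)) * (expR (- (lam k * t)) * expR (lam k * t))); last by ring.
    rewrite -expRD addNr expR0 mulr1 -!(mulrA (2 / L)) ler_wpM2l ?divr_ge0 ?(ltW L0)//.
    rewrite -(mulrA (K * U)); apply: ler_pM => //.
    + exact: mulr_ge0.
    + by rewrite divr_ge0// ltW.
    + by rewrite ler_wpM2r.
  - move=> n; rewrite -mulr_sumr; apply: ler_piMr; last exact: sum_telescoping_le.
    by rewrite !mulr_ge0// invr_ge0 ltW.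
  - apply: measurable_funM; last exact: trace_meas.
    exact: (@measurable_funS _ _ RM R `]0, T[ _ _ (itvoo_meas _ _) (sub t1) mu_).
  apply: (@filterS _ _ (ae_filter_ringOfSetsType mu) _ _ _ H2phi) => s /= Hs st.
  have sT : 0 <= s <= t by move: st; rewrite in_itv/= => /andP[s0 s1]; rewrite !ltW.
  have := cvgM (@cvg_cst _ (u s) _ \oo _) (trace_series L0 m0 (Hs st)).
  rewrite (_ : _ \* _ = (fun n => \sum_(i < n) g i s)); first by apply.
  apply/funext => n /=; rewrite mulr_sumr mulr_sumr; apply: eq_bigr => k _.
  rewrite coefE// /g -/(c k) (_ : - (decay L m eps k * (t - s)) = - (lam k * t) + lam k * s).
    by rewrite expRD; ring.
  by rewrite /lam; ring.
have z0 : 0 <= (0 : R) <= t by rewrite lexx.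
have Lphi00 : L2 D (phi 0) by have [] := Cphi _ z0.
have lim2 := parseval_mode L0 (m / 2) Lphi00 Ly0.
have lim1 := parseval_mode L0 (m / 2) Lphi0 Ls.
have lim23 := cvgD lim2 lim3.
have E1 : \int[mu]_(x in D) (state t x * phi0 x) = \int[mu]_(x in D) (phi0 x * state t x).
  by apply: eq_Rint => x _; rewrite mulrC.
have E2 : \int[mu]_(x in D) (y0 x * phi 0 x) = \int[mu]_(x in D) (phi 0 x * y0 x).
  by apply: eq_Rint => x _; rewrite mulrC.
rewrite E1 E2; apply: (cvg_unique _ lim1) => //.
rewrite (_ : (fun n => 2 / L * _) = (fun n =>
  2 / L * \sum_(k < n) (\int[mu]_(x in D) (phi 0 x * mode L (m / 2) k x)) *
     (\int[mu]_(x in D) (y0 x * mode L (- (m / 2)) k x)) +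
  \sum_(k < n) \int[mu]_(s in `]0, t[) g k s)); first exact: lim23.
apply/funext => n; rewrite !mulr_sumr -big_split/=; apply: eq_bigr => k _.
rewrite gE state_mode// coefE// subr0 -/(c k) -/(lam k) -/(initial k) /amplitude.
by ring.
Qed.

(** The separated adjoint solutions determine every coefficient of y(T), for any
    solution y and not only for [state]. *)
Lemma transposition_null (y : R -> R -> R) :
  (forall k, forcing k T = - initial k / freq L k) ->
  transposition_solution L T eps delta M y0 u y -> ae_zero D (y T).
Proof.
move=> hF /(_ T); rewrite (ltW T0) lexx => /(_ isT) [LyT Hy].
apply: (@mode_complete _ _ L0 _ (- (m / 2))) => // k.
have := Hy _ (mode_L2 L (- (m / 2)) k) _ _ _ (mode_adjoint_solution L0 m eps k (ltW T0)).
move=> ->; rewrite mode1_0.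
have -> : \int[mu]_(x in D) (y0 x * (mode_flow L m eps T k 0 * mode L (- (m / 2)) k x)) =
    expR (- (lam k * T)) * initial k.
  have I := intg_L2M mD Ly0 (mode_L2 L (- (m / 2)) k).
  rewrite -RintZl//; apply: eq_Rint => x _.
  by rewrite /mode_flow mulr0 expR0 -/(lam k); ring.
have -> : \int[mu]_(s in `]0, T[) (u s * (mode_flow L m eps T k s * freq L k)) =
    expR (- (lam k * T)) * freq L k * forcing k T.
  rewrite -RintZl//; last by apply: forcing_intg.
  by apply: eq_Rint => s _; rewrite /mode_flow -/(lam k); ring.
by rewrite hF; field; rewrite gt_eqF.
Qed.

End State.

(** * The critical dispersion coefficient and the spectral gaps *)
Section Constants.
Context {R : realType}.

Lemma cbrt_cube (a : R) : cbrt a ^+ 3 = a.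
Proof.
have p3 : (`|a| `^ 3^-1) ^+ 3 = `|a|.
  by rewrite -powR_mulrn ?powR_ge0// -powRrM mulVf ?pnatr_eq0// powRr1.
rewrite /cbrt exprMn p3 exprS sqr_sg; have [->|a0] := eqVneq a 0.
  by rewrite normr0 mulr0.
by rewrite mulr1 -numEsg.
Qed.

(** m is the real cube root of M / eps. *)
Lemma critical_factor (eps M : R) : 0 < eps -> M != 0 -> exists2 m, m != 0 &
  critical_delta eps M = - 2 * eps * m /\ M = eps * m ^+ 3.
Proof.
move=> eps0 M0; pose r := eps `^ 3^-1.
have r0 : 0 < r by rewrite powR_gt0.
have r3 : r ^+ 3 = eps.
  by rewrite -powR_mulrn ?ltW// -powRrM mulVf ?pnatr_eq0// powRr1// ltW.
have r2 : eps `^ (2 / 3) = r ^+ 2 by rewrite mulrC powRrM powR_mulrn// ltW.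
exists (cbrt M / r).
  apply: mulf_neq0; last by rewrite invr_eq0 gt_eqF.
  by apply/eqP => E; move/eqP: M0; apply; rewrite -(cbrt_cube M) E expr0n.
have eb : eps * (cbrt M / r) = r ^+ 2 * cbrt M.
  by rewrite -[in LHS]r3; field; rewrite gt_eqF.
split; first by rewrite /critical_delta r2 -mulrA -[in RHS]mulrA eb mulrA.
have -> : eps * (cbrt M / r) ^+ 3 = eps * (cbrt M / r) * (cbrt M / r) ^+ 2 by ring.
rewrite eb -[LHS](cbrt_cube M); field; by rewrite gt_eqF.
Qed.

(** The leading part of the eigenvalues is eps w_k^4, and n^4 - j^4 >= n^3 for
    j < n. *)
Lemma decay_gap (L m eps : R) : 0 < L -> 0 < eps -> exists2 c, 0 < c &
  forall j n, (j < n)%N -> c * n.+1%:R ^+ 3 <= decay L m eps n - decay L m eps j.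
Proof.
move=> L0 eps0; pose w := pi / L.
have w0 : 0 < w by rewrite divr_gt0// pi_gt0.
exists (eps * w ^+ 4); first by rewrite mulr_gt0// exprn_gt0.
move=> j n jn; rewrite /decay /symbol /freq.
have fw k : k.+1%:R * pi / L = k.+1%:R * w by rewrite /w mulrA.
rewrite !fw; set N : R := n.+1%:R; set J : R := j.+1%:R.
have J0 : 0 <= J by [].
have JN : J + 1 <= N by rewrite /J /N natr1 ler_nat ltnS.
have N0 : 0 <= N by [].
have N3 : N ^+ 3 <= N ^+ 4 - J ^+ 4.
  have J3 : J ^+ 3 <= N ^+ 3 by rewrite lerXn2r ?nnegrE//; lra.
  have N30 : 0 <= N ^+ 3 by exact: exprn_ge0.
  have h1 : J * J ^+ 3 <= J * N ^+ 3 by rewrite ler_wpM2l.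
  have h2 : (J + 1) * N ^+ 3 <= N * N ^+ 3 by rewrite ler_wpM2r.
  by rewrite !(exprS _ 3); lra.
have N2 : J ^+ 2 <= N ^+ 2 by rewrite lerXn2r ?nnegrE//; lra.
have h : w ^+ 4 * N ^+ 3 <= w ^+ 4 * (N ^+ 4 - J ^+ 4) by rewrite ler_wpM2l// exprn_ge0// ltW.
have h' : 0 <= w ^+ 2 * (N ^+ 2 - J ^+ 2) * (2 * (m / 2) ^+ 2 + m ^+ 2).
  apply: mulr_ge0; first by apply: mulr_ge0; [exact: sqr_ge0|rewrite subr_ge0].
  by apply: addr_ge0; [apply: mulr_ge0 => //|]; exact: sqr_ge0.
rewrite -mulrA -mulrBr ler_wpM2l ?(ltW eps0)//.
apply: le_trans h _; rewrite -subr_ge0; move: h'.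
by congr (_ <= _); ring.
Qed.

End Constants.

Theorem theorem1 (R : realType) (M : R) (hM : M != 0) (L T eps : R)
    (hL : 0 < L) (hT : 0 < T) (heps : 0 < eps) :
  let delta := critical_delta eps M in
  forall y0 : R -> R, L2 `]0, L[ y0 ->
  exists u : R -> R,
    [/\ L2 `]0, T[ u,
        exists y : R -> R -> R,
          C_L2 T L y /\ transposition_solution L T eps delta M y0 u y &
        forall y : R -> R -> R,
          transposition_solution L T eps delta M y0 u y ->
          ae_zero `]0, L[ (y T)].
Proof.
move=> delta y0 Ly0; have [m m0 [dE ME]] := critical_factor heps hM.
rewrite /delta dE [M in transposition_solution _ _ _ _ M]ME.
(* half of the time for the initial indicator, half for its translates *)
have T2 : 0 < T / 2 by rewrite divr_gt0.
have [c c0 gap] := decay_gap m hL heps.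
have [Cb Cb0 hb] := initial_sq hL m Ly0.
pose a k := - initial L m y0 k / freq L k.
have f0 : 0 < freq L 0 by exact: freq_gt0.
have aA k : `|a k| <= (1 + Cb) / freq L 0.
  have bB : `|initial L m y0 k| <= 1 + Cb.
    have : initial L m y0 k ^+ 2 <= Cb.
      apply: le_trans (hb k.+1); rewrite big_ord_recr/= lerDr.
      by apply: sumr_ge0 => i _; exact: sqr_ge0.
    rewrite -(real_normK (num_real (initial L m y0 k))).
    move: (normr_ge0 (initial L m y0 k)).
    by move: (`|initial L m y0 k|) => z *; nra.
  rewrite /a normrM normrN normfV (gtr0_norm (freq_gt0 hL k)).
  apply: ler_pM => //; first by rewrite invr_ge0 ltW// freq_gt0.
  rewrite lef_pV2 ?posrE ?freq_gt0// /freq.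
  by rewrite ler_wpM2r ?invr_ge0 ?(ltW hL)// ler_wpM2r ?pi_ge0// ler_nat.
pose h j : R := T / 2 * telescoping j.
have h0 j : 0 < h j by rewrite mulr_gt0// telescoping_gt0.
have hsum n : \sum_(j < n) h j + T / 2 <= T.
  rewrite -mulr_sumr [leRHS]splitr lerD2r ler_piMr ?(ltW T2)//.
  exact: sum_telescoping_le.
have lamI j n : (j < n)%N -> decay L m eps j < decay L m eps n.
  move=> jn; rewrite -subr_gt0; apply: lt_le_trans (gap j n jn).
  by rewrite mulr_gt0// exprn_gt0.
(* the gap is at least c (n + 1)^3 and h j at least T / (2 (n + 1)^2) *)
have [N0 _ HN0] := nbhs_infty_ger (6 / (c * (T / 2))).
have lamh j n : (j < n)%N -> (N0 <= n)%N -> 6 <= (decay L m eps n - decay L m eps j) * h j.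
  move=> jn Nn.
  have cT : 0 < c * (T / 2) by rewrite mulr_gt0.
  have := HN0 n Nn; rewrite /= ler_pdivrMr// => n6.
  have n0 : (0 : R) < n.+1%:R by [].
  apply: (@le_trans _ _ (c * n.+1%:R ^+ 3 * (T / 2 * (n.+1%:R ^+ 2)^-1))); last first.
    apply: ler_pM; [by rewrite mulr_ge0 ?exprn_ge0// ltW| |exact: gap|].
      by rewrite mulr_ge0 ?invr_ge0 ?exprn_ge0// ltW.
    rewrite ler_wpM2l ?(ltW T2)// lef_pV2 ?posrE ?exprn_gt0// ?mulr_gt0//.
    by rewrite expr2; apply: ler_pM => //; rewrite ler_nat ltnS// ltnW.
  apply: le_trans n6 _.
  rewrite (_ : c * n.+1%:R ^+ 3 * (T / 2 * (n.+1%:R ^+ 2)^-1) = n.+1%:R * (c * (T / 2))).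
    by rewrite ler_wpM2r ?(ltW cT)// ler_nat.
  by field; rewrite gt_eqF.
have [u [mu_ [U uU] hu]] := @moment_problem R (decay L m eps) h a T (T / 2) _ N0
  T2 h0 hsum (decay_gt0 hL m heps) lamI lamh aA.
exists u; split.
- by apply: (@L2_bnd _ _ _ U) => //; exact: itvoo_fin.
- exists (state hL m heps hT mu_ uU Ly0); split.
    exact: state_C_L2.
  exact: state_transposition.
- move=> y; apply: (transposition_null hL hT mu_ uU Ly0) => k; exact: hu.
Qed.
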